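(* Let $H$ be a quasi-Hopf algebra over a field $k$ and $(\mathbb{A},\lambda,\rho,\Phi_\lambda,\Phi_\rho,\Phi_{\lambda,\rho})$ an $H$-bicomodule algebra. Define two right $H^{\rm op}\otimes H$-coactions $\rho_1,\rho_2:\mathbb{A}\to\mathbb{A}\otimes(H^{\rm op}\otimes H)$ and corresponding elements $\Phi_{\rho_1},\Phi_{\rho_2}\in\mathbb{A}\otimes(H^{\rm op}\otimes H)\otimes(H^{\rm op}\otimes H)$ by $$\rho_1(u)=u_{\langle0\rangle_{[0]}}\otimes\big(S^{-1}(u_{\langle0\rangle_{[-1]}})\otimes u_{\langle1\rangle}\big),$$ $$\Phi_{\rho_1}=(\tilde X^1_\rho)_{[0]}\tilde x^3_\lambda\theta^2_{[0]}\otimes\big(S^{-1}(f^2(\tilde X^1_\rho)_{[-1]_2}\tilde x^2_\lambda\theta^2_{[-1]})\otimes\tilde X^2_\rho\theta^3\big)\otimes\big(S^{-1}(f^1(\tilde X^1_\rho)_{[-1]_1}\tilde x^1_\lambda\theta^1)\otimes\tilde X^3_\rho\big),$$ and $$\rho_2(u)=u_{[0]_{\langle0\rangle}}\otimes\big(S^{-1}(u_{[-1]})\otimes u_{[0]_{\langle1\rangle}}\big),$$ $$\Phi_{\rho_2}=(\tilde x^3_\lambda)_{\langle0\rangle}\tilde X^1_\rho\Theta^2_{\langle0\rangle}\otimes\big(S^{-1}(f^2\tilde x^2_\lambda\Theta^1)\otimes(\tilde x^3_\lambda)_{\langle1\rangle_1}\tilde X^2_\rho\Theta^2_{\langle1\rangle}\big)\otimes\big(S^{-1}(f^1\tilde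 x^1_\lambda)\otimes(\tilde x^3_\lambda)_{\langle1\rangle_2}\tilde X^3_\rho\Theta^3\big).$$ Then $(\mathbb{A},\rho_1,\Phi_{\rho_1})$ and $(\mathbb{A},\rho_2,\Phi_{\rho_2})$ are twist equivalent right $H^{\rm op}\otimes H$-comodule algebras.
   Context: $k$ is a field, $\otimes=\otimes_k$; algebras are associative and unital; summation is implicit. Quasi-bialgebra $(H,\Delta,\varepsilon,\Phi)$: an algebra $H$, algebra maps $\Delta:H\to H\otimes H$, $\varepsilon:H\to k$, an invertible $\Phi\in H^{\otimes3}$ with $(id\otimes\Delta)\Delta(h)=\Phi(\Delta\otimes id)\Delta(h)\Phi^{-1}$, $(id\otimes\varepsilon)\Delta(h)=h=(\varepsilon\otimes id)\Delta(h)$, $(1\otimes\Phi)(id\otimes\Delta\otimes id)(\Phi)(\Phi\otimes1)=(id\otimes id\otimes\Delta)(\Phi)(\Delta\otimes id\otimes id)(\Phi)$, $(id\otimes\varepsilon\otimes id)(\Phi)=1\otimes1$. Write $\Delta(h)=h_1\otimes h_2$, $\Phi=X^1\otimes X^2\otimes X^3$, $\Phi^{-1}=x^1\otimes x^2\otimes x^3$. A quasi-Hopf algebra has in addition an algebra anti-automorphism $S$ and $\alpha,\beta\in H$ with $S(h_1)\alpha h_2=\varepsilon(h)\alpha$, $h_1\beta S(h_2)=\varepsilon(h)\beta$, $X^1\beta S(X^2)\alpha X^3=1$, $S(x^1)\alpha x^2\beta S(x^3)=1$; convention: $\varepsilon(\alpha)=\varepsilon(\beta)=1$, $\varepsilon\circ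 S=\varepsilon$. Drinfeld twist: $f=f^1\otimes f^2=(S\otimes S)(\Delta^{\rm cop}(x^1))\,\gamma\,\Delta(x^2\beta S(x^3))\in H\otimes H$, an invertible element, where $\gamma=S(A^2)\alpha A^3\otimes S(A^1)\alpha A^4$, $A^1\otimes A^2\otimes A^3\otimes A^4=(\Phi\otimes1)(\Delta\otimes id\otimes id)(\Phi^{-1})$, $\Delta^{\rm cop}(h)=h_2\otimes h_1$. It satisfies $f\Delta(S(h))f^{-1}=(S\otimes S)(\Delta^{\rm cop}(h))$ and $(1\otimes f)(id\otimes\Delta)(f)\Phi(\Delta\otimes id)(f^{-1})(f^{-1}\otimes1)=S(X^3)\otimes S(X^2)\otimes S(X^1)$. $H^{\rm op}$ is $H$ with opposite multiplication, same $\Delta,\varepsilon$, and reassociator $\Phi^{-1}$; $H^{\rm op}\otimes H$ is the tensor product quasi-bialgebra, with componentwise structure and reassociator $(x^1\otimes X^1)\otimes(x^2\otimes X^2)\otimes(x^3\otimes X^3)$. Left $H$-comodule algebra $(\mathfrak{B},\lambda,\Phi_\lambda)$: algebra $\mathfrak{B}$, algebra map $\lambda:\mathfrak{B}\to H\otimes\mathfrak{B}$, invertible $\Phi_\lambda\in H\otimes H\otimes\mathfrak{B}$ with $(id\otimes\lambda)(\lambda(b))\Phi_\lambda=\Phi_\lambda(\Delta\otimes id)(\lambda(b))$, $(1_H\otimes\Phi_\lambda)(id\otimes\Delta\otimes id)(\Phi_\lambda)(\Phi\otimes1)=(id\otimes id\otimes\lambda)(\Phi_\lambda)(\Delta\otimes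 id\otimes id)(\Phi_\lambda)$, $(\varepsilon\otimes id)\lambda=id$, $(id\otimes\varepsilon\otimes id)(\Phi_\lambda)=(\varepsilon\otimes id\otimes id)(\Phi_\lambda)=1\otimes1$. Right $H$-comodule algebra $(\mathfrak{A},\rho,\Phi_\rho)$: algebra $\mathfrak{A}$, algebra map $\rho:\mathfrak{A}\to\mathfrak{A}\otimes H$, invertible $\Phi_\rho\in\mathfrak{A}\otimes H\otimes H$ with $\Phi_\rho(\rho\otimes id)(\rho(a))=(id\otimes\Delta)(\rho(a))\Phi_\rho$, $(1\otimes\Phi)(id\otimes\Delta\otimes id)(\Phi_\rho)(\Phi_\rho\otimes1_H)=(id\otimes id\otimes\Delta)(\Phi_\rho)(\rho\otimes id\otimes id)(\Phi_\rho)$, $(id\otimes\varepsilon)\rho=id$, $(id\otimes\varepsilon\otimes id)(\Phi_\rho)=(id\otimes id\otimes\varepsilon)(\Phi_\rho)=1\otimes1$. Notation: $\lambda(u)=u_{[-1]}\otimes u_{[0]}$, $\rho(u)=u_{\langle0\rangle}\otimes u_{\langle1\rangle}$, $\Phi_\lambda^{-1}=\tilde x^1_\lambda\otimes\tilde x^2_\lambda\otimes\tilde x^3_\lambda$, $\Phi_\rho=\tilde X^1_\rho\otimes\tilde X^2_\rho\otimes\tilde X^3_\rho$. $H$-bicomodule algebra $(\mathbb{A},\lambda,\rho,\Phi_\lambda,\Phi_\rho,\Phi_{\lambda,\rho})$: $(\mathbb{A},\lambda,\Phi_\lambda)$ is a left and $(\mathbb{A},\rho,\Phi_\rho)$ a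 right $H$-comodule algebra, and $\Phi_{\lambda,\rho}=\Theta^1\otimes\Theta^2\otimes\Theta^3\in H\otimes\mathbb{A}\otimes H$ is invertible, with inverse $\theta^1\otimes\theta^2\otimes\theta^3$, such that $\Phi_{\lambda,\rho}(\lambda\otimes id)(\rho(u))=(id\otimes\rho)(\lambda(u))\Phi_{\lambda,\rho}$, $(1_H\otimes\Phi_{\lambda,\rho})(id\otimes\lambda\otimes id)(\Phi_{\lambda,\rho})(\Phi_\lambda\otimes1_H)=(id\otimes id\otimes\rho)(\Phi_\lambda)(\Delta\otimes id\otimes id)(\Phi_{\lambda,\rho})$, $(1_H\otimes\Phi_\rho)(id\otimes\rho\otimes id)(\Phi_{\lambda,\rho})(\Phi_{\lambda,\rho}\otimes1_H)=(id\otimes id\otimes\Delta)(\Phi_{\lambda,\rho})(\lambda\otimes id\otimes id)(\Phi_\rho)$. Right $H$-comodule algebras $(\mathfrak{A},\rho,\Phi_\rho)$ and $(\mathfrak{A},\rho',\Phi_{\rho'})$ are twist equivalent if there is an invertible $\mathbb{V}\in\mathfrak{A}\otimes H$ with $(id\otimes\varepsilon)(\mathbb{V})=1$, $\rho'(a)=\mathbb{V}\rho(a)\mathbb{V}^{-1}$, $\Phi_{\rho'}=(id\otimes\Delta)(\mathbb{V})\Phi_\rho(\rho\otimes id)(\mathbb{V}^{-1})(\mathbb{V}^{-1}\otimes1_H)$. *)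

(* Defs.v *)
From HB Require Import structures.
From mathcomp Require Import all_boot all_order all_algebra.
From mathcomp Require Import boolp classical_sets.

Set Implicit Arguments.
Unset Strict Implicit.
Unset Printing Implicit Defensive.

Import GRing.Theory.

Local Open Scope ring_scope.
Local Open Scope quotient_scope.

Reserved Notation "x ⊗ y" (at level 38, right associativity).
Reserved Notation "\tsum_ ( x , y <- t ) F"
  (at level 41, F at level 41, x name, y name, t at level 200,
   format "'[' \tsum_ ( x ,  y  <-  t ) '/  '  F ']'").
Reserved Notation "\tsum_ ( x , y , z <- t ) F"
  (at level 41, F at level 41, x name, y name, z name, t at level 200,
   format "'[' \tsum_ ( x ,  y ,  z  <-  t ) '/  '  F ']'").
Reserved Notation "\tsum_ ( x , y , z , w <- t ) F"
  (at level 41, F at level 41, x name, y name, z name, w name, t at level 200,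
   format "'[' \tsum_ ( x ,  y ,  z ,  w  <-  t ) '/  '  F ']'").

(* The tensor product over k of the vector spaces underlying two k-algebras: *)
(* finite formal sums of pairs, modulo the smallest congruence that makes *)
(* (v, w) |-> [:: (v, w)] bilinear. Only the lmodType structure of the factors *)
(* matters; they are taken in algType k because every space that occurs is an *)
(* algebra, and canonical structure inference on iterated tensor products is *)
(* exponential when the factors are only known as lmodTypes. *)
Section TensorDef.
Variables (k : fieldType) (V W : algType k).

Inductive tens_rel : seq (V * W) -> seq (V * W) -> Prop :=
| TensRefl s : tens_rel s s
| TensSym s t : tens_rel s t -> tens_rel t s
| TensTrans s t u : tens_rel s t -> tens_rel t u -> tens_rel s u
| TensCat s s' t t' :
    tens_rel s s' -> tens_rel t t' -> tens_rel (s ++ t) (s' ++ t')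
| TensComm s t : tens_rel (s ++ t) (t ++ s)
| TensAddl v v' w : tens_rel [:: (v + v', w)] [:: (v, w); (v', w)]
| TensAddr v w w' : tens_rel [:: (v, w + w')] [:: (v, w); (v, w')]
| TensScale a v w : tens_rel [:: (a *: v, w)] [:: (v, a *: w)]
| TensZero w : tens_rel [:: (0, w)] [::].

Definition tens_eqv : rel (seq (V * W)) := fun s t => `[< tens_rel s t >].

Lemma tens_eqv_refl : reflexive tens_eqv.
Proof. by move=> s; apply/asboolP/TensRefl. Qed.
Lemma tens_eqv_sym : symmetric tens_eqv.
Proof. by move=> s t; apply/asboolP/asboolP => /TensSym. Qed.
Lemma tens_eqv_trans : transitive tens_eqv.
Proof. by move=> s t u /asboolP ts /asboolP su; apply/asboolP/(TensTrans ts su). Qed.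

Canonical tens_equiv := EquivRel tens_eqv tens_eqv_refl tens_eqv_sym tens_eqv_trans.

Definition tens := {eq_quot tens_equiv}.
HB.instance Definition _ := Choice.on tens.
HB.instance Definition _ := EqQuotient.on tens.

Lemma tens_piE s t : tens_rel s t -> \pi_tens s = \pi_tens t.
Proof. by move=> st; apply/eqmodP/asboolP. Qed.

Lemma tens_reprK (s : seq (V * W)) : tens_rel (repr (\pi_tens s)) s.
Proof.
apply/asboolP; rewrite -/(tens_eqv _ _); apply/(@eqmodP _ tens_equiv).
by rewrite reprK.
Qed.

Definition tens_add (x y : tens) : tens := \pi_tens (repr x ++ repr y).
Definition tens_zero : tens := \pi_tens [::].
Definition tens_scale (a : k) (x : tens) : tens :=
  \pi_tens [seq (a *: p.1, p.2) | p <- repr x].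

Lemma tens_add_pi s t : tens_add (\pi_tens s) (\pi_tens t) = \pi_tens (s ++ t).
Proof. by apply: tens_piE; apply: TensCat; apply: tens_reprK. Qed.

Lemma tens_rel_scale a s t : tens_rel s t ->
  tens_rel [seq (a *: p.1, p.2) | p <- s] [seq (a *: p.1, p.2) | p <- t].
Proof.
elim=> {s t} [s|s t _|s t u _ st _|s s' t t' _ ss' _|s t|v v' w|v w w'|b v w|w] /=.
- exact: TensRefl.
- exact: TensSym.
- exact: TensTrans.
- by rewrite !map_cat; apply: TensCat.
- by rewrite !map_cat; apply: TensComm.
- by rewrite scalerDr; apply: TensAddl.
- exact: TensAddr.
- by rewrite scalerA mulrC -scalerA; apply: TensScale.
- by rewrite scaler0; apply: TensZero.
Qed.

Lemma tens_scale_pi a s :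
  tens_scale a (\pi_tens s) = \pi_tens [seq (a *: p.1, p.2) | p <- s].
Proof. by apply: tens_piE; apply: tens_rel_scale; apply: tens_reprK. Qed.

Lemma tens_addA : associative tens_add.
Proof.
move=> x y z; rewrite -[x]reprK -[y]reprK -[z]reprK.
move: (repr x) (repr y) (repr z) => s t u.
by rewrite (tens_add_pi t u) (tens_add_pi s t) (tens_add_pi s) (tens_add_pi _ u) catA.
Qed.

Lemma tens_addC : commutative tens_add.
Proof.
move=> x y; rewrite -[x]reprK -[y]reprK !tens_add_pi.
exact/tens_piE/TensComm.
Qed.

Lemma tens_add0 : left_id tens_zero tens_add.
Proof. by move=> x; rewrite -[x]reprK tens_add_pi. Qed.

Lemma tens_scale0 x : tens_scale 0 x = tens_zero.
Proof.
rewrite -[x]reprK; move: (repr x) => s; rewrite tens_scale_pi; apply: tens_piE.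
elim: s => [|p s IHs] /=; first exact: TensRefl.
by rewrite scale0r; apply: (TensCat (TensZero _) IHs).
Qed.

Lemma tens_scaleDl x a b :
  tens_scale (a + b) x = tens_add (tens_scale a x) (tens_scale b x).
Proof.
rewrite -[x]reprK; move: (repr x) => s.
rewrite !tens_scale_pi tens_add_pi; apply: tens_piE.
elim: s => [|p s IHs] /=; first exact: TensRefl.
rewrite scalerDl; apply: (TensTrans (TensCat (TensAddl _ _ _) IHs)) => /=.
set A := map _ s; set B := map _ s.
apply: (@TensCat [:: _] [:: _] (_ :: A ++ B) (A ++ _ :: B)).
  exact: TensRefl.
rewrite -[A ++ _ :: B]/(A ++ [:: _] ++ B) catA.
exact: (TensCat (TensComm [:: _] A) (TensRefl B)).
Qed.

Lemma tens_scale1 : left_id 1 tens_scale.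
Proof.
move=> x; rewrite -[x]reprK; move: (repr x) => s.
rewrite tens_scale_pi; congr (\pi_tens _).
by rewrite -[RHS]map_id; apply: eq_map => -[v w]; rewrite /= scale1r.
Qed.

Lemma tens_addN : left_inverse tens_zero (tens_scale (-1)) tens_add.
Proof.
by move=> x; rewrite -{2}[x]tens_scale1 -tens_scaleDl addNr tens_scale0.
Qed.

HB.instance Definition _ :=
  GRing.isZmodule.Build tens tens_addA tens_addC tens_add0 tens_addN.

Lemma tens_scaleA a b x : tens_scale a (tens_scale b x) = tens_scale (a * b) x.
Proof.
rewrite -[x]reprK; move: (repr x) => s.
rewrite (tens_scale_pi b) (tens_scale_pi a) (tens_scale_pi (a * b)) -map_comp.
congr (\pi_tens _); apply: eq_map => p /=; by rewrite scalerA.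
Qed.

Lemma tens_scaleDr : right_distributive tens_scale +%R.
Proof.
move=> a x y; rewrite -[x]reprK -[y]reprK.
move: (repr x) (repr y) => s t.
rewrite -[LHS]/(tens_scale a (tens_add _ _)) -[RHS]/(tens_add _ _).
rewrite (tens_add_pi s t) (tens_scale_pi a s) (tens_scale_pi a t).
by rewrite tens_scale_pi tens_add_pi map_cat.
Qed.

HB.instance Definition _ := GRing.Zmodule_isLmodule.Build k tens
  tens_scaleA tens_scale1 tens_scaleDr (fun x a b => tens_scaleDl x a b).

Definition pure (v : V) (w : W) : tens := \pi_tens [:: (v, w)].

(* Sweedler notation: for t = \sum v ⊗ w, [tsum t F] is \sum F v w, computed *)
(* on the representative of t picked by the quotient; it depends only on t as *)
(* soon as F is bilinear, see [tsum_pure] and [tsum_linear]. *)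
Definition tsum (U : nmodType) (t : tens) (F : V -> W -> U) : U :=
  \sum_(p <- repr t) F p.1 p.2.

End TensorDef.

Notation "V ⊗ W" := (tens V%type W%type) : type_scope.
Notation "v ⊗ w" := (pure v w) : ring_scope.
Notation "\tsum_ ( x , y <- t ) F" := (tsum t (fun x y => F)) : ring_scope.
Notation "\tsum_ ( x , y , z <- t ) F" :=
  (tsum t (fun x t' => tsum t' (fun y z => F))) : ring_scope.
Notation "\tsum_ ( x , y , z , w <- t ) F" :=
  (tsum t (fun x t' => tsum t' (fun y t'' => tsum t'' (fun z w => F))))
  : ring_scope.

Notation bilin f := (bilinear_for *:%R *:%R f).

Section TensorTheory.
Variables (k : fieldType) (V W : algType k).

Lemma pi_tens_sum (s : seq (V * W)) :
  \pi_(V ⊗ W) s = \sum_(p <- s) p.1 ⊗ p.2.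
Proof.
elim: s => [|p s IHs]; first by rewrite big_nil.
rewrite big_cons -IHs -cat1s -(@tens_add_pi k V W).
by congr (tens_add _ _); case: p.
Qed.

Lemma tensE (t : V ⊗ W) : t = \tsum_(v, w <- t) v ⊗ w.
Proof. by rewrite /tsum -pi_tens_sum reprK. Qed.

Lemma pure_bilin : bilin (@pure k V W).
Proof.
split=> [w a v v'|v a w w'] /=.
- rewrite [LHS](tens_piE (TensAddl _ _ _)) pi_tens_sum !big_cons big_nil addr0.
  congr (_ + _); by rewrite /pure [RHS]tens_scale_pi.
- rewrite [LHS](tens_piE (TensAddr _ _ _)) pi_tens_sum !big_cons big_nil addr0.
  congr (_ + _); rewrite /pure [RHS]tens_scale_pi /=.
  exact/tens_piE/TensSym/TensScale.
Qed.

Lemma tens_ind (P : V ⊗ W -> Prop) :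
  (forall v w, P (v ⊗ w)) -> (forall s t, P s -> P t -> P (s + t)) ->
  forall t, P t.
Proof.
move=> Pp PD t; rewrite [t]tensE /tsum.
elim: (repr t) => [|p s IHs]; last by rewrite big_cons; apply: PD.
rewrite big_nil; have <- : (0 : V) ⊗ (0 : W) = 0; last exact: Pp.
exact/tens_piE/TensZero.
Qed.

Lemma tens_rel_sum (U : lmodType k) (F : V -> W -> U) s t : bilin F ->
  tens_rel s t -> \sum_(p <- s) F p.1 p.2 = \sum_(p <- t) F p.1 p.2.
Proof.
move=> [Fl Fr].
have F0 w : F 0 w = 0.
  by have := Fl w (-1) 0 0; rewrite /= scaler0 addr0 scaleN1r addNr => ->.
have Fr0 v : F v 0 = 0.
  by have := Fr v (-1) 0 0; rewrite /= scaler0 addr0 scaleN1r addNr => ->.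
elim=> {s t} [s|s t _|s t u _ st _|s s' t t' _ ss' _|s t|v v' w|v w w'|b v w|w];
  rewrite ?big_cat ?big_cons ?big_nil ?addr0 //=.
- by move=> <-.
- by rewrite ss' => ->.
- exact: addrC.
- by have := Fl w 1 v v'; rewrite /= !scale1r.
- by have := Fr v 1 w w'; rewrite /= !scale1r.
- have := Fl w b v 0; have := Fr v b w 0.
  by rewrite /= !addr0 F0 Fr0 !addr0 => -> ->.
Qed.

Section Tsum.
Variables (U : lmodType k) (F : V -> W -> U).
Hypothesis F_bilin : bilin F.

Lemma tsum_pi s : tsum (\pi_(V ⊗ W) s) F = \sum_(p <- s) F p.1 p.2.
Proof. exact: tens_rel_sum (tens_reprK s). Qed.

Lemma tsum_pure v w : \tsum_(x, y <- v ⊗ w) F x y = F v w.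
Proof. by rewrite tsum_pi big_cons big_nil addr0. Qed.

Lemma tsum_linear : linear (fun t : V ⊗ W => \tsum_(x, y <- t) F x y).
Proof.
move=> a x y; rewrite -[x]reprK -[y]reprK.
move: (repr x) (repr y) => s t.
rewrite [a *: _]tens_scale_pi [_ + _ in LHS]tens_add_pi !tsum_pi.
rewrite big_cat big_map scaler_sumr; congr (_ + _); apply: eq_bigr => p _ /=.
have F0 : F 0 p.2 = 0.
  by have := F_bilin.1 p.2 (-1) 0 0; rewrite /= scaler0 addr0 scaleN1r addNr => ->.
by have := F_bilin.1 p.2 a p.1 0; rewrite /= !addr0 F0 addr0.
Qed.

End Tsum.

Lemma tens_ext (U : lmodType k) (f g : V ⊗ W -> U) : linear f -> linear g ->
  (forall v w, f (v ⊗ w) = g (v ⊗ w)) -> f =1 g.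
Proof.
move=> fl gl fg; elim/tens_ind => // s t fs ft.
by have := fl 1 s t; have := gl 1 s t; rewrite !scale1r fs ft => -> ->.
Qed.

End TensorTheory.

Lemma lin_tsum (k : fieldType) (V W : algType k) (U T : lmodType k) (t : V ⊗ W)
    (G : U -> V -> W -> T) :
  (forall x y, linear (fun u => G u x y)) ->
  linear (fun u => \tsum_(x, y <- t) G u x y).
Proof.
move=> Gl a u v; rewrite /tsum scaler_sumr -big_split /=.
by apply: eq_bigr => p _; rewrite (Gl _ _ a).
Qed.

Lemma lin_comp (k : fieldType) (V W U : lmodType k) (g : W -> U) (f : V -> W) :
  linear g -> linear f -> linear (fun v => g (f v)).
Proof. by move=> gl fl a u v; rewrite (fl a) (gl a). Qed.

Lemma lin_scale (k : fieldType) (V W : lmodType k) (a : k) (v : V) (f : V -> W) :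
  linear f -> f (a *: v) = a *: f v.
Proof.
move=> fl; have f0 : f 0 = 0.
  by have := fl (-1) 0 0; rewrite scaler0 addr0 scaleN1r addNr.
by have := fl a v 0; rewrite !addr0 f0 addr0.
Qed.

Section PureLinear.
Variables (k : fieldType) (V W : algType k) (U : lmodType k).

Lemma lin_purel (f : U -> V) w : linear f -> linear (fun u => f u ⊗ (w : W)).
Proof. by move=> fl a u v; rewrite (fl a); apply: (@pure_bilin k V W).1. Qed.

Lemma lin_purer v (f : U -> W) : linear f -> linear (fun u => (v : V) ⊗ f u).
Proof. by move=> fl a u u'; rewrite (fl a); apply: (@pure_bilin k V W).2. Qed.

Lemma lin_id : linear (fun v : V => v). Proof. by []. Qed.

End PureLinear.

Section MulLinear.
Variables (k : fieldType) (V : lmodType k) (A : algType k).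
Lemma lin_mull (f : V -> A) b : linear f -> linear (fun v => f v * b).
Proof. by move=> fl a u v; rewrite (fl a) mulrDl scalerAl. Qed.
Lemma lin_mulr (f : V -> A) b : linear f -> linear (fun v => b * f v).
Proof. by move=> fl a u v; rewrite (fl a) mulrDr scalerAr. Qed.
End MulLinear.

Section LinearForm.
Variables (k : fieldType) (W : lmodType k) (e : W).
Hypothesis e_neq0 : e != 0.

Local Open Scope classical_set_scope.

Let P (X : set W) := ~ X e /\ forall a x y, X x -> X y -> X (a *: x + y).

Lemma exists_linear_form : exists phi : W -> k^o, linear phi /\ phi e = 1.
Proof.
have [F FP Ftot|X [[Xe Xl] Xmax]] := @Zorn_bigcup W P.
  split=> [[X FX Xe]|a x y [X FX Xx] [Y FY Yy]]; first exact: (FP _ FX).1.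
  have [XY|YX] := Ftot _ _ FX FY.
    by exists Y => //; apply: (FP _ FY).2 => //; apply: XY.
  by exists X => //; apply: (FP _ FX).2 => //; apply: YX.
have X0 : X 0.
  apply: contrapT => nX0.
  have X_0 : X `<=` [set 0].
    move=> x Xx; apply: contrapT => _; apply: nX0.
    by have := Xl (-1) x x Xx Xx; rewrite scaleN1r addNr.
  apply: (Xmax [set 0]).
    by split=> // /(_ 0 erefl).
  split=> [/= e0|a x y -> ->]; first by move/eqP: e_neq0.
  by rewrite scaler0 addr0.
have XZ a x : X x -> X (a *: x) by move=> Xx; rewrite -[_ *: _]addr0; apply: Xl.
have XD x y : X x -> X y -> X (x + y) by move=> Xx; rewrite -[x]scale1r; apply: Xl.
have dec v : exists a, X (v - a *: e).
  case: (pselect (X v)) => [Xv|nXv]; first by exists 0; rewrite scale0r subr0.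
  pose Y := [set y | exists c x, X x /\ y = c *: v + x].
  have [c [x [Xx ex]]] : Y e.
    apply: contrapT => nYe; apply: (Xmax Y).
      split=> [x Xx|YX]; first by exists 0, x; rewrite scale0r add0r.
      by apply/nXv/YX; exists 1, 0; rewrite scale1r addr0.
    split=> // a _ _ [c [x [Xx ->]]] [d [y [Xy ->]]].
    exists (a * c + d), (a *: x + y); split; first exact: Xl.
    by rewrite scalerDr scalerA scalerDl addrACA.
  have c0 : c != 0 by apply/eqP => c0; apply: Xe; rewrite ex c0 scale0r add0r.
  exists c^-1; rewrite ex scalerDr scalerA mulVf // scale1r opprD addNKr.
  by rewrite -scaleNr; apply: XZ.
have uniq v a b : X (v - a *: e) -> X (v - b *: e) -> a = b.
  move=> Xa Xb; apply: contrapT => /eqP ab; apply: Xe.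
  have := XD _ _ Xb (XZ (-1) _ Xa).
  rewrite scaleN1r opprB addrC addrA subrK -scalerBl.
  by move/(XZ (a - b)^-1); rewrite scalerA mulVf ?scale1r // subr_eq0.
have [phi phiP] := choice dec.
exists phi; split; last by apply: (uniq e) => //; rewrite scale1r subrr.
move=> a u v; apply: (uniq (a *: u + v)) => //.
have := Xl a _ _ (phiP u) (phiP v).
by rewrite scalerBr scalerDl scalerA addrACA opprD.
Qed.

End LinearForm.

Section TensorAlgebra.
Variables (k : fieldType) (A B : algType k).
Implicit Types x y z : A ⊗ B.

Definition tens_mul x y : A ⊗ B :=
  \tsum_(a, b <- x) \tsum_(a', b' <- y) (a * a') ⊗ (b * b').
Definition tens_one : A ⊗ B := 1 ⊗ 1.

Lemma tens_mul_bilin0 (a : A) (b : B) :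
  bilin (fun (a' : A) (b' : B) => (a * a') ⊗ (b * b')).
Proof.
split=> [b'|a'].
  by apply: lin_purel; apply: lin_mulr; apply: lin_id.
by apply: lin_purer; apply: lin_mulr; apply: lin_id.
Qed.

Lemma tens_mul_bilin1 y :
  bilin (fun (a : A) (b : B) => \tsum_(a', b' <- y) (a * a') ⊗ (b * b')).
Proof.
split=> [b|a] /=; apply: lin_tsum => a' b'.
  by apply: lin_purel; apply: lin_mull; apply: lin_id.
by apply: lin_purer; apply: lin_mull; apply: lin_id.
Qed.

Lemma tens_mul_linl y : linear (tens_mul^~ y).
Proof. exact: tsum_linear (tens_mul_bilin1 y). Qed.

Lemma tens_mul_linr x : linear (tens_mul x).
Proof.
by apply: lin_tsum => a b; apply: tsum_linear (tens_mul_bilin0 a b).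
Qed.

Lemma tens_mul_pure (a a' : A) (b b' : B) :
  tens_mul (a ⊗ b) (a' ⊗ b') = (a * a') ⊗ (b * b').
Proof.
rewrite /tens_mul tsum_pure; last exact: tens_mul_bilin1.
by rewrite tsum_pure //; apply: tens_mul_bilin0.
Qed.

Lemma tens_mulDl : left_distributive tens_mul +%R.
Proof. by move=> x y z; have := tens_mul_linl z 1 x y; rewrite /= !scale1r. Qed.

Lemma tens_mulDr : right_distributive tens_mul +%R.
Proof. by move=> x y z; have := tens_mul_linr x 1 y z; rewrite !scale1r. Qed.

Lemma tens_mulA : associative tens_mul.
Proof.
move=> x y z; elim/tens_ind: x => [a b|x x' IH IH']; last first.
  by rewrite !tens_mulDl IH IH'.
elim/tens_ind: y => [a' b'|y y' IH IH']; last first.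
  by rewrite !(tens_mulDl, tens_mulDr) IH IH'.
elim/tens_ind: z => [a'' b''|z z' IH IH']; last by rewrite !tens_mulDr IH IH'.
by rewrite !tens_mul_pure !mulrA.
Qed.

Lemma tens_mul1l : left_id tens_one tens_mul.
Proof.
move=> x; elim/tens_ind: x => [a b|x y IHx IHy].
  by rewrite tens_mul_pure !mul1r.
by rewrite tens_mulDr IHx IHy.
Qed.

Lemma tens_mul1r : right_id tens_one tens_mul.
Proof.
move=> x; elim/tens_ind: x => [a b|x y IHx IHy].
  by rewrite tens_mul_pure !mulr1.
by rewrite tens_mulDl IHx IHy.
Qed.

Lemma tens_one_neq0 : tens_one != 0.
Proof.
have [phi [phi_lin phi1]] := exists_linear_form (oner_neq0 B).
pose F (a : A) (b : B) := (phi b : k) *: a.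
have Fb : bilin F.
  split=> [b c a a'|a c b b']; rewrite /F /=.
    by rewrite scalerDr scalerA mulrC -scalerA.
  by rewrite (phi_lin c) scalerDl -scalerA.
apply/eqP => one0; have := tsum_pure Fb 1 1; rewrite /F phi1 scale1r.
rewrite -/tens_one one0 => /eqP.
have := tsum_linear Fb (-1) 0 0; rewrite scaler0 addr0 scaleN1r addNr => ->.
by rewrite eq_sym oner_eq0.
Qed.

HB.instance Definition _ := GRing.Zmodule_isNzRing.Build (tens A B)
  tens_mulA tens_mul1l tens_mul1r tens_mulDl tens_mulDr tens_one_neq0.

Lemma tens_scaleAl (c : k) x y : c *: (x * y) = (c *: x) * y.
Proof. by rewrite -(lin_scale c _ (tens_mul_linl y)). Qed.

Lemma tens_scaleAr (c : k) x y : c *: (x * y) = x * (c *: y).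
Proof. by rewrite -(lin_scale c _ (tens_mul_linr x)). Qed.

HB.instance Definition _ :=
  GRing.Lmodule_isLalgebra.Build k (tens A B) tens_scaleAl.
HB.instance Definition _ :=
  GRing.Lalgebra_isAlgebra.Build k (tens A B) tens_scaleAr.

Lemma pureM (a a' : A) (b b' : B) : (a ⊗ b) * (a' ⊗ b') = (a * a') ⊗ (b * b').
Proof. exact: tens_mul_pure. Qed.

Lemma pure1 : (1 : A) ⊗ (1 : B) = 1. Proof. by []. Qed.
End TensorAlgebra.

Section TensorMaps.
Variable k : fieldType.

Definition tmap (V V' W W' : algType k) (f : V -> V') (g : W -> W')
    (t : V ⊗ W) : V' ⊗ W' := \tsum_(v, w <- t) f v ⊗ g w.

Definition tassoc (U V W : algType k) (t : (U ⊗ V) ⊗ W) : U ⊗ (V ⊗ W) :=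
  \tsum_(uv, w <- t) \tsum_(u, v <- uv) u ⊗ (v ⊗ w).

(* Canonical identification (U ⊗ V ⊗ W) ⊗ Z = U ⊗ V ⊗ W ⊗ Z. *)
Definition tassoc3 (U V W Z : algType k) (t : (U ⊗ V ⊗ W) ⊗ Z)
    : U ⊗ V ⊗ W ⊗ Z := tmap idfun (@tassoc V W Z) (tassoc t).

Definition tflip (V W : algType k) (t : V ⊗ W) : W ⊗ V :=
  \tsum_(v, w <- t) w ⊗ v.

(* f ⊗ id for f : V -> U ⊗ U', with values in U ⊗ (U' ⊗ W); when W is itself *)
(* a tensor product W1 ⊗ W2 this is f ⊗ id ⊗ id. *)
Definition tmapl (V U U' W : algType k) (f : V -> U ⊗ U') (t : V ⊗ W)
    : U ⊗ U' ⊗ W := tassoc (tmap f idfun t).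

(* e ⊗ id and id ⊗ e for a linear form e, with k ⊗ W = W and W ⊗ k = W. *)
Definition contrl (V W : algType k) (e : V -> k) (t : V ⊗ W) : W :=
  \tsum_(v, w <- t) e v *: w.
Definition contrr (V W : algType k) (e : V -> k) (t : W ⊗ V) : W :=
  \tsum_(w, v <- t) e v *: w.

End TensorMaps.
HB.instance Definition _ (k : fieldType) (A : algType k) := GRing.Lmodule.on A^c.
Lemma conv_scaleAl (k : fieldType) (A : algType k) (a : k) (x y : A^c) :
  a *: (x * y) = (a *: x : A^c) * y.
Proof. exact: (scalerAr a (y : A) (x : A)). Qed.
Lemma conv_scaleAr (k : fieldType) (A : algType k) (a : k) (x y : A^c) :
  a *: (x * y) = x * (a *: y : A^c).
Proof. exact: (scalerAl a (y : A) (x : A)). Qed.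
HB.instance Definition _ (k : fieldType) (A : algType k) :=
  GRing.Lmodule_isLalgebra.Build k A^c (@conv_scaleAl k A).
HB.instance Definition _ (k : fieldType) (A : algType k) :=
  GRing.Lalgebra_isAlgebra.Build k A^c (@conv_scaleAr k A).

(* The identity, as maps A -> A^op and A^op -> A. *)
Definition op (k : fieldType) (A : algType k) (a : A) : A^c := a.
Definition unop (k : fieldType) (A : algType k) (a : A^c) : A := a.

Section TensorMapsTheory.
Variable k : fieldType.

Section Linear.
Variables (U V V' W W' : algType k).

Lemma tmap_bilin (f : {linear V -> V'}) (g : {linear W -> W'}) :
  bilin (fun v w => f v ⊗ g w).
Proof.
split=> [w|v] /=; first by apply: lin_purel; apply: linearP.
by apply: lin_purer; apply: linearP.
Qed.

Lemma tmap_pure (f : {linear V -> V'}) (g : {linear W -> W'}) v w :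
  tmap f g (v ⊗ w) = f v ⊗ g w.
Proof. by rewrite /tmap tsum_pure //; apply: tmap_bilin. Qed.

Lemma tmap_linear (f : {linear V -> V'}) (g : {linear W -> W'}) :
  linear (tmap f g).
Proof. exact: tsum_linear (tmap_bilin f g). Qed.
HB.instance Definition _ (f : {linear V -> V'}) (g : {linear W -> W'}) :=
  GRing.isLinear.Build k (tens V W) (tens V' W') *:%R (tmap f g)
    (tmap_linear f g).

Lemma tassoc_bilin0 (w : W) : bilin (fun (u : U) (v : V) => u ⊗ (v ⊗ w)).
Proof.
split=> [v|u] /=; first by apply: lin_purel; apply: lin_id.
by apply: lin_purer; apply: lin_purel; apply: lin_id.
Qed.
Lemma tassoc_bilin :
  bilin (fun (uv : U ⊗ V) (w : W) => \tsum_(u, v <- uv) u ⊗ (v ⊗ w)).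
Proof.
split=> [w|uv] /=; first exact: tsum_linear (tassoc_bilin0 w).
by apply: lin_tsum => u v; do 2!apply: lin_purer; apply: lin_id.
Qed.
Lemma tassoc_pure (u : U) (v : V) (w : W) :
  tassoc ((u ⊗ v) ⊗ w) = u ⊗ (v ⊗ w).
Proof.
rewrite /tassoc tsum_pure; last exact: tassoc_bilin.
by rewrite tsum_pure //; apply: tassoc_bilin0.
Qed.
Lemma tassoc_linear : linear (@tassoc k U V W).
Proof. exact: tsum_linear tassoc_bilin. Qed.
HB.instance Definition _ :=
  GRing.isLinear.Build k (tens (tens U V) W) (tens U (tens V W)) *:%R
    (@tassoc k U V W) tassoc_linear.

Lemma tflip_bilin : bilin (fun (v : V) (w : W) => w ⊗ v).
Proof.
split=> [w|v] /=; first by apply: lin_purer; apply: lin_id.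
by apply: lin_purel; apply: lin_id.
Qed.
Lemma tflip_pure (v : V) (w : W) : tflip (v ⊗ w) = w ⊗ v.
Proof. by rewrite /tflip tsum_pure //; apply: tflip_bilin. Qed.
Lemma tflip_linear : linear (@tflip k V W).
Proof. exact: tsum_linear tflip_bilin. Qed.
HB.instance Definition _ :=
  GRing.isLinear.Build k (tens V W) (tens W V) *:%R (@tflip k V W) tflip_linear.

Lemma contrl_bilin (e : {linear V -> k^o}) :
  bilin (fun (v : V) (w : W) => (e v : k) *: w).
Proof.
split=> [w a v v'|v a w w'] /=.
  by rewrite linearP /= scalerDl scalerA.
by rewrite scalerDr !scalerA mulrC.
Qed.
Lemma contrl_pure (e : {linear V -> k^o}) v (w : W) :
  contrl e (v ⊗ w) = (e v : k) *: w.
Proof. by rewrite /contrl tsum_pure //; apply: contrl_bilin. Qed.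
Lemma contrl_linear (e : {linear V -> k^o}) : linear (@contrl k V W e).
Proof. exact: tsum_linear (contrl_bilin e). Qed.
HB.instance Definition _ (e : {linear V -> k^o}) :=
  GRing.isLinear.Build k (tens V W) W *:%R (@contrl k V W e) (contrl_linear e).

Lemma contrr_bilin (e : {linear V -> k^o}) :
  bilin (fun (w : W) (v : V) => (e v : k) *: w).
Proof.
split=> [v a w w'|w a v v'] /=.
  by rewrite scalerDr !scalerA mulrC.
by rewrite linearP /= scalerDl scalerA.
Qed.
Lemma contrr_pure (e : {linear V -> k^o}) v (w : W) :
  contrr e (w ⊗ v) = (e v : k) *: w.
Proof. by rewrite /contrr tsum_pure //; apply: contrr_bilin. Qed.
Lemma contrr_linear (e : {linear V -> k^o}) : linear (@contrr k V W e).
Proof. exact: tsum_linear (contrr_bilin e). Qed.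
HB.instance Definition _ (e : {linear V -> k^o}) :=
  GRing.isLinear.Build k (tens W V) W *:%R (@contrr k V W e) (contrr_linear e).

End Linear.

Section Linear4.
Variables (U V W Z : algType k).
HB.instance Definition _ :=
  GRing.Linear.copy (@tassoc3 k U V W Z)
    (tmap idfun (@tassoc k V W Z) \o @tassoc k U (tens V W) Z).
Lemma tassoc3_pure (u : U) (v : V) (w : W) (z : Z) :
  tassoc3 ((u ⊗ v ⊗ w) ⊗ z) = u ⊗ v ⊗ w ⊗ z.
Proof. by rewrite /tassoc3 tassoc_pure tmap_pure /= tassoc_pure. Qed.
HB.instance Definition _ (f : {linear U -> tens V W}) :=
  GRing.Linear.copy (@tmapl k U V W Z f) (@tassoc k V W Z \o tmap f (@idfun Z)).
Lemma tmapl_pure (f : {linear U -> tens V W}) u (z : Z) :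
  tmapl f (u ⊗ z) = tassoc (f u ⊗ z).
Proof. by rewrite /tmapl tmap_pure. Qed.
End Linear4.


Section Multiplicative.

Lemma tens_monoid (A B C : algType k) (f : A ⊗ B -> C) : linear f ->
  f 1 = 1 ->
  (forall a b a' b', f (a ⊗ b * (a' ⊗ b')) = f (a ⊗ b) * f (a' ⊗ b')) ->
  monoid_morphism f.
Proof.
move=> fl f1 fM; split=> // x y.
have fD u v : f (u + v) = f u + f v by have := fl 1 u v; rewrite !scale1r.
elim/tens_ind: x => [a b|x x' IH IH']; last by rewrite mulrDl !fD IH IH' mulrDl.
elim/tens_ind: y => // y y' IH IH'; by rewrite mulrDr !fD IH IH' mulrDr.
Qed.

Lemma pureDl (A B : algType k) (a a' : A) (b : B) :
  (a + a') ⊗ b = a ⊗ b + a' ⊗ b.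
Proof. by have := (@pure_bilin k A B).1 b 1 a a'; rewrite /= !scale1r. Qed.

Lemma pureDr (A B : algType k) (a : A) (b b' : B) :
  a ⊗ (b + b') = a ⊗ b + a ⊗ b'.
Proof. by have := (@pure_bilin k A B).2 a 1 b b'; rewrite /= !scale1r. Qed.

Variables (A A' B B' C D : algType k).

Lemma tmap_monoid (f : {lrmorphism A -> A'}) (g : {lrmorphism B -> B'}) :
  monoid_morphism (tmap f g).
Proof.
apply: tens_monoid; [exact: linearP | by rewrite [LHS]tmap_pure !rmorph1 | ].
by move=> a b a' b'; rewrite pureM !tmap_pure !rmorphM pureM.
Qed.
HB.instance Definition _ (f : {lrmorphism A -> A'}) (g : {lrmorphism B -> B'}) :=
  GRing.isMonoidMorphism.Build (tens A B) (tens A' B') (tmap f g)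
    (tmap_monoid f g).

Lemma tassoc_monoid : monoid_morphism (@tassoc k A B C).
Proof.
apply: tens_monoid; [exact: linearP | by rewrite [LHS]tassoc_pure | ].
move=> u c v c'; elim/tens_ind: u => [a b|x y IHx IHy]; last first.
  by rewrite pureDl mulrDl !linearD /= IHx IHy mulrDl.
elim/tens_ind: v => [a' b'|x y IHx IHy]; last first.
  by rewrite pureDl mulrDr !linearD /= IHx IHy mulrDr.
by rewrite !pureM !tassoc_pure !pureM.
Qed.
HB.instance Definition _ :=
  GRing.isMonoidMorphism.Build (tens (tens A B) C) (tens A (tens B C))
    (@tassoc k A B C) tassoc_monoid.

Lemma tflip_monoid : monoid_morphism (@tflip k A B).
Proof.
apply: tens_monoid; [exact: linearP | by rewrite [LHS]tflip_pure | ].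
by move=> a b a' b'; rewrite pureM !tflip_pure pureM.
Qed.
HB.instance Definition _ :=
  GRing.isMonoidMorphism.Build (tens A B) (tens B A) (@tflip k A B)
    tflip_monoid.

Lemma contrl_monoid (e : {lrmorphism A -> k^o}) :
  monoid_morphism (@contrl k A B e).
Proof.
apply: tens_monoid; [exact: linearP | |].
  by rewrite [LHS]contrl_pure rmorph1 scale1r.
move=> a b a' b'; rewrite pureM !contrl_pure rmorphM /=.
by rewrite -scalerAl -scalerAr scalerA.
Qed.
HB.instance Definition _ (e : {lrmorphism A -> k^o}) :=
  GRing.isMonoidMorphism.Build (tens A B) B (@contrl k A B e) (contrl_monoid e).

Lemma contrr_monoid (e : {lrmorphism A -> k^o}) :
  monoid_morphism (@contrr k A B e).
Proof.
apply: tens_monoid; [exact: linearP | |].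
  by rewrite [LHS]contrr_pure rmorph1 scale1r.
move=> b a b' a'; rewrite pureM !contrr_pure rmorphM /=.
by rewrite -scalerAl -scalerAr scalerA.
Qed.
HB.instance Definition _ (e : {lrmorphism A -> k^o}) :=
  GRing.isMonoidMorphism.Build (tens B A) B (@contrr k A B e) (contrr_monoid e).

End Multiplicative.

Section MultiplicativeComp.
Variables (A B C D : algType k).
HB.instance Definition _ := GRing.RMorphism.copy (@tassoc3 k A B C D)
  (tmap idfun (@tassoc k B C D) \o @tassoc k A (tens B C) D).
HB.instance Definition _ (f : {lrmorphism A -> tens B C}) :=
  GRing.RMorphism.copy (@tmapl k A B C D f)
    (@tassoc k B C D \o tmap f (@idfun D)).
End MultiplicativeComp.

End TensorMapsTheory.

Definition inverse_of (A : pzRingType) (x y : A) := x * y = 1 /\ y * x = 1.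

(* Iterated tensor products are right-nested, and the coherence isomorphisms *)
(* tassoc and tassoc3 identify the other bracketings with them. *)
Record quasi_bialgebra (k : fieldType) (H : algType k) := QuasiBialgebra {
  comul : {lrmorphism H -> tens H H};
  counit : {lrmorphism H -> k^o};
  Phi : H ⊗ H ⊗ H;
  PhiV : H ⊗ H ⊗ H;
  Phi_inverse : inverse_of Phi PhiV;
  comul_coassoc : forall h : H,
    tmap idfun comul (comul h) = Phi * tmapl comul (comul h) * PhiV;
  comul_counitr : forall h : H, contrr counit (comul h) = h;
  comul_counitl : forall h : H, contrl counit (comul h) = h;
  Phi_pentagon :
    (1 ⊗ Phi) * tmap idfun (tmapl comul) Phi * tassoc3 (Phi ⊗ 1)
    = tmap idfun (tmap idfun comul) Phi * tmapl comul Phi;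
  Phi_counit : tmap idfun (contrl counit) Phi = 1 ⊗ 1
}.

Section OpTensorBialgebra.
Variable k : fieldType.

(* (x^1 ⊗ y^1) ⊗ F (x^2) (y^2). *)
Definition shuffle (A B X Y Z : algType k) (F : X -> Y -> Z)
    (x : A ⊗ X) (y : B ⊗ Y) : (A ⊗ B) ⊗ Z :=
  \tsum_(a, x' <- x) \tsum_(b, y' <- y) (a ⊗ b) ⊗ F x' y'.

Section Shuffle.
Variables (A B X Y Z : algType k) (F : X -> Y -> Z).
Hypothesis F_bilin : bilin F.

Lemma shuffle_bilin0 a x :
  bilin (fun (b : B) (y : Y) => ((a : A) ⊗ b) ⊗ F x y).
Proof.
split=> [y|b] /=; first by apply: lin_purel; apply: lin_purer; apply: lin_id.
by apply: lin_purer; apply: F_bilin.2.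
Qed.

Lemma shuffle_bilin1 y :
  bilin (fun (a : A) (x : X) => \tsum_(b, y' <- y) (a ⊗ (b : B)) ⊗ F x y').
Proof.
split=> [x|a] /=; apply: lin_tsum => b y'.
  by apply: lin_purel; apply: lin_purel; apply: lin_id.
by apply: lin_purer; apply: F_bilin.1.
Qed.

Lemma shuffle_bilin : bilin (@shuffle A B X Y Z F).
Proof.
split=> [y|x]; first exact: tsum_linear (shuffle_bilin1 y).
by apply: lin_tsum => a x'; apply: tsum_linear (shuffle_bilin0 a x').
Qed.

Lemma shuffle_pure a x b y :
  shuffle F ((a : A) ⊗ x) ((b : B) ⊗ y) = (a ⊗ b) ⊗ F x y.
Proof.
rewrite /shuffle tsum_pure; last exact: shuffle_bilin1.
by rewrite tsum_pure //; apply: shuffle_bilin0.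
Qed.

Lemma shuffleDl x x' y :
  shuffle F (x + x' : A ⊗ X) (y : B ⊗ Y) = shuffle F x y + shuffle F x' y.
Proof. by have := shuffle_bilin.1 y 1 x x'; rewrite /= !scale1r. Qed.

Lemma shuffleDr x y y' :
  shuffle F (x : A ⊗ X) (y + y' : B ⊗ Y) = shuffle F x y + shuffle F x y'.
Proof. by have := shuffle_bilin.2 x 1 y y'; rewrite /= !scale1r. Qed.

Lemma shuffle_ind (P : A ⊗ X -> B ⊗ Y -> Prop) :
  (forall a x b y, P (a ⊗ x) (b ⊗ y)) ->
  (forall x x' y, P x y -> P x' y -> P (x + x') y) ->
  (forall x y y', P x y -> P x y' -> P x (y + y')) ->
  forall x y, P x y.
Proof.
move=> Pp Pl Pr x y; elim/tens_ind: x => [a x|x x' Px Px']; last exact: Pl.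
by elim/tens_ind: y => [b y|y y' Py Py']; [apply: Pp | apply: Pr].
Qed.

End Shuffle.

Lemma shuffleM (A B X Y Z : algType k) (F : X -> Y -> Z) : bilin F ->
  (forall x x' y y', F (x * x') (y * y') = F x y * F x' y') ->
  forall (x x' : A ⊗ X) (y y' : B ⊗ Y),
    shuffle F (x * x') (y * y') = shuffle F x y * shuffle F x' y'.
Proof.
move=> Fb FM x x' y y'; elim/shuffle_ind: x / y =>
  [a x b y|x1 x2 y IH1 IH2|x y1 y2 IH1 IH2].
- elim/shuffle_ind: x' / y' =>
    [a' x' b' y'|x1 x2 y' IH1 IH2|x' y1 y2 IH1 IH2].
  + by rewrite !pureM !shuffle_pure // !pureM FM.
  + by rewrite shuffleDl // !mulrDr -IH1 -IH2 shuffleDl.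
  + by rewrite shuffleDr // !mulrDr -IH1 -IH2 shuffleDr.
- by rewrite shuffleDl // !mulrDl -IH1 -IH2 shuffleDl.
- by rewrite shuffleDr // !mulrDl -IH1 -IH2 shuffleDr.
Qed.


Lemma linear_tsum (V W : algType k) (U T : lmodType k) (g : U -> T) (t : V ⊗ W)
    (F : V -> W -> U) : linear g ->
  g (\tsum_(x, y <- t) F x y) = \tsum_(x, y <- t) g (F x y).
Proof.
move=> gl; rewrite /tsum; elim/big_rec2: _ => [|p _ y _ <-].
  by have := gl (-1) 0 0; rewrite scaler0 addr0 scaleN1r addNr.
by have := gl 1 (F p.1 p.2) y; rewrite !scale1r.
Qed.

Lemma shuffle_tmap (A B X Y Z X' Y' Z' : algType k)
    (F : X -> Y -> Z) (F' : X' -> Y' -> Z')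
    (f : {linear X -> X'}) (g : {linear Y -> Y'}) (h : {linear Z -> Z'}) :
  bilin F -> bilin F' -> (forall x y, h (F x y) = F' (f x) (g y)) ->
  forall (x : A ⊗ X) (y : B ⊗ Y),
    tmap idfun h (shuffle F x y) = shuffle F' (tmap idfun f x) (tmap idfun g y).
Proof.
move=> Fb F'b hF x y.
elim/shuffle_ind: x / y => [a x b y|x1 x2 y IH1 IH2|x y1 y2 IH1 IH2].
- by rewrite !(shuffle_pure, tmap_pure) //= hF.
- by rewrite shuffleDl // !linearD /= IH1 IH2 shuffleDl.
- by rewrite shuffleDr // !linearD /= IH1 IH2 shuffleDr.
Qed.

Lemma shuffle_tassoc (A A' B B' X Y Z : algType k) (F : X -> Y -> Z) :
  bilin F -> forall (u : A ⊗ A') (v : B ⊗ B') x y,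
  tassoc (shuffle (@pure k A' B') u v ⊗ F x y)
  = shuffle (shuffle F) (tassoc (u ⊗ x)) (tassoc (v ⊗ y)).
Proof.
move=> Fb u v x y; have Fsb := shuffle_bilin A' B' Fb; have pb := @pure_bilin k.
have pD (V W : algType k) (v1 v2 : V) (w : W) : (v1 + v2) ⊗ w = v1 ⊗ w + v2 ⊗ w.
  by have := (pb V W).1 w 1 v1 v2; rewrite /= !scale1r.
elim/shuffle_ind: u / v => [a a' b b'|x1 x2 y' IH1 IH2|x' y1 y2 IH1 IH2].
- by rewrite shuffle_pure // !tassoc_pure !shuffle_pure.
- by rewrite shuffleDl // !pD !linearD /= IH1 IH2 shuffleDl.
- by rewrite shuffleDr // !pD !linearD /= IH1 IH2 shuffleDr.
Qed.

Section TensorBialgebra.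
Variables (H H' : algType k) (Q : quasi_bialgebra H) (Q' : quasi_bialgebra H').

Let sh2 := @shuffle H H' _ _ _ (@pure k H H').
Let sh3 := @shuffle H H' _ _ _ sh2.
Let sh4 := @shuffle H H' _ _ _ sh3.

Let pureb (V W : algType k) : bilin (@pure k V W) := @pure_bilin k V W.
Let sh2b : bilin sh2. Proof. exact: shuffle_bilin. Qed.
Let sh3b : bilin sh3. Proof. exact: shuffle_bilin. Qed.
Let sh4b : bilin sh4. Proof. exact: shuffle_bilin. Qed.
Let sh2M x x' y y' : sh2 (x * x') (y * y') = sh2 x y * sh2 x' y'.
Proof. by apply: shuffleM => // *; rewrite pureM. Qed.
Let sh3M x x' y y' : sh3 (x * x') (y * y') = sh3 x y * sh3 x' y'.
Proof. by apply: shuffleM => // *; apply: sh2M. Qed.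
Let sh4M x x' y y' : sh4 (x * x') (y * y') = sh4 x y * sh4 x' y'.
Proof. by apply: shuffleM => // *; apply: sh3M. Qed.
Let sh2_1 : sh2 1 1 = 1. Proof. exact: shuffle_pure. Qed.
Let sh3_1 : sh3 1 1 = 1.
Proof. by rewrite /sh3 [LHS]shuffle_pure // sh2_1. Qed.

Definition tens_comul (t : H ⊗ H') : (H ⊗ H') ⊗ (H ⊗ H') :=
  \tsum_(a, b <- t) \tsum_(a1, a2 <- comul Q a) \tsum_(b1, b2 <- comul Q' b)
    (a1 ⊗ b1) ⊗ (a2 ⊗ b2).

Definition tens_counit (t : H ⊗ H') : k^o :=
  \tsum_(a, b <- t) counit Q a * counit Q' b.

Definition tens_3 (x : H ⊗ H ⊗ H) (y : H' ⊗ H' ⊗ H') :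
    (H ⊗ H') ⊗ (H ⊗ H') ⊗ (H ⊗ H') :=
  \tsum_(x1, x2, x3 <- x) \tsum_(y1, y2, y3 <- y)
    (x1 ⊗ y1) ⊗ (x2 ⊗ y2) ⊗ (x3 ⊗ y3).

Lemma tens_3E x y : tens_3 x y = sh3 x y.
Proof.
rewrite /tens_3 /sh3 /shuffle; apply: eq_bigr => p _.
rewrite /tsum exchange_big /=; apply: eq_bigr => q _.
have lin : linear (fun z : (H ⊗ H') ⊗ (H ⊗ H') => (p.1 ⊗ q.1) ⊗ z).
  by apply: lin_purer; apply: lin_id.
rewrite [RHS](linear_tsum _ _ lin); apply: eq_bigr => r _ /=.
by rewrite [RHS](linear_tsum _ _ lin).
Qed.

Let comul2_bilin : bilin (fun a b => sh2 (comul Q a) (comul Q' b)).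
Proof.
split=> [b|a] /=; first exact: (lin_comp (sh2b.1 _) (linearP (comul Q))).
exact: (lin_comp (sh2b.2 _) (linearP (comul Q'))).
Qed.

Let tens_comul_pure a b : tens_comul (a ⊗ b) = sh2 (comul Q a) (comul Q' b).
Proof. exact: (tsum_pure comul2_bilin). Qed.

Lemma tens_comul_linear : linear tens_comul.
Proof. exact: (tsum_linear comul2_bilin). Qed.
HB.instance Definition _ := GRing.isLinear.Build k (tens H H')
  (tens (tens H H') (tens H H')) *:%R tens_comul tens_comul_linear.

Lemma tens_comul_monoid : monoid_morphism tens_comul.
Proof.
split=> [|x y]; first by rewrite [LHS]tens_comul_pure !rmorph1 sh2_1.
elim/tens_ind: x => [a b|x x' IH IH']; last first.
  by rewrite mulrDl !linearD /= IH IH' mulrDl.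
elim/tens_ind: y => [a' b'|x x' IH IH']; last first.
  by rewrite mulrDr !linearD /= IH IH' mulrDr.
by rewrite pureM !tens_comul_pure !rmorphM sh2M.
Qed.
HB.instance Definition _ := GRing.isMonoidMorphism.Build (tens H H')
  (tens (tens H H') (tens H H')) tens_comul tens_comul_monoid.

Let counit2_bilin : bilin (fun a b => counit Q a * counit Q' b : k^o).
Proof.
split=> [b|a] /=; first exact: (lin_mull _ (linearP (counit Q))).
exact: (lin_mulr _ (linearP (counit Q'))).
Qed.

Let tens_counit_pure a b : tens_counit (a ⊗ b) = counit Q a * counit Q' b.
Proof. exact: (tsum_pure counit2_bilin). Qed.

Lemma tens_counit_linear : linear tens_counit.
Proof. exact: (tsum_linear counit2_bilin). Qed.
HB.instance Definition _ := GRing.isLinear.Build k (tens H H')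
  k^o *:%R tens_counit tens_counit_linear.

Lemma tens_counit_monoid : monoid_morphism tens_counit.
Proof.
split=> [|x y]; first by rewrite [LHS]tens_counit_pure !rmorph1 mulr1.
elim/tens_ind: x => [a b|x x' IH IH']; last first.
  by rewrite mulrDl !linearD /= IH IH' mulrDl.
elim/tens_ind: y => [a' b'|x x' IH IH']; last first.
  by rewrite mulrDr !linearD /= IH IH' mulrDr.
by rewrite pureM !tens_counit_pure !rmorphM mulrACA.
Qed.
HB.instance Definition _ := GRing.isMonoidMorphism.Build (tens H H')
  k^o tens_counit tens_counit_monoid.

Let tmapl_sh (X Y Z : algType k) (F : X -> Y -> Z) x y : bilin F ->
  tmapl tens_comul (@shuffle H H' X Y Z F x y)
  = @shuffle H H' _ _ _ (@shuffle H H' _ _ _ F)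
      (tmapl (comul Q) x) (tmapl (comul Q') y).
Proof.
move=> Fb; have Fsb := shuffle_bilin H H' Fb.
elim/shuffle_ind: x / y => [a x b y|x1 x2 y IH1 IH2|x y1 y2 IH1 IH2].
- by rewrite shuffle_pure // !tmapl_pure /= tens_comul_pure shuffle_tassoc.
- by rewrite shuffleDl // !linearD /= IH1 IH2 shuffleDl.
- by rewrite shuffleDr // !linearD /= IH1 IH2 shuffleDr.
Qed.

Let contrl_sh (X Y Z : algType k) (F : X -> Y -> Z) x y : bilin F ->
  contrl tens_counit (@shuffle H H' X Y Z F x y)
  = F (contrl (counit Q) x) (contrl (counit Q') y).
Proof.
move=> Fb.
elim/shuffle_ind: x / y => [a x b y|x1 x2 y IH1 IH2|x y1 y2 IH1 IH2].
- rewrite shuffle_pure // !contrl_pure /= tens_counit_pure.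
  rewrite (lin_scale _ _ (Fb.1 _)) /= (lin_scale _ _ (Fb.2 _)) scalerA.
  by [].
- rewrite shuffleDl // !linearD /= IH1 IH2.
  by have := Fb.1 (contrl (counit Q') y) 1 (contrl (counit Q) x1)
    (contrl (counit Q) x2); rewrite /= !scale1r.
- rewrite shuffleDr // !linearD /= IH1 IH2.
  by have := Fb.2 (contrl (counit Q) x) 1 (contrl (counit Q') y1)
    (contrl (counit Q') y2); rewrite /= !scale1r.
Qed.

Let contrr_sh2 x y :
  contrr tens_counit (sh2 x y) = contrr (counit Q) x ⊗ contrr (counit Q') y.
Proof.
have Fb := pureb H H'.
elim/shuffle_ind: x / y => [a x b y|x1 x2 y IH1 IH2|x y1 y2 IH1 IH2].
- rewrite /sh2 shuffle_pure // !contrr_pure /= tens_counit_pure.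
  rewrite (lin_scale _ _ (Fb.1 _)) /= (lin_scale _ _ (Fb.2 _)) scalerA.
  by [].
- rewrite /sh2 shuffleDl // !linearD /= IH1 IH2.
  by have := Fb.1 (contrr (counit Q') y) 1 (contrr (counit Q) x1)
    (contrr (counit Q) x2); rewrite /= !scale1r.
- rewrite /sh2 shuffleDr // !linearD /= IH1 IH2.
  by have := Fb.2 (contrr (counit Q) x) 1 (contrr (counit Q') y1)
    (contrr (counit Q') y2); rewrite /= !scale1r.
Qed.

Let tassoc3_sh x y :
  tassoc3 (sh3 x y ⊗ (1 ⊗ 1)) = sh4 (tassoc3 (x ⊗ 1)) (tassoc3 (y ⊗ 1)).
Proof.
have pD (V W : algType k) (v1 v2 : V) (w : W) :
    (v1 + v2) ⊗ w = v1 ⊗ w + v2 ⊗ w.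
  by have := (pureb V W).1 w 1 v1 v2; rewrite /= !scale1r.
have pDr (V W : algType k) (v : V) (w1 w2 : W) :
    v ⊗ (w1 + w2) = v ⊗ w1 + v ⊗ w2.
  by have := (pureb V W).2 v 1 w1 w2; rewrite /= !scale1r.
rewrite /sh4 /sh3.
elim/shuffle_ind: x / y => [a x b y|x1 x2 y IH1 IH2|x y1 y2 IH1 IH2].
- rewrite shuffle_pure // /sh2.
  elim/shuffle_ind: x / y => [a' x b' y|x1 x2 y IH1 IH2|x y1 y2 IH1 IH2].
  + by rewrite !(shuffle_pure, tassoc3_pure).
  + by rewrite shuffleDl // !(pD, pDr) !linearD /= IH1 IH2 shuffleDl.
  + by rewrite shuffleDr // !(pD, pDr) !linearD /= IH1 IH2 shuffleDr.
- by rewrite shuffleDl // !pD !linearD /= IH1 IH2 shuffleDl.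
- by rewrite shuffleDr // !pD !linearD /= IH1 IH2 shuffleDr.
Qed.

Lemma tens_Phi_inverse :
  inverse_of (tens_3 (Phi Q) (Phi Q')) (tens_3 (PhiV Q) (PhiV Q')).
Proof.
have [e1 e2] := Phi_inverse Q; have [e1' e2'] := Phi_inverse Q'.
by split; rewrite !tens_3E -sh3M ?(e1, e2) ?(e1', e2') sh3_1.
Qed.

Lemma tens_coassoc h : tmap idfun tens_comul (tens_comul h)
  = tens_3 (Phi Q) (Phi Q') * tmapl tens_comul (tens_comul h)
    * tens_3 (PhiV Q) (PhiV Q').
Proof.
rewrite !tens_3E; elim/tens_ind: h => [a b|x y IHx IHy]; last first.
  by rewrite !linearD /= IHx IHy mulrDr mulrDl.
rewrite tens_comul_pure tmapl_sh // -!sh3M -!comul_coassoc.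
by apply: shuffle_tmap.
Qed.

Lemma tens_counitr h : contrr tens_counit (tens_comul h) = h.
Proof.
elim/tens_ind: h => [a b|x y IHx IHy]; last by rewrite !linearD /= IHx IHy.
by rewrite tens_comul_pure contrr_sh2 !comul_counitr.
Qed.

Lemma tens_counitl h : contrl tens_counit (tens_comul h) = h.
Proof.
elim/tens_ind: h => [a b|x y IHx IHy]; last by rewrite !linearD /= IHx IHy.
by rewrite tens_comul_pure contrl_sh // !comul_counitl.
Qed.

Lemma tens_pentagon (P := tens_3 (Phi Q) (Phi Q')) :
  (1 ⊗ P) * tmap idfun (tmapl tens_comul) P * tassoc3 (P ⊗ 1)
  = tmap idfun (tmap idfun tens_comul) P * tmapl tens_comul P.
Proof.
rewrite /P !tens_3E; set p := Phi Q; set p' := Phi Q'.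
have -> : 1 ⊗ sh3 p p' = sh4 (1 ⊗ p) (1 ⊗ p') by rewrite /sh4 shuffle_pure.
rewrite [tassoc3 _]tassoc3_sh tmapl_sh // -[shuffle _]/sh4.
rewrite (@shuffle_tmap _ _ _ _ _ _ _ _ sh2 sh3
  (tmapl (comul Q)) (tmapl (comul Q')) (tmapl tens_comul)) //; last first.
  by move=> x y; apply: tmapl_sh.
rewrite (@shuffle_tmap _ _ _ _ _ _ _ _ sh2 sh3
  (tmap idfun (comul Q)) (tmap idfun (comul Q')) (tmap idfun tens_comul)) //; last first.
  by move=> x y; apply: shuffle_tmap.
by rewrite -/sh4 -!sh4M !Phi_pentagon.
Qed.

Lemma tens_Phi_counit :
  tmap idfun (contrl tens_counit) (tens_3 (Phi Q) (Phi Q')) = 1 ⊗ 1.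
Proof.
rewrite tens_3E (@shuffle_tmap _ _ _ _ _ _ _ _ sh2 (@pure k H H')
  (contrl (counit Q)) (contrl (counit Q')) (contrl tens_counit)) //; last first.
  by move=> x y; apply: contrl_sh.
by rewrite !Phi_counit shuffle_pure.
Qed.

Definition tens_quasi_bialgebra : quasi_bialgebra (tens H H') :=
  QuasiBialgebra tens_Phi_inverse tens_coassoc tens_counitr tens_counitl
    tens_pentagon tens_Phi_counit.

End TensorBialgebra.

Section OpBialgebra.
Variables (H : algType k) (Q : quasi_bialgebra H).

Lemma op_linear (A : algType k) : linear (@op k A). Proof. by []. Qed.
HB.instance Definition _ (A : algType k) :=
  GRing.isLinear.Build k A A^c *:%R (@op k A) (@op_linear A).

Lemma opM (A : algType k) (a b : A) : op (a * b) = op b * op a.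
Proof. by []. Qed.

Lemma tmap_antimul (A A' B B' : algType k)
    (f : {linear A -> A'}) (g : {linear B -> B'}) :
  {morph f : x y / x * y >-> y * x} -> {morph g : x y / x * y >-> y * x} ->
  {morph tmap f g : x y / x * y >-> y * x}.
Proof.
move=> fM gM x y; elim/tens_ind: x => [a b|x x' IH IH']; last first.
  by rewrite mulrDl !linearD /= IH IH' mulrDr.
elim/tens_ind: y => [a' b'|y y' IH IH']; last first.
  by rewrite mulrDr !linearD /= IH IH' mulrDl.
by rewrite pureM !tmap_pure pureM fM gM.
Qed.

Definition op_comul (h : H^c) : H^c ⊗ H^c :=
  \tsum_(h1, h2 <- comul Q (unop h)) op h1 ⊗ op h2.

Definition op_counit (h : H^c) : k^o := counit Q (unop h).

Definition op_3 (x : H ⊗ H ⊗ H) : H^c ⊗ H^c ⊗ H^c :=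
  \tsum_(x1, x2, x3 <- x) op x1 ⊗ op x2 ⊗ op x3.

Let o2 := tmap (@op k H) (@op k H).
Let o3 := tmap (@op k H) o2.
Let o4 := tmap (@op k H) o3.

Let o2M : {morph o2 : x y / x * y >-> y * x}.
Proof. by apply: tmap_antimul => x y; apply: opM. Qed.
Let o3M : {morph o3 : x y / x * y >-> y * x}.
Proof. by apply: tmap_antimul => x y; [apply: opM | apply: o2M]. Qed.
Let o4M : {morph o4 : x y / x * y >-> y * x}.
Proof. by apply: tmap_antimul => x y; [apply: opM | apply: o3M]. Qed.
Let o2_1 : o2 1 = 1. Proof. by rewrite [LHS]tmap_pure. Qed.
Let o3_1 : o3 1 = 1. Proof. by rewrite [LHS]tmap_pure; exact: (congr1 (pure (1 : H^c)) o2_1). Qed.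

Lemma op_3E x : op_3 x = o3 x.
Proof.
rewrite /op_3 /o3 /tmap; apply: eq_bigr => p _.
have lin : linear (fun z : H^c ⊗ H^c => op p.1 ⊗ z).
  by apply: lin_purer; apply: lin_id.
by rewrite [RHS](linear_tsum _ _ lin).
Qed.

Lemma op_comul_linear : linear op_comul.
Proof. exact: (lin_comp (linearP o2) (linearP (comul Q))). Qed.
HB.instance Definition _ := GRing.isLinear.Build k H^c
  (tens H^c H^c) *:%R op_comul op_comul_linear.

Lemma op_comul_monoid : monoid_morphism op_comul.
Proof.
split=> [|x y]; first by rewrite -[LHS]/(o2 (comul Q 1)) rmorph1 o2_1.
by rewrite -[LHS]/(o2 (comul Q (unop y * unop x))) rmorphM o2M.
Qed.
HB.instance Definition _ := GRing.isMonoidMorphism.Build H^c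
  (tens H^c H^c) op_comul op_comul_monoid.

Lemma op_counit_linear : linear op_counit.
Proof. exact: (linearP (counit Q)). Qed.
HB.instance Definition _ := GRing.isLinear.Build k H^c
  k^o *:%R op_counit op_counit_linear.

Lemma op_counit_monoid : monoid_morphism op_counit.
Proof.
split=> [|x y]; first exact: (rmorph1 (counit Q)).
by rewrite -[LHS]/(counit Q (unop y * unop x)) rmorphM mulrC.
Qed.
HB.instance Definition _ := GRing.isMonoidMorphism.Build H^c
  k^o op_counit op_counit_monoid.

Let tmapl_o (B B' : algType k) (g : {linear B -> B'}) x :
  tmapl op_comul (tmap (@op k H) g x)
  = tmap (@op k H) (tmap (@op k H) g) (tmapl (comul Q) x).
Proof.
elim/tens_ind: x => [a b|x y IHx IHy]; last by rewrite !linearD /= IHx IHy.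
rewrite tmap_pure !tmapl_pure /= -[op_comul _]/(o2 (comul Q a)).
elim/tens_ind: (comul Q a) => [a1 a2|x y IHx IHy].
  by rewrite /o2 !(tmap_pure, tassoc_pure) /= tmap_pure.
by rewrite /o2 in IHx IHy *; rewrite linearD !pureDl !linearD /= IHx IHy.
Qed.

Lemma op_Phi_inverse : inverse_of (op_3 (PhiV Q)) (op_3 (Phi Q)).
Proof.
have [e1 e2] := Phi_inverse Q.
by split; rewrite !op_3E -o3M ?(e1, e2) o3_1.
Qed.

Lemma op_coassoc h : tmap idfun op_comul (op_comul h)
  = op_3 (PhiV Q) * tmapl op_comul (op_comul h) * op_3 (Phi Q).
Proof.
rewrite !op_3E -[op_comul h]/(o2 (comul Q (unop h))) tmapl_o -/o2 -/o3.
rewrite -mulrA -!o3M -comul_coassoc.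
rewrite /o3 /o2; elim/tens_ind: (comul _ _) => [a b|x y IHx IHy]; last first.
  by rewrite !linearD /= IHx IHy.
by rewrite !tmap_pure.
Qed.

Lemma op_counitr h : contrr op_counit (op_comul h) = h.
Proof.
rewrite -[RHS]/(op (unop h)) -[in RHS](comul_counitr Q (unop h)).
rewrite -[op_comul h]/(o2 (comul Q (unop h))).
rewrite /o3 /o2; elim/tens_ind: (comul _ _) => [a b|x y IHx IHy]; last first.
  by rewrite !linearD /= IHx IHy.
by rewrite tmap_pure !contrr_pure.
Qed.

Lemma op_counitl h : contrl op_counit (op_comul h) = h.
Proof.
rewrite -[RHS]/(op (unop h)) -[in RHS](comul_counitl Q (unop h)).
rewrite -[op_comul h]/(o2 (comul Q (unop h))).
rewrite /o3 /o2; elim/tens_ind: (comul _ _) => [a b|x y IHx IHy]; last first.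
  by rewrite !linearD /= IHx IHy.
by rewrite tmap_pure !contrl_pure.
Qed.

Let inverse_uniq (A : algType k) (x y y' : A) :
  inverse_of x y -> y' * x = 1 -> y' = y.
Proof. by move=> [xy _] yx; rewrite -[y']mulr1 -xy mulrA yx mul1r. Qed.

Let inverse_morph (A B : algType k) (f : {rmorphism A -> B}) x y :
  inverse_of x y -> inverse_of (f x) (f y).
Proof. by move=> [e1 e2]; split; rewrite -rmorphM ?(e1, e2) rmorph1. Qed.

Let pentagonV :
  tassoc3 (PhiV Q ⊗ 1) * tmap idfun (tmapl (comul Q)) (PhiV Q) * (1 ⊗ PhiV Q)
  = tmapl (comul Q) (PhiV Q) * tmap idfun (tmap idfun (comul Q)) (PhiV Q).
Proof.
have i0 := Phi_inverse Q.
have i1 := inverse_morph (tmap idfun (tmapl (comul Q))) i0.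
have i2 := inverse_morph (tmap idfun (tmap idfun (comul Q))) i0.
have i3 := inverse_morph (tmapl (comul Q)) i0.
have i4 : inverse_of (1 ⊗ Phi Q : H ⊗ H ⊗ H ⊗ H) (1 ⊗ PhiV Q).
  by split; rewrite pureM mulr1 ?(i0.1, i0.2).
have i5 : inverse_of (tassoc3 (Phi Q ⊗ (1 : H))) (tassoc3 (PhiV Q ⊗ (1 : H))).
  apply: (inverse_morph (@tassoc3 k H H H H)).
  by split; rewrite pureM mulr1 ?(i0.1, i0.2).
have := Phi_pentagon Q.
set a := 1 ⊗ _; set b := tmap _ _ _; set c := tassoc3 _.
set d := tmap _ _ _; set e := tmapl _ _ => pent.
apply: (@inverse_uniq _ (a * b * c)).
  rewrite pent; split.
    by rewrite mulrA -[d * e * _]mulrA i3.1 mulr1 i2.1.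
  by rewrite mulrA -[_ * d]mulrA  i2.2 mulr1 i3.2.
rewrite !mulrA -[_ * a]mulrA i4.2 mulr1 -[_ * b]mulrA i1.2 mulr1.
exact: i5.2.
Qed.

Lemma op_pentagon (P := op_3 (PhiV Q)) :
  (1 ⊗ P) * tmap idfun (tmapl op_comul) P * tassoc3 (P ⊗ 1)
  = tmap idfun (tmap idfun op_comul) P * tmapl op_comul P.
Proof.
rewrite /P op_3E; set p := PhiV Q.
have -> : 1 ⊗ o3 p = o4 (1 ⊗ p) by rewrite /o4 tmap_pure.
have -> : tmap idfun (tmapl op_comul) (o3 p) = o4 (tmap idfun (tmapl (comul Q)) p).
  rewrite /o4 /o3 /o2; elim/tens_ind: p => [a b|x y IHx IHy]; last by rewrite !linearD /= IHx IHy.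
  by rewrite /o4 /o3 !tmap_pure /= tmapl_o.
have -> : tassoc3 (o3 p ⊗ 1) = o4 (tassoc3 (p ⊗ 1)).
  rewrite /o4 /o3 /o2; elim/tens_ind: p => [a x|x y IHx IHy]; last first.
    by rewrite linearD !pureDl !linearD /= IHx IHy.
  rewrite /o3 tmap_pure; elim/tens_ind: x => [b c|x y IHx IHy].
    by rewrite !(tmap_pure, tassoc3_pure) /= !(tmap_pure, tassoc3_pure) /= !tmap_pure.
  by rewrite linearD !(pureDr, pureDl) !linearD /= IHx IHy.
have -> : tmap idfun (tmap idfun op_comul) (o3 p)
    = o4 (tmap idfun (tmap idfun (comul Q)) p).
  rewrite /o4 /o3 /o2; elim/tens_ind: p => [a x|x y IHx IHy]; last by rewrite !linearD /= IHx IHy.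
  rewrite /o4 /o3 /o2 !tmap_pure /=; congr (_ ⊗ _).
  elim/tens_ind: x => [b c|x y IHx IHy]; last by rewrite !linearD /= IHx IHy.
  by rewrite !tmap_pure.
rewrite tmapl_o -/o2 -/o3 -/o4 -!o4M; congr o4.
by rewrite mulrA pentagonV.
Qed.

Lemma op_Phi_counit : tmap idfun (contrl op_counit) (op_3 (PhiV Q)) = 1 ⊗ 1.
Proof.
have := inverse_morph (tmap idfun (contrl (counit Q))) (Phi_inverse Q).
rewrite /= Phi_counit => -[]; rewrite mul1r => pv _.
rewrite op_3E.
have -> : (1 ⊗ 1 : H^c ⊗ H^c) = o2 1 by rewrite o2_1.
rewrite -pv.
rewrite /o3 /o2; elim/tens_ind: (PhiV Q) => [a x|x y IHx IHy]; last by rewrite !linearD /= IHx IHy.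
rewrite /o3 /o2 !tmap_pure /=; congr (_ ⊗ _).
elim/tens_ind: x => [b c|x y IHx IHy]; last by rewrite !linearD /= IHx IHy.
by rewrite tmap_pure !contrl_pure.
Qed.

Definition op_quasi_bialgebra : quasi_bialgebra H^c :=
  QuasiBialgebra op_Phi_inverse op_coassoc op_counitr op_counitl
    op_pentagon op_Phi_counit.

End OpBialgebra.
End OpTensorBialgebra.

Record quasi_hopf_algebra (k : fieldType) (H : algType k) := QuasiHopfAlgebra {
  qh_bialgebra :> quasi_bialgebra H;
  antipode : {linear H -> H};
  antipodeV : H -> H;
  antipodeK : cancel antipode antipodeV;
  antipodeVK : cancel antipodeV antipode;
  antipode1 : antipode 1 = 1;
  antipodeM : forall x y : H, antipode (x * y) = antipode y * antipode x;
  alpha : H;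
  beta : H;
  antipode_alpha : forall h : H,
    \tsum_(h1, h2 <- comul qh_bialgebra h) antipode h1 * alpha * h2
    = (counit qh_bialgebra h : k) *: alpha;
  antipode_beta : forall h : H,
    \tsum_(h1, h2 <- comul qh_bialgebra h) h1 * beta * antipode h2
    = (counit qh_bialgebra h : k) *: beta;
  antipode_Phi :
    \tsum_(X1, X2, X3 <- Phi qh_bialgebra)
      X1 * beta * antipode X2 * alpha * X3 = 1;
  antipode_PhiV :
    \tsum_(x1, x2, x3 <- PhiV qh_bialgebra)
      antipode x1 * alpha * x2 * beta * antipode x3 = 1;
  counit_alpha : counit qh_bialgebra alpha = 1;
  counit_beta : counit qh_bialgebra beta = 1;
  counit_antipode : forall h : H,
    counit qh_bialgebra (antipode h) = counit qh_bialgebra h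
}.

Definition op_tens (k : fieldType) (H : algType k) (Q : quasi_bialgebra H) :
    quasi_bialgebra (tens H^c H) :=
  tens_quasi_bialgebra (op_quasi_bialgebra Q) Q.

Section DrinfeldTwist.
Variables (k : fieldType) (H : algType k) (Q : quasi_hopf_algebra H).
Let S := antipode Q.

Definition drinfeld_gamma : H ⊗ H :=
  \tsum_(A1, A2, A3, A4 <- tassoc3 (Phi Q ⊗ 1) * tmapl (comul Q) (PhiV Q))
    (S A2 * alpha Q * A3) ⊗ (S A1 * alpha Q * A4).

Definition drinfeld_twist : H ⊗ H :=
  \tsum_(x1, x2, x3 <- PhiV Q)
    tmap S S (tflip (comul Q x1)) * drinfeld_gamma
      * comul Q (x2 * beta Q * S x3).

End DrinfeldTwist.

Section ComoduleAlgebras.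
Variables (k : fieldType) (H : algType k) (Q : quasi_bialgebra H).

Record is_left_comodule_algebra (B : algType k) (lambda : B -> H ⊗ B)
    (Phil : H ⊗ H ⊗ B) : Prop := IsLeftComoduleAlgebra {
  lca_linear : linear lambda;
  lca_monoid : monoid_morphism lambda;
  lca_invertible : exists PhilV, inverse_of Phil PhilV;
  lca_coassoc : forall b : B,
    tmap idfun lambda (lambda b) * Phil = Phil * tmapl (comul Q) (lambda b);
  lca_pentagon :
    (1 ⊗ Phil) * tmap idfun (tmapl (comul Q)) Phil * tassoc3 (Phi Q ⊗ 1)
    = tmap idfun (tmap idfun lambda) Phil * tmapl (comul Q) Phil;
  lca_counit : forall b : B, contrl (counit Q) (lambda b) = b;
  lca_Phi_counit2 : tmap idfun (contrl (counit Q)) Phil = 1 ⊗ 1;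
  lca_Phi_counit1 : contrl (counit Q) Phil = 1 ⊗ 1
}.

Record is_right_comodule_algebra (A : algType k) (rho : A -> A ⊗ H)
    (Phir : A ⊗ H ⊗ H) : Prop := IsRightComoduleAlgebra {
  rca_linear : linear rho;
  rca_monoid : monoid_morphism rho;
  rca_invertible : exists PhirV, inverse_of Phir PhirV;
  rca_coassoc : forall a : A,
    Phir * tmapl rho (rho a) = tmap idfun (comul Q) (rho a) * Phir;
  rca_pentagon :
    (1 ⊗ Phi Q) * tmap idfun (tmapl (comul Q)) Phir * tassoc3 (Phir ⊗ 1)
    = tmap idfun (tmap idfun (comul Q)) Phir * tmapl rho Phir;
  rca_counit : forall a : A, contrr (counit Q) (rho a) = a;
  rca_Phi_counit2 : tmap idfun (contrl (counit Q)) Phir = 1 ⊗ 1;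
  rca_Phi_counit3 : tmap idfun (contrr (counit Q)) Phir = 1 ⊗ 1
}.

Record bicomodule_algebra (A : algType k) := BicomoduleAlgebra {
  bc_lambda : A -> H ⊗ A;
  bc_rho : A -> A ⊗ H;
  bc_Phil : H ⊗ H ⊗ A;
  bc_PhilV : H ⊗ H ⊗ A;
  bc_Phir : A ⊗ H ⊗ H;
  bc_Philr : H ⊗ A ⊗ H;
  bc_PhilrV : H ⊗ A ⊗ H;
  bc_left : is_left_comodule_algebra bc_lambda bc_Phil;
  bc_right : is_right_comodule_algebra bc_rho bc_Phir;
  bc_Phil_inverse : inverse_of bc_Phil bc_PhilV;
  bc_Philr_inverse : inverse_of bc_Philr bc_PhilrV;
  bc_coassoc : forall u : A,
    bc_Philr * tmapl bc_lambda (bc_rho u)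
    = tmap idfun bc_rho (bc_lambda u) * bc_Philr;
  bc_pentagonl :
    (1 ⊗ bc_Philr) * tmap idfun (tmapl bc_lambda) bc_Philr
      * tassoc3 (bc_Phil ⊗ 1)
    = tmap idfun (tmap idfun bc_rho) bc_Phil * tmapl (comul Q) bc_Philr;
  bc_pentagonr :
    (1 ⊗ bc_Phir) * tmap idfun (tmapl bc_rho) bc_Philr
      * tassoc3 (bc_Philr ⊗ 1)
    = tmap idfun (tmap idfun (comul Q)) bc_Philr * tmapl bc_lambda bc_Phir
}.

Definition twist_equivalent (A : algType k)
    (rho : A -> A ⊗ H) (Phir : A ⊗ H ⊗ H)
    (rho' : A -> A ⊗ H) (Phir' : A ⊗ H ⊗ H) : Prop :=
  exists V W : A ⊗ H,
    [/\ inverse_of V W,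
        contrr (counit Q) V = 1,
        forall a : A, rho' a = V * rho a * W &
        Phir' = tmap idfun (comul Q) V * Phir * tmapl rho W * tassoc (W ⊗ 1)].

End ComoduleAlgebras.

(* Naming: for a component u, the legs of lambda u are um = u_[-1] and *)
(* u0 = u_[0], those of rho u are u0 = u_<0> and u1 = u_<1>, and those of *)
(* comul h are h1 and h2; thus X1m2 is ((X^1)_[-1])_2 and x311 is *)
(* ((x^3)_<1>)_1. The t's are the components of the inverse of bc_Philr. *)
Section TwoCoactions.
Variables (k : fieldType) (H : algType k) (Q : quasi_hopf_algebra H).
Variables (A : algType k) (M : bicomodule_algebra Q A).
Let Sinv := antipodeV Q.

Definition rho1 (u : A) : A ⊗ (H^c ⊗ H) :=
  \tsum_(u0, u1 <- bc_rho M u) \tsum_(u0m, u00 <- bc_lambda M u0)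
    u00 ⊗ (op (Sinv u0m) ⊗ u1).

Definition Phi_rho1 : A ⊗ (H^c ⊗ H) ⊗ (H^c ⊗ H) :=
  \tsum_(X1, X2, X3 <- bc_Phir M)
  \tsum_(x1, x2, x3 <- bc_PhilV M)
  \tsum_(t1, t2, t3 <- bc_PhilrV M)
  \tsum_(f1, f2 <- drinfeld_twist Q)
  \tsum_(X1m, X10 <- bc_lambda M X1) \tsum_(X1m1, X1m2 <- comul Q X1m)
  \tsum_(t2m, t20 <- bc_lambda M t2)
    (X10 * x3 * t20)
    ⊗ (op (Sinv (f2 * X1m2 * x2 * t2m)) ⊗ (X2 * t3))
    ⊗ (op (Sinv (f1 * X1m1 * x1 * t1)) ⊗ X3).

Definition rho2 (u : A) : A ⊗ (H^c ⊗ H) :=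
  \tsum_(um, u0 <- bc_lambda M u) \tsum_(u00, u01 <- bc_rho M u0)
    u00 ⊗ (op (Sinv um) ⊗ u01).

Definition Phi_rho2 : A ⊗ (H^c ⊗ H) ⊗ (H^c ⊗ H) :=
  \tsum_(x1, x2, x3 <- bc_PhilV M)
  \tsum_(X1, X2, X3 <- bc_Phir M)
  \tsum_(T1, T2, T3 <- bc_Philr M)
  \tsum_(f1, f2 <- drinfeld_twist Q)
  \tsum_(x30, x31 <- bc_rho M x3) \tsum_(x311, x312 <- comul Q x31)
  \tsum_(T20, T21 <- bc_rho M T2)
    (x30 * X1 * T20)
    ⊗ (op (Sinv (f2 * x2 * T1)) ⊗ (x311 * X2 * T21))
    ⊗ (op (Sinv (f1 * x1)) ⊗ (x312 * X3 * T3)).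

End TwoCoactions.

(* Main.v *)
(**
An element of an iterated tensor power is determined by its values at pairwise
commuting algebra maps ("points") p, q, ... from the factors to a common algebra
T. Writing F(p,q,r) for the value of Phi and p ⋆ q for the point (p ⊗ q) ∘ Delta,
the 3-cocycle condition is Mac Lane's pentagon
  F(q,r,s) F(p,q⋆r,s) F(p,q,r) = F(p,q,r⋆s) F(p⋆q,r,s)
in T, and F(p,q,r) intertwines p⋆q⋆r and p⋆(q⋆r); so identities between
reassociators become commuting diagrams of bracketings.

Call (sigma, alpha, beta) a dual of p when it satisfies the antipode axioms with
p in place of the identity. Any two duals of p are related by a unique invertible
element of T (uniqueness of duals in a monoidal category). Both
(anti (p⋆q), (p⋆q)(alpha), (p⋆q)(beta)) and (anti q ⋆ anti p, gamma, delta) are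
duals of p⋆q, and the element relating them is the Drinfeld twist f at (p, q);
its intertwining, cocycle and counit properties all follow from uniqueness.

A point c of H^op ⊗ H consists of two commuting points of H, the left one after
S^-1; its reassociator involves Phi conjugated by f. After f is cancelled, the
pentagon for Phi_rho1 is the coherence of the reassociators on seven letters, three
points of H on either side of one point of A. Finally, Phi_lr, with its left leg
twisted by S^-1, conjugates rho1 into rho2 and twists Phi_rho1 into Phi_rho2, and
a twist of a comodule algebra is again one.
*)
Require Import Defs.
From mathcomp Require Import all_boot all_order all_algebra.
From mathcomp Require Import boolp.

Set Implicit Arguments.
Unset Strict Implicit.
Unset Printing Implicit Defensive.

Import GRing.Theory.
Local Open Scope ring_scope.

(** * Classes for linear maps, points, commuting letters and intertwiners *)

Class lin (k : fieldType) (V T : lmodType k) (p : V -> T) : Prop :=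
  lin_of : linear p.

Class mor (k : fieldType) (V T : algType k) (p : V -> T) : Prop := Mor {
  mor_lin : linear p;
  mor1 : p 1 = 1;
  morM : forall x y, p (x * y) = p x * p y
}.

Class comm (k : fieldType) (V W : Type) (T : algType k)
    (p : V -> T) (q : W -> T) : Prop :=
  commP : forall v w, p v * q w = q w * p v.

(** A class, so that naturality of reassociators is found by instance search: an intertwiner of
    letters passes to [ev] and [cv] of those letters, hence to every bracketing built from them. *)
Class itw (k : fieldType) (V : Type) (T : algType k) (w : T)
    (p p' : V -> T) : Prop :=
  itwP : forall v, w * p v = p' v * w.

Lemma comm_sym (k : fieldType) (V W : Type) (T : algType k)
    (p : V -> T) (q : W -> T) : comm p q -> comm q p.
Proof. by move=> pq w v; rewrite pq. Qed.

#[global] Hint Mode lin - - - ! : typeclass_instances.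
#[global] Hint Mode mor - - - ! : typeclass_instances.
#[global] Hint Mode comm - - - - ! ! : typeclass_instances.
#[global] Hint Mode itw - - - ! ! ! : typeclass_instances.
#[global] Hint Extern 5 (comm _ _) =>
  simple apply comm_sym; assumption : typeclass_instances.
#[global] Hint Extern 0 (lin _) => solve [typeclasses eauto] : core.
#[global] Hint Extern 0 (mor _) => solve [typeclasses eauto] : core.
#[global] Hint Extern 0 (comm _ _) => solve [typeclasses eauto] : core.

(** * Points *)

Section Points.
Variable k : fieldType.

Global Instance lin_mor (V T : algType k) (p : V -> T) : mor p -> lin p.
Proof. by case. Qed.

Lemma linED (V T : lmodType k) (p : V -> T) : lin p -> forall x y,
    p (x + y) = p x + p y.
Proof. by move=> pl x y; have := pl 1 x y; rewrite !scale1r. Qed.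

Lemma linEZ (V T : lmodType k) (p : V -> T) : lin p -> forall a x,
    p (a *: x) = a *: p x.
Proof. by move=> pl a x; exact: lin_scale. Qed.

Lemma linE_tsum (V W : algType k) (U T : lmodType k) (g : U -> T) (t : V ⊗ W)
    (F : V -> W -> U) : lin g ->
  g (\tsum_(x, y <- t) F x y) = \tsum_(x, y <- t) g (F x y).
Proof. exact: linear_tsum. Qed.

Lemma eq_tsum (V W : algType k) (U : nmodType) (t : V ⊗ W) (F G : V -> W -> U) :
  (forall v w, F v w = G v w) -> tsum t F = tsum t G.
Proof. by move=> FG; apply: eq_bigr => i _. Qed.

Lemma tsum_mull (V W : algType k) (T : algType k) (t : V ⊗ W) (F : V -> W -> T) b :
  b * tsum t F = \tsum_(x, y <- t) b * F x y.
Proof. exact: mulr_sumr. Qed.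

Lemma tsum_mulr (V W : algType k) (T : algType k) (t : V ⊗ W) (F : V -> W -> T) b :
  tsum t F * b = \tsum_(x, y <- t) F x y * b.
Proof. exact: mulr_suml. Qed.

Definition ev (V W T : algType k) (p : V -> T) (q : W -> T) (t : V ⊗ W) : T :=
  @tsum k V W T t (fun v w => p v * q w).

Section Ev.
Variables (V W T : algType k).
Implicit Types (p : V -> T) (q : W -> T).

Lemma ev_bilin p q : lin p -> lin q -> bilin (fun v w => p v * q w).
Proof.
move=> pl ql; split=> [w|v] /=; first exact: (lin_mull _ pl).
exact: (lin_mulr _ ql).
Qed.

Lemma ev_pure p q v w : lin p -> lin q -> ev p q (v ⊗ w) = p v * q w.
Proof. by move=> pl ql; rewrite /ev tsum_pure //; apply: ev_bilin. Qed.

Global Instance lin_ev p q : lin p -> lin q -> lin (ev p q).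
Proof. by move=> pl ql; apply: tsum_linear; apply: ev_bilin. Qed.

Global Instance itw_ev (w : T) p p' q q' :
  itw w p p' -> itw w q q' -> itw w (ev p q) (ev p' q') | 5.
Proof.
move=> wp wq t; rewrite /ev tsum_mull tsum_mulr; apply: eq_tsum => x y.
by rewrite mulrA wp -mulrA wq mulrA.
Qed.

Global Instance comm_evl (Z : Type) p q (r : Z -> T) :
  comm p r -> comm q r -> comm (ev p q) r.
Proof.
move=> pr qr t z; have -> // : itw (r z) (ev p q) (ev p q).
by apply: itw_ev => x; rewrite (pr, qr).
Qed.

Global Instance comm_evr (Z : Type) p q (r : Z -> T) :
  comm r p -> comm r q -> comm r (ev p q).
Proof.
move=> pr qr z t; have -> // : itw (r z) (ev p q) (ev p q).
by apply: itw_ev => x; rewrite (pr, qr).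
Qed.

Global Instance mor_ev p q : mor p -> mor q -> comm p q -> mor (ev p q).
Proof.
move=> pm qm pq.
have el : lin (ev p q) by exact _.
have [] : monoid_morphism (ev p q).
  apply: tens_monoid => //.
    by rewrite [LHS]ev_pure ?mor1 ?mulr1.
  move=> a b a' b'; rewrite pureM !ev_pure !morM !mulrA.
  by rewrite -!mulrA (mulrA (q b)) -pq -mulrA.
by split.
Qed.

End Ev.

Lemma eq_ev (V W T : algType k) (p p' : V -> T) (q q' : W -> T) t :
  p =1 p' -> q =1 q' -> ev p q t = ev p' q' t.
Proof. by move=> pp qq; apply: eq_tsum => x y; rewrite pp qq. Qed.

Lemma ev_tmap (V W V' W' T : algType k) (f : V' -> V) (g : W' -> W)
    (p : V -> T) (q : W -> T) t :
  lin p -> lin q -> ev p q (tmap f g t) = ev (p \o f) (q \o g) t.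
Proof.
move=> pl ql; rewrite /tmap (linE_tsum (g := ev p q)); apply: eq_tsum => x y.
by rewrite ev_pure.
Qed.

Lemma ev_tassoc (V W Z T : algType k) (p : V -> T) (q : W -> T) (r : Z -> T) t :
  lin p -> lin q -> lin r ->
  ev p (ev q r) (tassoc t) = ev (ev p q) r t.
Proof.
move=> pl ql rl; rewrite /tassoc (linE_tsum (g := ev p (ev q r)));
apply: eq_tsum => x y.
rewrite (linE_tsum (g := ev p (ev q r))) [ev p q x]/ev tsum_mulr; apply: eq_tsum => u v.
by rewrite !ev_pure mulrA.
Qed.

(** One formula for three operations: [c] is the comultiplication for [⋆], a left coaction for [⊳]
    and a right coaction for [⊲]. *)
Definition cv (C V W T : algType k) (c : C -> V ⊗ W) (p : V -> T) (q : W -> T)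
  (x : C) : T := ev p q (c x).

Section Cv.
Variables (C V W T : algType k) (c : C -> V ⊗ W).
Implicit Types (p : V -> T) (q : W -> T).

Global Instance mor_cv p q :
  mor c -> mor p -> mor q -> comm p q -> mor (cv c p q).
Proof.
move=> cm pm qm pq; split=> [a x y||x y]; rewrite /cv.
- have el : lin (ev p q) by exact _.
  by rewrite (mor_lin a) (el a).
- by rewrite !mor1.
- by rewrite !morM.
Qed.

Global Instance comm_cvl (Z : Type) p q (r : Z -> T) :
  comm p r -> comm q r -> comm (cv c p q) r.
Proof. by move=> pr qr t z; exact: (comm_evl pr qr). Qed.

Global Instance comm_cvr (Z : Type) p q (r : Z -> T) :
  comm r p -> comm r q -> comm r (cv c p q).
Proof. by move=> pr qr z t; exact: (comm_evr pr qr). Qed.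

Global Instance itw_cv (w : T) p p' q q' :
  itw w p p' -> itw w q q' -> itw w (cv c p q) (cv c p' q') | 5.
Proof. by move=> wp wq x; exact: (itw_ev wp wq). Qed.
End Cv.

Global Instance itw_comm (V W : algType k) (U : Type) (T : algType k) (p : V -> T)
    (q : W -> T)
   (r : U -> T) t : comm p r -> comm q r -> itw (ev p q t) r r.
Proof. by move=> pr qr z; exact: (comm_evl pr qr). Qed.

Lemma ev_tmapl (V U U' W T : algType k) (f : V -> U ⊗ U') (p : U -> T)
    (q : U' -> T) (r : W -> T) t : lin p -> lin q -> lin r ->
  ev p (ev q r) (tmapl f t) = ev (cv f p q) r t.
Proof. by move=> pl ql rl; rewrite /tmapl ev_tassoc ev_tmap. Qed.

Lemma ev_tmapr (V U U' W T : algType k) (f : V -> U ⊗ U') (p : W -> T)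
    (q : U -> T) (r : U' -> T) t : lin p -> lin q -> lin r ->
  ev p (ev q r) (tmap idfun f t) = ev p (cv f q r) t.
Proof. by move=> pl ql rl; rewrite ev_tmap. Qed.

Lemma ev_tmaprr (V U U' W Z T : algType k) (f : V -> U ⊗ U') (p : W -> T)
    (s : Z -> T) (q : U -> T) (r : U' -> T) t : lin p -> lin s -> lin q -> lin r ->
  ev p (ev s (ev q r)) (tmap idfun (tmap idfun f) t) = ev p (ev s (cv f q r)) t.
Proof.
move=> pl sl ql rl; rewrite ev_tmap; apply: eq_ev => // x.
exact: ev_tmapr.
Qed.

Lemma ev_tmaprl (V U U' W Z T : algType k) (f : V -> U ⊗ U') (p : W -> T)
    (s : Z -> T) (q : U -> T) (r : U' -> T) t : lin p -> lin s -> lin q -> lin r ->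
  ev p (ev q (ev r s)) (tmap idfun (tmapl f) t) = ev p (ev (cv f q r) s) t.
Proof.
move=> pl sl ql rl; rewrite ev_tmap; apply: eq_ev => // x.
exact: ev_tmapl.
Qed.

Lemma ev_tassoc3 (U V W Z T : algType k) (p : U -> T) (q : V -> T) (r : W -> T)
   (s : Z -> T) t : lin p -> lin q -> lin r -> mor s ->
  ev p (ev q (ev r s)) (tassoc3 (t ⊗ 1)) = ev p (ev q r) t.
Proof.
move=> pl ql rl sm; rewrite /tassoc3 ev_tmap.
rewrite (eq_ev (p' := p) (q' := ev (ev q r) s)) //; last first.
  by move=> x; apply: ev_tassoc.
by rewrite ev_tassoc ev_pure mor1 mulr1.
Qed.

Lemma ev_tassoc1 (U V Z T : algType k) (p : U -> T) (q : V -> T)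
   (s : Z -> T) t : lin p -> lin q -> mor s ->
  ev p (ev q s) (tassoc (t ⊗ 1)) = ev p q t.
Proof. by move=> pl ql sm; rewrite ev_tassoc ev_pure mor1 mulr1. Qed.

Lemma ev_1pure (U V T : algType k) (p : U -> T) (q : V -> T) t : mor p -> lin q ->
  ev p q (1 ⊗ t) = q t.
Proof. by move=> pm qm; rewrite ev_pure mor1 mul1r. Qed.

Lemma mor_ev_push (V W T T' : algType k) (g : T -> T') (p : V -> T) (q : W -> T) t :
  mor g -> g (ev p q t) = ev (g \o p) (g \o q) t.
Proof.
by move=> gm; rewrite /ev (linE_tsum (g := g)); apply: eq_tsum => x y; rewrite morM.
Qed.

Lemma inv_sq (T : algType k) (a a' b c d d' : T) :
  inverse_of a a' -> inverse_of d d' -> b * d = a * c -> a' * b = c * d'.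
Proof.
move=> [_ a'a] [dd' _] e.
by rewrite -[b]mulr1 -dd' (mulrA b) e !mulrA a'a mul1r.
Qed.

Lemma inverseC (T : algType k) (a a' : T) : inverse_of a a' -> inverse_of a' a.
Proof. by case. Qed.

Lemma inverseM (T : algType k) (a a' b b' : T) :
  inverse_of a a' -> inverse_of b b' -> inverse_of (a * b) (b' * a').
Proof.
move=> [h1 h2] [h3 h4]; split; first by rewrite mulrA -(mulrA a) h3 mulr1 h1.
by rewrite mulrA -(mulrA b') h2 mulr1 h4.
Qed.

Lemma inverse_mor (V T : algType k) (p : V -> T) a a' : mor p ->
  inverse_of a a' -> inverse_of (p a) (p a').
Proof. by move=> pm [h1 h2]; split; rewrite -morM ?h1 ?h2 mor1. Qed.

Lemma inverse_uniq (T : algType k) (a a' a'' : T) :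
  inverse_of a a' -> inverse_of a a'' -> a' = a''.
Proof. by move=> [_ h] [h' _]; rewrite -[a']mulr1 -h' mulrA h mul1r. Qed.

(** The pentagon solved for the factors that later steps need. It is stated for bare invertible
    elements so as to serve [Phi] as well as the left and mixed reassociators of a bicomodule
    algebra. *)
Lemma pentagon_words (T : algType k) (a a' b b' c c' d d' e e' : T) :
  inverse_of a a' -> inverse_of b b' -> inverse_of c c' -> inverse_of d d' ->
  inverse_of e e' -> a * b * c = d * e ->
  [/\ c' = e' * d' * a * b, d' * a = e * c' * b', c' * b' * a' = e' * d',
      c * e' = b' * a' * d & a' * d = b * c * e'] /\ e * c' = d' * a * b.
Proof.
move=> ia ib ic id ie abc.
have ida : a * (b * c) = d * e by rewrite mulrA.
have da : d' * a = e * c' * b'.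
  by rewrite -mulrA; apply: (inv_sq id (inverseM ib ic)).
have ec : e * c' = d' * a * b by rewrite da -mulrA ib.2 mulr1.
have ad : a' * d = b * c * e' by rewrite (inv_sq ia ie (esym ida)).
do 2!split=> //.
- by rewrite -!mulrA (mulrA d') -ec mulrA ie.2 mul1r.
- have i1 := inverseM (inverseM ia ib) ic; have i2 := inverseM id ie.
  rewrite -mulrA; apply: (inverse_uniq i1); rewrite abc; exact: i2.
- have -> : d = a * b * c * e' by rewrite abc -mulrA ie.1 mulr1.
  by rewrite !mulrA -(mulrA b') ia.2 mulr1 ib.2 mul1r.
Qed.

Lemma inverse_idem (T : algType k) (a a' : T) : inverse_of a a' -> a * a = a -> a = 1.
Proof. by move=> [h _] e; rewrite -[LHS]mulr1 -h mulrA e. Qed.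

Lemma itw_inv (V : Type) (T : algType k) (w w' : T) (p p' : V -> T) :
  inverse_of w w' -> itw w p p' -> itw w' p' p.
Proof. by move=> ww pp v; apply: (inv_sq ww ww); rewrite pp. Qed.

Lemma itw_compose (V : Type) (U : algType k) (a b : U) (f g h : V -> U) :
  itw a g h -> itw b f g -> itw (a * b) f h.
Proof. by move=> ah bg v; rewrite -mulrA bg mulrA ah mulrA. Qed.

(** * Reassociators of a quasi-bialgebra at points *)

Section QuasiBialgebraPoints.
Variables (H : algType k) (Q : quasi_bialgebra H).

Global Instance mor_comul : mor (comul Q).
Proof. by split; [exact: linearP | exact: rmorph1 | exact: rmorphM]. Qed.

Definition triv (T : algType k) (h : H) : T := (counit Q h : k) *: 1.

Global Instance mor_triv T : mor (@triv T).
Proof.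
split=> [a x y||x y]; rewrite /triv.
- by rewrite linearP /= scalerDl scalerA.
- by rewrite rmorph1 scale1r.
- by rewrite rmorphM /= -scalerAl mul1r scalerA.
Qed.

Global Instance comm_trivl (T : algType k) Z (p : Z -> T) : comm (@triv T) p.
Proof. by move=> v w; rewrite /triv -scalerAl -scalerAr mul1r mulr1. Qed.
Global Instance comm_trivr (T : algType k) Z (p : Z -> T) : comm p (@triv T).
Proof. exact: comm_sym. Qed.
Lemma ev_trivl (V T : algType k) (p : V -> T) t
    `{!lin p} :
  ev (@triv T) p t = p (contrl (counit Q) t).
Proof.
rewrite /contrl (linE_tsum (g := p)); apply: eq_tsum => x y.
by rewrite linEZ /triv -scalerAl mul1r.
Qed.

Lemma ev_trivr (V T : algType k) (p : V -> T) t
    `{!lin p} :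
  ev p (@triv T) t = p (contrr (counit Q) t).
Proof.
rewrite /contrr (linE_tsum (g := p)); apply: eq_tsum => x y.
by rewrite linEZ /triv -scalerAr mulr1.
Qed.

Lemma cv_trivl (T : algType k) (p : H -> T)
    `{!lin p} :
  cv (comul Q) (@triv T) p = p.
Proof. by apply: funext => h; rewrite /cv ev_trivl comul_counitl. Qed.

Lemma cv_trivr (T : algType k) (p : H -> T)
    `{!lin p} :
  cv (comul Q) p (@triv T) = p.
Proof. by apply: funext => h; rewrite /cv ev_trivr comul_counitr. Qed.

Section Phi3.
Variable T : algType k.
Implicit Types p q r s : H -> T.

Definition Phi3 p q r : T := ev p (ev q r) (Phi Q).
Definition Phi3V p q r : T := ev p (ev q r) (PhiV Q).

Lemma Phi3_inv p q r
    `{!mor p} `{!mor q} `{!mor r} `{!comm p q} `{!comm p r} `{!comm q r} :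
  inverse_of (Phi3 p q r) (Phi3V p q r).
Proof. by apply: inverse_mor (Phi_inverse Q). Qed.

Lemma Phi3VK p q r
    `{!mor p} `{!mor q} `{!mor r} `{!comm p q} `{!comm p r} `{!comm q r} :
  Phi3V p q r * Phi3 p q r = 1.
Proof. by case: (Phi3_inv (p := p) (q := q) (r := r)). Qed.

Global Instance itw_coassoc p q r
    `{!mor p} `{!mor q} `{!mor r} `{!comm p q} `{!comm p r} `{!comm q r} :
  itw (Phi3 p q r) (cv (comul Q) (cv (comul Q) p q) r)
    (cv (comul Q) p (cv (comul Q) q r)) | 1.
Proof.
move=> h; rewrite /Phi3 {1 3}/cv -ev_tmapl -ev_tmapr comul_coassoc.
by rewrite -!(morM (p := ev p (ev q r))) -(mulrA _ (PhiV Q)) (Phi_inverse Q).2 mulr1.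
Qed.

Global Instance itw_coassocV p q r
    `{!mor p} `{!mor q} `{!mor r} `{!comm p q} `{!comm p r} `{!comm q r} :
  itw (Phi3V p q r) (cv (comul Q) p (cv (comul Q) q r))
    (cv (comul Q) (cv (comul Q) p q) r) | 1.
Proof.
by apply: (itw_inv (w := Phi3 p q r)); exact: Phi3_inv.
Qed.

Lemma pentagon p q r s
    `{!mor p} `{!mor q} `{!mor r} `{!mor s} `{!comm p q} `{!comm p r} `{!comm p s}
      `{!comm q r} `{!comm q s} `{!comm r s} :
  Phi3 q r s * Phi3 p (cv (comul Q) q r) s * Phi3 p q r
  = Phi3 p q (cv (comul Q) r s) * Phi3 (cv (comul Q) p q) r s.
Proof.
rewrite /Phi3.
have := congr1 (ev p (ev q (ev r s))) (Phi_pentagon Q).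
rewrite !morM ev_1pure ev_tmaprl ev_tassoc3 ev_tmaprr => ->.
by rewrite ev_tmapl.
Qed.

Lemma pentagonV p q r s
    `{!mor p} `{!mor q} `{!mor r} `{!mor s} `{!comm p q} `{!comm p r} `{!comm p s}
      `{!comm q r} `{!comm q s} `{!comm r s}
    (a := Phi3 q r s) (b := Phi3 p (cv (comul Q) q r) s) (c := Phi3 p q r)
    (d := Phi3 p q (cv (comul Q) r s)) (e := Phi3 (cv (comul Q) p q) r s)
    (a' := Phi3V q r s) (b' := Phi3V p (cv (comul Q) q r) s) (c' := Phi3V p q r)
    (d' := Phi3V p q (cv (comul Q) r s)) (e' := Phi3V (cv (comul Q) p q) r s) :
  [/\ c' = e' * d' * a * b, d' * a = e * c' * b', c' * b' * a' = e' * d',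
      c * e' = b' * a' * d & a' * d = b * c * e'] /\ e * c' = d' * a * b.
Proof. by apply: pentagon_words pentagon; exact: Phi3_inv. Qed.

Lemma Phi3_triv2 p q
    `{!mor p} `{!mor q} `{!comm p q} :
  Phi3 p (@triv T) q = 1.
Proof.
rewrite /Phi3.
have := congr1 (ev p q) (Phi_counit Q).
rewrite ev_tmap [ev p q _]ev_pure !mor1 mulr1 => <-.
by apply: eq_ev => // x; rewrite ev_trivl.
Qed.

(** The counit axiom concerns the middle leg. With two trivial letters in front, the pentagon makes
    this value idempotent, and an invertible idempotent is 1. *)
Lemma Phi3_triv1 p q
    `{!mor p} `{!mor q} `{!comm p q} :
  Phi3 (@triv T) p q = 1.
Proof.
have := pentagon (p := @triv T) (q := @triv T) (r := p) (s := q).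
rewrite !(cv_trivl, Phi3_triv2) mulr1 => e.
apply: (inverse_idem Phi3_inv).
by rewrite e mul1r.
Qed.

Lemma Phi3_triv3 p q
    `{!mor p} `{!mor q} `{!comm p q} :
  Phi3 p q (@triv T) = 1.
Proof.
have := pentagon (p := p) (q := q) (r := @triv T) (s := @triv T).
rewrite !(cv_trivr, Phi3_triv2) mul1r mulr1 => e.
apply: (inverse_idem Phi3_inv).
by rewrite e.
Qed.

Lemma Phi3V_triv1 p q
    `{!mor p} `{!mor q} `{!comm p q} :
  Phi3V (@triv T) p q = 1.
Proof.
have [] : inverse_of (Phi3 (@triv T) p q) (Phi3V (@triv T) p q) by apply: Phi3_inv.
by rewrite Phi3_triv1 mul1r.
Qed.
Lemma Phi3V_triv2 p q
    `{!mor p} `{!mor q} `{!comm p q} :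
  Phi3V p (@triv T) q = 1.
Proof.
have [] : inverse_of (Phi3 p (@triv T) q) (Phi3V p (@triv T) q) by apply: Phi3_inv.
by rewrite Phi3_triv2 mul1r.
Qed.
Lemma Phi3V_triv3 p q
    `{!mor p} `{!mor q} `{!comm p q} :
  Phi3V p q (@triv T) = 1.
Proof.
have [] : inverse_of (Phi3 p q (@triv T)) (Phi3V p q (@triv T)) by apply: Phi3_inv.
by rewrite Phi3_triv3 mul1r.
Qed.

End Phi3.
End QuasiBialgebraPoints.

End Points.

(** * Leg inclusions and universal points *)

Definition iL {k : fieldType} {X : Type} {V W : algType k} (p : X -> V) (x : X)
  : V ⊗ W := p x ⊗ 1.
Definition iR {k : fieldType} {X : Type} {V W : algType k} (p : X -> W) (x : X)
  : V ⊗ W := 1 ⊗ p x.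

Section Inclusions.
Variable k : fieldType.

Global Instance mor_iL (X V W : algType k) (p : X -> V) `{!mor p} : mor (iL (W := W) p).
Proof.
split=> [a x y||x y]; rewrite /iL.
- by rewrite (mor_lin a); exact: (pure_bilin V W).1.
- by rewrite mor1.
- by rewrite morM pureM mulr1.
Qed.

Global Instance mor_iR (X V W : algType k) (p : X -> W) `{!mor p} : mor (iR (V := V) p).
Proof.
split=> [a x y||x y]; rewrite /iR.
- by rewrite (mor_lin a); exact: (pure_bilin V W).2.
- by rewrite mor1.
- by rewrite morM pureM mulr1.
Qed.

(** Letters on different legs commute whatever their values. This is how a point and its dual, whose
    values in one algebra need not commute, become commuting letters to which the pentagon
    applies. *)
Global Instance comm_iLR (X Y : Type) (V W : algType k) (p : X -> V) (q : Y -> W) :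
  comm (iL p) (iR q).
Proof. by move=> x y; rewrite !pureM !mul1r !mulr1. Qed.
Global Instance comm_iRL (X Y : Type) (V W : algType k) (p : X -> V) (q : Y -> W) :
  comm (iR q) (iL p).
Proof. exact: comm_sym. Qed.
Global Instance comm_iLL (X Y : Type) (V W : algType k) (p : X -> V) (q : Y -> V)
  `{!comm p q} : comm (iL (W := W) p) (iL q).
Proof. by move=> x y; rewrite !pureM commP. Qed.
Global Instance comm_iRR (X Y : Type) (V W : algType k) (p : X -> W) (q : Y -> W)
  `{!comm p q} : comm (iR (V := V) p) (iR q).
Proof. by move=> x y; rewrite !pureM commP. Qed.

Global Instance mor_idfun (V : algType k) : mor (@idfun V).
Proof. by []. Qed.

Lemma ev_iR (X Y V W : algType k) (p : X -> W) (q : Y -> W) :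
  ev (iR (V := V) p) (iR q) = iR (ev p q).
Proof.
apply: funext => t.
rewrite -[RHS]/(iR (V := V) idfun (ev p q t)) [ev p q t]/ev (linE_tsum (g := iR _)).
by apply: eq_tsum => x y; rewrite pureM mulr1.
Qed.

Lemma ev_iL (X Y V W : algType k) (p : X -> V) (q : Y -> V) :
  ev (iL (W := W) p) (iL q) = iL (ev p q).
Proof.
apply: funext => t.
rewrite -[RHS]/(iL (W := W) idfun (ev p q t)) [ev p q t]/ev (linE_tsum (g := iL _)).
by apply: eq_tsum => x y; rewrite pureM mulr1.
Qed.

Lemma cv_iR (C X Y V W : algType k) (c : C -> X ⊗ Y) (p : X -> W) (q : Y -> W) :
  cv c (iR (V := V) p) (iR q) = iR (cv c p q).
Proof. by rewrite /cv ev_iR. Qed.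

Lemma ev_iLR (X Y V W T : algType k) (f : V -> T) (g : W -> T)
    (p : X -> V) (q : Y -> W) t `{!lin f} `{!lin g} :
  ev f g (ev (iL p) (iR q) t) = ev (f \o p) (g \o q) t.
Proof.
rewrite {2}/ev (linE_tsum (g := ev f g)); apply: eq_tsum => x y.
by rewrite pureM mulr1 mul1r ev_pure.
Qed.

(** The leg inclusions are the universal points: an identity proved at all points holds in the
    tensor product itself. *)
Lemma ev_iLR_id (V W : algType k) (t : V ⊗ W) : ev (iL idfun) (iR idfun) t = t.
Proof.
by rewrite [RHS]tensE; apply: eq_tsum => x y; rewrite pureM mulr1 mul1r.
Qed.

End Inclusions.

(** * Contractions *)

(* [lkill E m m'] lets [m] be replaced by [m'] at the left end of the argument of
   [E], [rkill] at its right end. In practice [E] inserts [alpha] or [beta] between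
   the legs of a tensor and multiplies out, [m] is a product [sigma ⋆ phi] or
   [phi ⋆ sigma] of adjacent legs, and [m'] is trivial: an evaluation or a
   coevaluation. *)
Section Kill.
Variables (k : fieldType) (U X : algType k).

Class lkill (E : U -> X) (V : Type) (m m' : V -> U) : Prop :=
  lkillP : forall v Z, E (m v * Z) = E (m' v * Z).
Class rkill (E : U -> X) (V : Type) (m m' : V -> U) : Prop :=
  rkillP : forall v Z, E (Z * m v) = E (Z * m' v).

Section Ev.
Variables (E : U -> X) (V W : algType k).
Context `{!lin E}.
Implicit Types (p : V -> U) (q : W -> U).

Let E_tsum (t : V ⊗ W) F : E (tsum t F) = \tsum_(x, y <- t) E (F x y).
Proof. exact: linE_tsum. Qed.

Global Instance lkill_evl p p' q : lkill E p p' -> lkill E (ev p q) (ev p' q).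
Proof.
move=> pp t Z; rewrite /ev !tsum_mulr !E_tsum; apply: eq_tsum => x y.
by rewrite -!mulrA pp.
Qed.

Global Instance lkill_evr p q q' : comm p q -> comm p q' -> lkill E q q' ->
  lkill E (ev p q) (ev p q').
Proof.
move=> pq pq' qq t Z; rewrite /ev !tsum_mulr !E_tsum; apply: eq_tsum => x y.
by rewrite pq pq' -!mulrA qq.
Qed.

Global Instance rkill_evr p q q' : rkill E q q' -> rkill E (ev p q) (ev p q').
Proof.
move=> pp t Z; rewrite /ev !tsum_mull !E_tsum; apply: eq_tsum => x y.
by rewrite !mulrA pp.
Qed.

Global Instance rkill_evl p p' q : comm p q -> comm p' q -> rkill E p p' ->
  rkill E (ev p q) (ev p' q).
Proof.
move=> pq pq' qq t Z; rewrite /ev !tsum_mull !E_tsum; apply: eq_tsum => x y.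
by rewrite pq pq' !mulrA qq.
Qed.

Variables (C : algType k) (c : C -> V ⊗ W).

Global Instance lkill_cvl p p' q : lkill E p p' -> lkill E (cv c p q) (cv c p' q).
Proof. by move=> pp x; exact: (lkill_evl _ pp). Qed.
Global Instance lkill_cvr p q q' : comm p q -> comm p q' -> lkill E q q' ->
  lkill E (cv c p q) (cv c p q').
Proof. by move=> pq pq' qq x; exact: (lkill_evr pq pq' qq). Qed.
Global Instance rkill_cvr p q q' : rkill E q q' -> rkill E (cv c p q) (cv c p q').
Proof. by move=> pp x; exact: (rkill_evr _ pp). Qed.
Global Instance rkill_cvl p p' q : comm p q -> comm p' q -> rkill E p p' ->
  rkill E (cv c p q) (cv c p' q).
Proof. by move=> pq pq' qq x; exact: (rkill_evl pq pq' qq). Qed.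

End Ev.

End Kill.

(** * Evaluations and coevaluations as contractions *)

Section KillBase.
Variables (k : fieldType) (H : algType k) (Q : quasi_bialgebra H) (T : algType k).
Implicit Types (phi : H -> T) (sigma : H -> T^c).

Definition evalP phi sigma (alpha : T) : Prop :=
  forall h, ev (fun x => unop (sigma x) * alpha) phi (comul Q h)
            = (counit Q h : k) *: alpha.
Definition coevP phi sigma (beta : T) : Prop :=
  forall h, ev (fun x => phi x * beta) (fun x => unop (sigma x)) (comul Q h)
            = (counit Q h : k) *: beta.

(* Anti-multiplicative maps into [T] are algebra maps into [T^c]: the legs of a
   contracted tensor alternate between [T^c] and [T], with [alpha] following a [T^c]
   leg and [beta] a [T] leg. *)
Definition eA (alpha : T) (a : T^c) : T := unop a * alpha.
Definition eB (beta : T) (b : T) : T := b * beta.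
Definition eU (b : T^c) : T := unop b.

Global Instance lin_eA alpha : lin (eA alpha).
Proof. by move=> a x y; rewrite /eA mulrDl scalerAl. Qed.
Global Instance lin_eB alpha : lin (eB alpha).
Proof. by move=> a x y; rewrite /eB mulrDl scalerAl. Qed.
Global Instance lin_eU : lin eU.
Proof. by []. Qed.

Lemma unopM (a b : T^c) : unop (a * b) = unop b * unop a.
Proof. by []. Qed.

(** In [T^c] a left factor lands next to [alpha], and [E] releases [m] as [phi] on the other side of
    [alpha]; the evaluation axiom then applies around [alpha]. *)
Lemma lkill_head (W : algType k) (E : W -> T) (m : H -> W) phi sigma alpha
    `{!lin E} :
  (forall h w, E (m h * w) = phi h * E w) -> evalP phi sigma alpha ->
  lkill (ev (eA alpha) E) (cv (comul Q) (iL sigma) (iR m)) (triv Q (tens T^c W)).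
Proof.
move=> Em ePh h Z; elim/tens_ind: Z => [a w|x y IHx IHy]; last first.
  by rewrite !mulrDr !(linED (p := ev (eA alpha) E)) IHx IHy.
rewrite /cv {2}/ev tsum_mulr (linE_tsum (g := ev (eA alpha) E)).
rewrite /triv -scalerAl mul1r (linEZ (p := ev (eA alpha) E)) ev_pure.
rewrite {2}/eA -mulrA scalerAr scalerAl -ePh /ev tsum_mulr tsum_mull.
apply: eq_tsum => x y; rewrite !pureM mulr1 mul1r -/(ev _ _ _) ev_pure Em /eA.
by rewrite unopM !mulrA.
Qed.

(** Mirror image: in [T] a right factor lands next to [beta], and [E] releases [m] on the left as
    [sigma]. *)
Lemma rkill_head (W : algType k) (E : W -> T) (m : H -> W) phi sigma beta
    `{!lin E} :
  (forall h w, E (w * m h) = unop (sigma h) * E w) -> coevP phi sigma beta ->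
  rkill (ev (eB beta) E) (cv (comul Q) (iL phi) (iR m)) (triv Q (tens T W)).
Proof.
move=> Em ePh h Z; elim/tens_ind: Z => [a w|x y IHx IHy]; last first.
  by rewrite !mulrDl !(linED (p := ev (eB beta) E)) IHx IHy.
rewrite /cv {2}/ev tsum_mull (linE_tsum (g := ev (eB beta) E)).
rewrite /triv -scalerAr mulr1 (linEZ (p := ev (eB beta) E)) ev_pure.
rewrite {2}/eB -mulrA scalerAr scalerAl -ePh /ev tsum_mulr tsum_mull.
apply: eq_tsum => x y; rewrite !pureM mulr1 mul1r -/(ev _ _ _) ev_pure Em /eB.
by rewrite !mulrA.
Qed.

Lemma lkill_tail (V W : algType k) (f : V -> T) (E : W -> T) (m m' : H -> W)
   `{!lin E} `{!lin f} :
  lkill E m m' -> lkill (ev f E) (iR m) (iR m').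
Proof.
move=> mm h Z; elim/tens_ind: Z => [a w|x y IHx IHy]; last first.
  by rewrite !mulrDr !(linED (p := ev f E)) IHx IHy.
by rewrite !pureM !ev_pure mm.
Qed.

Lemma rkill_tail (V W : algType k) (f : V -> T) (E : W -> T) (m m' : H -> W)
   `{!lin E} `{!lin f} :
  rkill E m m' -> rkill (ev f E) (iR m) (iR m').
Proof.
move=> mm h Z; elim/tens_ind: Z => [a w|x y IHx IHy]; last first.
  by rewrite !mulrDl !(linED (p := ev f E)) IHx IHy.
by rewrite !pureM !ev_pure mm.
Qed.

Lemma iR_triv (V W : algType k) : iR (triv Q W) = triv Q (tens V W).
Proof.
apply: funext => h; rewrite /iR /triv.
by rewrite -(linEZ (p := iR idfun)).
Qed.

End KillBase.

(** * The pentagon under contraction *)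

Section Contractions.
Variables (k : fieldType) (H : algType k) (Q : quasi_bialgebra H).
Variables (U X : algType k) (E : U -> X).
Context `{!lin E}.

Local Notation "p ⋆ q" := (cv (comul Q) p q) (at level 40, left associativity).
Local Notation F := (Phi3 Q).
Local Notation G := (Phi3V Q).
Local Notation e := (triv Q U).

Section Kill3.
Variables (p q r p' q' r' : H -> U) (w z : U).
Lemma lkill3 : lkill E (ev p (ev q r)) (ev p' (ev q' r')) ->
  E (F p q r * w) = E (F p' q' r' * w).
Proof. by move=> kk; apply: kk. Qed.
Lemma lkill3V : lkill E (ev p (ev q r)) (ev p' (ev q' r')) ->
  E (G p q r * w) = E (G p' q' r' * w).
Proof. by move=> kk; apply: kk. Qed.
Lemma rkill3 : rkill E (ev p (ev q r)) (ev p' (ev q' r')) ->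
  E (w * F p q r) = E (w * F p' q' r').
Proof. by move=> kk; apply: kk. Qed.
Lemma rkill3V : rkill E (ev p (ev q r)) (ev p' (ev q' r')) ->
  E (w * G p q r) = E (w * G p' q' r').
Proof. by move=> kk; apply: kk. Qed.
End Kill3.

Global Instance itw_mul (V : Type) (a b : U) (p : V -> U) :
  itw a p p -> itw b p p -> itw (a * b) p p.
Proof. by move=> ap bp v; rewrite -mulrA bp !mulrA ap. Qed.

(* A contraction of two legs can also be applied behind (resp. in front of) a factor
   [w] commuting with the contracted legs. *)
Definition preE (w z : U) : X := E (w * z).
Definition postE (w z : U) : X := E (z * w).

Global Instance lin_preE w : lin (preE w).
Proof. by move=> a x y; rewrite /preE mulrDr -scalerAr (lin_of a). Qed.
Global Instance lin_postE w : lin (postE w).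
Proof. by move=> a x y; rewrite /postE mulrDl -scalerAl (lin_of a). Qed.

Global Instance lkill_preE (V : Type) (m m' : V -> U) w :
  lkill E m m' -> itw w m m -> itw w m' m' -> lkill (preE w) m m'.
Proof.
move=> mm wm wm' v z; rewrite /preE !mulrA (itwP (p := m) (p' := m)).
by rewrite (itwP (p := m') (p' := m')) -!mulrA mm.
Qed.
Global Instance rkill_postE (V : Type) (m m' : V -> U) w :
  rkill E m m' -> itw w m m -> itw w m' m' -> rkill (postE w) m m'.
Proof.
move=> mm wm wm' v z; rewrite /postE -!mulrA -(itwP (p := m) (p' := m)).
by rewrite -(itwP (p := m') (p' := m')) !mulrA mm.
Qed.

Section Kill3C.
Variables (p q r p' q' r' : H -> U) (w z : U).
Lemma lkill3C : lkill (preE w) (ev p (ev q r)) (ev p' (ev q' r')) ->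
  E (w * F p q r * z) = E (w * F p' q' r' * z).
Proof. by move=> kk; rewrite -!mulrA; apply: kk. Qed.
Lemma lkill3VC : lkill (preE w) (ev p (ev q r)) (ev p' (ev q' r')) ->
  E (w * G p q r * z) = E (w * G p' q' r' * z).
Proof. by move=> kk; rewrite -!mulrA; apply: kk. Qed.
Lemma rkill3C : rkill (postE w) (ev p (ev q r)) (ev p' (ev q' r')) ->
  E (z * F p q r * w) = E (z * F p' q' r' * w).
Proof. by move=> kk; apply: kk. Qed.
Lemma rkill3VC : rkill (postE w) (ev p (ev q r)) (ev p' (ev q' r')) ->
  E (z * G p q r * w) = E (z * G p' q' r' * w).
Proof. by move=> kk; apply: kk. Qed.
End Kill3C.

(** The reassociator carries one bracketing of [p1], [p2], [p3] to the other. One bracketing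
    collapses to [p3] by contracting the first two letters, the other to [p1] by contracting the
    last two. *)
Lemma kill_itw p1 p2 p3 `{!mor p1} `{!mor p2} `{!mor p3}
    `{!comm p1 p2} `{!comm p1 p3} `{!comm p2 p3}
    `{!lkill E (p1 ⋆ p2) e} `{!rkill E (p2 ⋆ p3) e} h :
  E (p3 h * G p1 p2 p3) = E (G p1 p2 p3 * p1 h).
Proof.
transitivity (E ((p1 ⋆ p2 ⋆ p3) h * G p1 p2 p3)).
  have -> : lkill E (p1 ⋆ p2 ⋆ p3) (e ⋆ p3) by exact _.
  by rewrite cv_trivl.
rewrite -(itwP (p := p1 ⋆ (p2 ⋆ p3))).
have -> : rkill E (p1 ⋆ (p2 ⋆ p3)) (p1 ⋆ e) by exact _.
by rewrite cv_trivr.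
Qed.

Section Four.
Variables p1 p2 p3 p4 : H -> U.
Context `{!mor p1} `{!mor p2} `{!mor p3} `{!mor p4}.
Context `{!comm p1 p2} `{!comm p1 p3} `{!comm p1 p4} `{!comm p2 p3}
  `{!comm p2 p4} `{!comm p3 p4}.

(** The pentagon expresses the left-hand reassociator by four others; each contraction trivializes
    one of them, and the one on the last three letters survives. *)
Lemma kill_zig `{!lkill E (p1 ⋆ p2) e} `{!lkill E (p3 ⋆ p4) e} `{!rkill E (p2 ⋆ p3) e} :
  E (G p1 p2 p3) = E (F p2 p3 p4).
Proof.
have [[-> _ _ _ _] _] := pentagonV Q (p := p1) (q := p2) (r := p3) (s := p4).
rewrite -!mulrA (lkill3V (p' := e) (q' := p3) (r' := p4)) Phi3V_triv1 mul1r.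
rewrite (lkill3V (p' := p1) (q' := p2) (r' := e)) Phi3V_triv3 mul1r.
by rewrite (rkill3 (p' := p1) (q' := e) (r' := p4)) Phi3_triv2 mulr1.
Qed.

(** The element [a] rebrackets the word so that [p2] and [p3] are adjacent. Contracting them brings
    [p1] and [p4] together, which contract in turn; [kill_delta] is the mirror image for
    coevaluations. *)
Lemma kill_gamma `{!lkill E (p1 ⋆ p4) e} `{!lkill E (p2 ⋆ p3) e}
    (a := F p1 p2 p3 * G (p1 ⋆ p2) p3 p4) h :
  E (a * ((p1 ⋆ p2) ⋆ (p3 ⋆ p4)) h) = (counit Q h : k) *: E a.
Proof.
have -> : a * ((p1 ⋆ p2) ⋆ (p3 ⋆ p4)) h = (p1 ⋆ (p2 ⋆ p3) ⋆ p4) h * a.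
  rewrite -mulrA (itwP (p' := (p1 ⋆ p2) ⋆ p3 ⋆ p4)) mulrA.
  by rewrite (itwP (p' := p1 ⋆ (p2 ⋆ p3) ⋆ p4)) mulrA.
have -> : lkill E (p1 ⋆ (p2 ⋆ p3) ⋆ p4) (p1 ⋆ e ⋆ p4) by exact _.
rewrite cv_trivr.
have -> : lkill E (p1 ⋆ p4) e by exact _.
by rewrite -scalerAl mul1r linEZ.
Qed.

Lemma kill_delta `{!rkill E (p1 ⋆ p4) e} `{!rkill E (p2 ⋆ p3) e}
    (a := F (p1 ⋆ p2) p3 p4 * G p1 p2 p3) h :
  E (((p1 ⋆ p2) ⋆ (p3 ⋆ p4)) h * a) = (counit Q h : k) *: E a.
Proof.
have -> : ((p1 ⋆ p2) ⋆ (p3 ⋆ p4)) h * a = a * (p1 ⋆ (p2 ⋆ p3) ⋆ p4) h.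
  rewrite -mulrA (itwP (p' := (p1 ⋆ p2) ⋆ p3 ⋆ p4)) !mulrA.
  by rewrite (itwP (p' := (p1 ⋆ p2) ⋆ (p3 ⋆ p4))).
have -> : rkill E (p1 ⋆ (p2 ⋆ p3) ⋆ p4) (p1 ⋆ e ⋆ p4) by exact _.
rewrite cv_trivr.
have -> : rkill E (p1 ⋆ p4) e by exact _.
by rewrite -scalerAr mulr1 linEZ.
Qed.

End Four.

Section Six.
Variables p1 p2 p3 p4 p5 p6 : H -> U.
Context `{!mor p1} `{!mor p2} `{!mor p3} `{!mor p4} `{!mor p5} `{!mor p6}.
Context `{!comm p1 p2} `{!comm p1 p3} `{!comm p1 p4} `{!comm p1 p5} `{!comm p1 p6}
  `{!comm p2 p3} `{!comm p2 p4} `{!comm p2 p5} `{!comm p2 p6} `{!comm p3 p4}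
  `{!comm p3 p5} `{!comm p3 p6} `{!comm p4 p5} `{!comm p4 p6} `{!comm p5 p6}.

(* The left-hand side reassociates [(12)((3(45))6)] into [((1(23))4)(56)]; the
   evaluations of 23, 14 and the coevaluations of 45, 36 form two nested zigzags. *)
Lemma kill_zag6 `{!lkill E (p2 ⋆ p3) e} `{!lkill E (p1 ⋆ p4) e}
    `{!rkill E (p4 ⋆ p5) e} `{!rkill E (p3 ⋆ p6) e} :
  E (F p1 p2 p3 * G (p1 ⋆ p2) p3 p4 * G (p1 ⋆ p2) (p3 ⋆ p4) (p5 ⋆ p6)
     * (F (p3 ⋆ p4) p5 p6 * G p3 p4 p5))
  = E (G p1 p4 p5 * G p2 p3 p6).
Proof.
have [[_ e1 _ _ _] _] := pentagonV Q (p := p1 ⋆ p2) (q := p3 ⋆ p4) (r := p5) (s := p6).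
have [[_ _ e2 _ _] _] := pentagonV Q (p := p1 ⋆ p2) (q := p3) (r := p4) (s := p5).
have [[_ _ _ e3 _] _] := pentagonV Q (p := p1) (q := p2) (r := p3) (s := p6).
rewrite -!mulrA (mulrA (G (p1 ⋆ p2) (p3 ⋆ p4) (p5 ⋆ p6))) e1.
(* By naturality the reassociator ending in [p5], [p6] goes to the far left and the one ending in
   [p6] alone to the far right: only the ends are exposed to contractions. *)
have -> : F p1 p2 p3 * (G (p1 ⋆ p2) p3 p4 * (F (p1 ⋆ p2 ⋆ (p3 ⋆ p4)) p5 p6 *
     G (p1 ⋆ p2) (p3 ⋆ p4) p5 * G (p1 ⋆ p2) (p3 ⋆ p4 ⋆ p5) p6 * G p3 p4 p5))
  = F (p1 ⋆ (p2 ⋆ p3) ⋆ p4) p5 p6 * (F p1 p2 p3 * (G (p1 ⋆ p2) p3 p4 *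
     G (p1 ⋆ p2) (p3 ⋆ p4) p5 * G p3 p4 p5) * G (p1 ⋆ p2) (p3 ⋆ (p4 ⋆ p5)) p6).
  have n1 : itw (F p1 p2 p3) (ev (p1 ⋆ p2 ⋆ p3 ⋆ p4) (ev p5 p6))
    (ev (p1 ⋆ (p2 ⋆ p3) ⋆ p4) (ev p5 p6)) by exact _.
  have n2 : itw (G (p1 ⋆ p2) p3 p4) (ev (p1 ⋆ p2 ⋆ (p3 ⋆ p4)) (ev p5 p6))
    (ev (p1 ⋆ p2 ⋆ p3 ⋆ p4) (ev p5 p6)) by exact _.
  have n3 : itw (G p3 p4 p5) (ev (p1 ⋆ p2) (ev (p3 ⋆ (p4 ⋆ p5)) p6))
    (ev (p1 ⋆ p2) (ev (p3 ⋆ p4 ⋆ p5) p6)) by exact _.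
  rewrite -!mulrA -n3 !mulrA; congr (_ * _ * _ * _).
by rewrite -mulrA n2 mulrA n1.
rewrite (lkill3 (p' := p1 ⋆ e ⋆ p4) (q' := p5) (r' := p6)) cv_trivr.
rewrite (lkill3 (p' := e) (q' := p5) (r' := p6)) Phi3_triv1 mul1r.
rewrite e2 !mulrA (rkill3V (p' := p1 ⋆ p2) (q' := p3 ⋆ e) (r' := p6)) cv_trivr.
(* The last factor contains neither [p4] nor [p5], so their coevaluation acts across it. *)
rewrite (rkill3VC (p' := p1 ⋆ p2) (q' := p3) (r' := e)) Phi3V_triv3 mulr1.
have n4 : itw (F p1 p2 p3) (ev (p1 ⋆ p2 ⋆ p3) (ev p4 p5))
  (ev (p1 ⋆ (p2 ⋆ p3)) (ev p4 p5)) by exact _.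
rewrite n4 -mulrA (lkill3V (p' := p1 ⋆ e) (q' := p4) (r' := p5)) cv_trivr.
rewrite e3 !mulrA (rkill3 (p' := p1) (q' := p2) (r' := e)) Phi3_triv3 mulr1.
by rewrite (lkill3VC (p' := p1) (q' := e) (r' := p6)) Phi3V_triv2 mulr1.
Qed.

(* As in [kill_zag6], from [((1(23))4)(56)] to [(12)((3(45))6)], with evaluations
   and coevaluations exchanged. *)
Lemma kill_zig6 `{!rkill E (p2 ⋆ p3) e} `{!rkill E (p1 ⋆ p4) e}
    `{!lkill E (p4 ⋆ p5) e} `{!lkill E (p3 ⋆ p6) e} :
  E (F p3 p4 p5 * G (p3 ⋆ p4) p5 p6 * F (p1 ⋆ p2) (p3 ⋆ p4) (p5 ⋆ p6)
     * (F (p1 ⋆ p2) p3 p4 * G p1 p2 p3))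
  = E (F p2 p3 p6 * F p1 p4 p5).
Proof.
have [[_ _ _ _ e1] _] := pentagonV Q (p := p1 ⋆ p2) (q := p3 ⋆ p4) (r := p5) (s := p6).
have e2 := pentagon Q (p := p1 ⋆ p2) (q := p3) (r := p4) (s := p5).
have [_ e3] := pentagonV Q (p := p1) (q := p2) (r := p3) (s := p6).
rewrite -!mulrA (mulrA (G (p3 ⋆ p4) p5 p6)) e1.
(* Again the two reassociators to be contracted first are brought to the two ends. *)
have -> : F p3 p4 p5 * (F (p1 ⋆ p2) (p3 ⋆ p4 ⋆ p5) p6 * F (p1 ⋆ p2) (p3 ⋆ p4) p5
     * G (p1 ⋆ p2 ⋆ (p3 ⋆ p4)) p5 p6 * (F (p1 ⋆ p2) p3 p4 * G p1 p2 p3))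
  = F (p1 ⋆ p2) (p3 ⋆ (p4 ⋆ p5)) p6 * (F p3 p4 p5 * F (p1 ⋆ p2) (p3 ⋆ p4) p5
     * F (p1 ⋆ p2) p3 p4 * G p1 p2 p3) * G (p1 ⋆ (p2 ⋆ p3) ⋆ p4) p5 p6.
  have n1 : itw (F (p1 ⋆ p2) p3 p4) (ev (p1 ⋆ p2 ⋆ p3 ⋆ p4) (ev p5 p6))
    (ev (p1 ⋆ p2 ⋆ (p3 ⋆ p4)) (ev p5 p6)) by exact _.
  have n2 : itw (G p1 p2 p3) (ev (p1 ⋆ (p2 ⋆ p3) ⋆ p4) (ev p5 p6))
    (ev (p1 ⋆ p2 ⋆ p3 ⋆ p4) (ev p5 p6)) by exact _.
  have n3 : itw (F p3 p4 p5) (ev (p1 ⋆ p2) (ev (p3 ⋆ p4 ⋆ p5) p6))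
    (ev (p1 ⋆ p2) (ev (p3 ⋆ (p4 ⋆ p5)) p6)) by exact _.
  rewrite -!mulrA n2 !mulrA n3; congr (_ * _).
  by rewrite -!mulrA n1.
rewrite (rkill3V (p' := p1 ⋆ e ⋆ p4) (q' := p5) (r' := p6)) cv_trivr.
rewrite (rkill3V (p' := e) (q' := p5) (r' := p6)) Phi3V_triv1 mulr1.
rewrite e2 !mulrA -!mulrA (lkill3 (p' := p1 ⋆ p2) (q' := p3 ⋆ e) (r' := p6)) cv_trivr
  !mulrA.
rewrite -(mulrA (_ * _)) (lkill3C (p' := p1 ⋆ p2) (q' := p3) (r' := e)) Phi3_triv3
  mulr1.
have n4 : itw (G p1 p2 p3) (ev (p1 ⋆ (p2 ⋆ p3)) (ev p4 p5))
  (ev (p1 ⋆ p2 ⋆ p3) (ev p4 p5)) by exact _.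
rewrite -n4 !mulrA (rkill3 (p' := p1 ⋆ e) (q' := p4) (r' := p5)) cv_trivr.
rewrite e3 -!mulrA (lkill3V (p' := p1) (q' := p2) (r' := e)) Phi3V_triv3 mul1r.
by rewrite mulrA (rkill3C (p' := p1) (q' := e) (r' := p6)) Phi3_triv2 mulr1.
Qed.

(** Compares the nested evaluations for the products [p4 ⋆ (p5 ⋆ p6)] and [(p4 ⋆ p5) ⋆ p6]: they
    differ by the reassociators of [p4], [p5], [p6] and of [p1], [p2], [p3] once the innermost pair
    is contracted. *)
Lemma kill_assoc6 `{!lkill E (p3 ⋆ p4) e} z :
  E (F p1 p2 p5 * G (p1 ⋆ p2) p5 p6
    * (F (p1 ⋆ p2) p3 p4 * G (p1 ⋆ p2 ⋆ p3) p4 (p5 ⋆ p6))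
     * F p4 p5 p6 * z)
  = E (F p2 p3 p4 * G (p2 ⋆ p3) p4 p5
    * (F p1 (p2 ⋆ p3) (p4 ⋆ p5) * G (p1 ⋆ (p2 ⋆ p3)) (p4 ⋆ p5) p6)
     * F p1 p2 p3 * z).
Proof.
have [[_ e1 _ _ _] _] := pentagonV Q (p := p1 ⋆ p2 ⋆ p3) (q := p4) (r := p5) (s := p6).
have [[_ _ _ _ e2] _] := pentagonV Q (p := p1) (q := p2 ⋆ p3) (r := p4) (s := p5).
have e3 := pentagon Q (p := p1) (q := p2) (r := p3) (s := p4).
have n1 : itw (F (p1 ⋆ p2) p3 p4) (ev (p1 ⋆ p2 ⋆ p3 ⋆ p4) (ev p5 p6))
  (ev (p1 ⋆ p2 ⋆ (p3 ⋆ p4)) (ev p5 p6)) by exact _.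
have n2 : itw (F p1 p2 p3) (ev (p1 ⋆ p2 ⋆ p3) (ev (p4 ⋆ p5) p6))
  (ev (p1 ⋆ (p2 ⋆ p3)) (ev (p4 ⋆ p5) p6)) by exact _.
have n2V : G (p1 ⋆ (p2 ⋆ p3)) (p4 ⋆ p5) p6 * F p1 p2 p3
  = F p1 p2 p3 * G (p1 ⋆ p2 ⋆ p3) (p4 ⋆ p5) p6.
  by rewrite n2.
have n3 : itw (F p1 p2 p3) (ev (p1 ⋆ p2 ⋆ p3) (ev p4 p5))
  (ev (p1 ⋆ (p2 ⋆ p3)) (ev p4 p5)) by exact _.
have n3V : G (p1 ⋆ (p2 ⋆ p3)) p4 p5 * F p1 p2 p3 = F p1 p2 p3 * G (p1 ⋆ p2 ⋆ p3) p4 p5.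
  by rewrite n3.
have n4 : itw (F p2 p3 p4) (ev p1 (ev (p2 ⋆ p3 ⋆ p4) p5))
  (ev p1 (ev (p2 ⋆ (p3 ⋆ p4)) p5)) by exact _.
set y := G (p1 ⋆ p2 ⋆ p3) (p4 ⋆ p5) p6 * z.
(* Common form of both sides. On the left, contraction makes a reassociator ending in [p5], [p6]
   cancel its inverse; on the right, it turns [F p1 (p2 ⋆ (p3 ⋆ p4)) p5] into [F p1 p2 p5] and
   [F p1 p2 (p3 ⋆ p4)] into 1. *)
transitivity (E (F p1 p2 p5 * (F (p1 ⋆ p2) p3 p4 * G (p1 ⋆ p2 ⋆ p3) p4 p5 * y))).
  have -> : F p1 p2 p5 * G (p1 ⋆ p2) p5 p6
    * (F (p1 ⋆ p2) p3 p4 * G (p1 ⋆ p2 ⋆ p3) p4 (p5 ⋆ p6))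
     * F p4 p5 p6 * z
   = F p1 p2 p5 * G (p1 ⋆ p2) p5 p6 * F (p1 ⋆ p2 ⋆ (p3 ⋆ p4)) p5 p6 *
       (F (p1 ⋆ p2) p3 p4 * G (p1 ⋆ p2 ⋆ p3) p4 p5 * y).
    rewrite -!mulrA (mulrA (G _ _ (p5 ⋆ p6))) e1 /y !mulrA; congr (_ * _ * _ * _).
    by rewrite -!mulrA n1.
  rewrite (lkill3C (p' := p1 ⋆ p2 ⋆ e) (q' := p5) (r' := p6)) cv_trivr.
  by rewrite -(mulrA _ (G _ _ _) (F _ _ _)) Phi3VK mulr1.
rewrite -!mulrA (mulrA (G (p2 ⋆ p3) p4 p5)) e2 -!mulrA.
rewrite [in RHS](mulrA _ (F p1 p2 p3) z) n2V -(mulrA (F p1 p2 p3)) -/y.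
rewrite [in RHS](mulrA _ (F p1 p2 p3) y) n3V -(mulrA (F p1 p2 p3)).
rewrite [in RHS](mulrA (F p2 p3 p4)) n4 -mulrA
  (lkill3 (p' := p1) (q' := p2 ⋆ e) (r' := p5)) cv_trivr.
rewrite [in RHS](mulrA (F p1 _ _) (F p1 p2 p3)) (mulrA (F p2 p3 p4)).
rewrite [in RHS](mulrA (F p2 p3 p4)) e3 -!mulrA.
symmetry; rewrite (mulrA (F p1 p2 p5)).
by rewrite (lkill3C (p' := p1) (q' := p2) (r' := e)) Phi3_triv3 mulr1.
Qed.

End Six.
End Contractions.

(** * Uniqueness of duals *)

Section Duals.
Variables (k : fieldType) (H : algType k) (Q : quasi_bialgebra H) (T : algType k).
Implicit Types (phi : H -> T) (sigma : H -> T^c).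

Local Notation "p ⋆ q" := (cv (comul Q) p q) (at level 40, left associativity).

Lemma lkill_tail2 (V W : algType k) (f : V -> T) (E : W -> T) (p q : H -> W)
   `{!lin E} `{!lin f} :
  lkill E (p ⋆ q) (triv Q W) ->
  lkill (ev f E) (iR p ⋆ iR q) (triv Q (tens V W)).
Proof. by move=> pq; rewrite cv_iR -iR_triv; exact: lkill_tail. Qed.

Lemma rkill_tail2 (V W : algType k) (f : V -> T) (E : W -> T) (p q : H -> W)
   `{!lin E} `{!lin f} :
  rkill E (p ⋆ q) (triv Q W) ->
  rkill (ev f E) (iR p ⋆ iR q) (triv Q (tens V W)).
Proof. by move=> pq; rewrite cv_iR -iR_triv; exact: rkill_tail. Qed.

(** Provides the release condition of [lkill_head] when further legs follow; [eA_iL] does the same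
    for [rkill_head]. *)
Lemma eB_iL (Y : Type) (W : algType k) (phi : Y -> T) beta (E : W -> T) `{!lin E} h w :
  ev (eB beta) E (iL phi h * w) = phi h * ev (eB beta) E w.
Proof.
elim/tens_ind: w => [b c|x y IHx IHy].
  by rewrite pureM !ev_pure mul1r /eB !mulrA.
by rewrite !mulrDr !(linED (p := ev _ _)) mulrDr IHx IHy.
Qed.

Lemma eA_iL (Y : Type) (W : algType k) (sigma : Y -> T^c) alpha (E : W -> T) `{!lin E}
    h w :
  ev (eA alpha) E (w * iL sigma h) = unop (sigma h) * ev (eA alpha) E w.
Proof.
elim/tens_ind: w => [b c|x y IHx IHy].
  by rewrite pureM !ev_pure mulr1 /eA unopM !mulrA.
by rewrite !mulrDl !(linED (p := ev _ _)) mulrDr IHx IHy.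
Qed.

Lemma E3_iRR sigma alpha beta h Z :
  ev (eA alpha) (ev (eB beta) (@eU _ T)) (iR (iR sigma) h * Z)
  = ev (eA alpha) (ev (eB beta) (@eU _ T)) Z * unop (sigma h).
Proof.
elim/tens_ind: Z => [a w|x y IHx IHy]; last first.
  by rewrite !mulrDr !(linED (p := ev _ _)) mulrDl IHx IHy.
elim/tens_ind: w => [b c|x y IHx IHy]; last first.
  by rewrite !(pureDr, mulrDr) !(linED (p := ev _ _)) mulrDl IHx IHy.
by rewrite !pureM !ev_pure !mul1r /eU unopM !mulrA.
Qed.

Section Kills.
Variables (phi : H -> T) (sigma : H -> T^c) (alpha beta alpha' beta' : T).

(** In these names the digit counts the legs and a prime says that the first leg lies in [T]; for
    three legs, [r] marks a coevaluation contracted on the right. *)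
Lemma kill2 : evalP Q phi sigma alpha ->
  lkill (ev (eA alpha) idfun) (iL sigma ⋆ iR phi) (triv Q _).
Proof. exact: lkill_head. Qed.

Lemma kill2' : coevP Q phi sigma beta ->
  rkill (ev (eB beta) (@eU _ T)) (iL phi ⋆ iR sigma) (triv Q _).
Proof. exact: rkill_head. Qed.

Lemma kill3 : evalP Q phi sigma alpha ->
  lkill (ev (eA alpha) (ev (eB beta') (@eU _ T))) (iL sigma ⋆ iR (iL phi)) (triv Q _).
Proof. by apply: lkill_head; exact: eB_iL. Qed.

Lemma kill3r : coevP Q phi sigma beta ->
  rkill (ev (eA alpha') (ev (eB beta) (@eU _ T))) (iR (iL phi) ⋆ iR (iR sigma))
    (triv Q _).
Proof. by move=> c; apply: rkill_tail2; exact: kill2'. Qed.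

Lemma kill3' : evalP Q phi sigma alpha ->
  lkill (ev (eB beta') (ev (eA alpha) idfun)) (iR (iL sigma) ⋆ iR (iR phi)) (triv Q _).
Proof. by move=> c; apply: lkill_tail2; exact: kill2. Qed.

Lemma kill3r' : coevP Q phi sigma beta ->
  rkill (ev (eB beta) (ev (eA alpha') idfun)) (iL phi ⋆ iR (iL sigma)) (triv Q _).
Proof. by apply: rkill_head; exact: eA_iL. Qed.

End Kills.

Record dual phi sigma (alpha beta : T) : Prop := Dual {
  dual_ev : evalP Q phi sigma alpha;
  dual_coev : coevP Q phi sigma beta;
  dual_zig : ev (eB beta \o phi) (ev (eA alpha \o sigma) phi) (Phi Q) = 1;
  dual_zag : ev (eA alpha \o sigma) (ev (eB beta \o phi) (@eU _ T \o sigma))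
    (PhiV Q) = 1
}.

(** The canonical comparison from the dual [sigma'] to the dual [sigma'']: the coevaluation of the
    first followed by the evaluation of the second. For equal duals it is the zigzag of
    [dual_zag]. *)
Definition transport sigma'' (alpha'' : T) phi (beta' : T) sigma' : T :=
  ev (eA alpha'' \o sigma'') (ev (eB beta' \o phi) (@eU _ T \o sigma')) (PhiV Q).

(** Expand 1 by [dual_zag]: moving [w] inwards turns [sigma'] into [sigma''], and on reaching
    [alpha'] it becomes [alpha'']. *)
Lemma transport_uniq sigma'' alpha'' phi alpha' beta' sigma' w :
  dual phi sigma' alpha' beta' ->
  (forall h, w * unop (sigma' h) = unop (sigma'' h) * w) -> w * alpha' = alpha'' ->
  w = transport sigma'' alpha'' phi beta' sigma'.
Proof.
move=> d ws wa; rewrite -[LHS]mulr1 -(dual_zag d) /transport /ev tsum_mull.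
by apply: eq_tsum => x y; rewrite /= /eA !mulrA ws -(mulrA _ w) wa.
Qed.

Section Transport.
Variables (phi : H -> T) (sigma' sigma'' : H -> T^c) (alpha' alpha'' beta' : T).
Context `{!mor phi} `{!mor sigma'} `{!mor sigma''}.
Hypothesis d' : dual phi sigma' alpha' beta'.
Hypothesis d'' : evalP Q phi sigma'' alpha''.
Let u := transport sigma'' alpha'' phi beta' sigma'.

Lemma transport_itw h : u * unop (sigma' h) = unop (sigma'' h) * u.
Proof.
have -> : u = ev (eA alpha'') (ev (eB beta') (@eU _ T))
  (Phi3V Q (iL sigma'') (iR (iL phi)) (iR (iR sigma'))).
  rewrite /Phi3V ev_iR ev_iLR; apply: eq_ev => // t /=.
  by rewrite ev_iLR.
have := @kill_itw _ _ Q _ _ (ev (eA alpha'') (ev (eB beta') (@eU _ T))) _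
  (iL sigma'') (iR (iL phi)) (iR (iR sigma')) _ _ _ _ _ _
  (kill3 _ d'') (kill3r _ (dual_coev d')) h.
by rewrite eA_iL E3_iRR => ->.
Qed.

(** Apply [kill_zig] to the letters [sigma''], [phi], [sigma'], [phi]: the zigzag moves to the last
    three letters, where it is [dual_zig] of the first dual, and [alpha''] remains. *)
Lemma transport_alpha : u * alpha' = alpha''.
Proof.
transitivity (ev (eA alpha'') (ev (eB beta') (ev (eA alpha') idfun))
  (Phi3V Q (iL sigma'') (iR (iL phi)) (iR (iR (iL sigma'))))).
  rewrite /Phi3V !ev_iR ev_iLR /u /transport /ev tsum_mulr.
  apply: eq_tsum => x y /=; rewrite -mulrA; congr (_ * _).
  rewrite -/(ev _ _ _) -[tsum _ _ in RHS]/(ev _ _ _) ev_iLR /ev tsum_mulr.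
  apply: eq_tsum => {}x {}y /=.
  by rewrite -/(ev _ _ _) ev_pure mulr1 /eA mulrA.
have l12 : lkill (ev (eA alpha'') (ev (eB beta') (ev (eA alpha') idfun)))
    (iL sigma'' ⋆ iR (iL phi)) (triv Q _).
  by apply: lkill_head d''; exact: eB_iL.
have l34 : lkill (ev (eA alpha'') (ev (eB beta') (ev (eA alpha') idfun)))
    (iR (iR (iL sigma')) ⋆ iR (iR (iR phi))) (triv Q _).
  by do 2!apply: lkill_tail2; exact: kill2 (dual_ev d').
have r23 : rkill (ev (eA alpha'') (ev (eB beta') (ev (eA alpha') idfun)))
    (iR (iL phi) ⋆ iR (iR (iL sigma'))) (triv Q _).
  by apply: rkill_tail2; exact: kill3r' (dual_coev d').
have -> // := @kill_zig _ _ Q _ _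
  (ev (eA alpha'') (ev (eB beta') (ev (eA alpha') idfun))) _
  (iL sigma'') (iR (iL phi)) (iR (iR (iL sigma')))
    (iR (iR (iR phi))) _ _ _ _ _ _ _ _ _ _ l12 l34 r23.
rewrite /Phi3 !ev_iR ev_pure ev_iLR /=.
rewrite (eq_ev (p' := eB beta' \o phi) (q' := ev (eA alpha' \o sigma') phi)) //.
  by rewrite (dual_zig d') mulr1 /eA mul1r.
by move=> t /=; rewrite ev_iLR.
Qed.

End Transport.

(** Each composite intertwines a dual with itself and fixes its alpha, as 1 does; uniqueness
    identifies the two. *)
Lemma transport_inv phi sigma' sigma'' alpha' alpha'' beta' beta''
    `{!mor phi} `{!mor sigma'} `{!mor sigma''} :
  dual phi sigma' alpha' beta' -> dual phi sigma'' alpha'' beta'' ->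
  inverse_of (transport sigma'' alpha'' phi beta' sigma')
             (transport sigma' alpha' phi beta'' sigma'').
Proof.
move=> d' d''.
have tid sigma alpha beta : dual phi sigma alpha beta ->
    1 = transport sigma alpha phi beta sigma.
  by move=> d; apply: (transport_uniq d) => [h|]; rewrite ?mulr1 mul1r.
split.
  rewrite (tid _ _ _ d''); apply: (transport_uniq d'') => [h|].
    rewrite -mulrA (transport_itw d'' (dual_ev d')) mulrA.
    by rewrite (transport_itw d' (dual_ev d'')) mulrA.
  rewrite -mulrA (transport_alpha d'' (dual_ev d')).
  exact: (transport_alpha d' (dual_ev d'')).
rewrite (tid _ _ _ d'); apply: (transport_uniq d') => [h|].
  rewrite -mulrA (transport_itw d' (dual_ev d'')) mulrA.
  by rewrite (transport_itw d'' (dual_ev d')) mulrA.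
rewrite -mulrA (transport_alpha d' (dual_ev d'')).
exact: (transport_alpha d'' (dual_ev d')).
Qed.

End Duals.

(** * Splitting a contraction around its inner part *)

Definition jL {k : fieldType} {V W Z : algType k} : V ⊗ W -> V ⊗ (W ⊗ Z) :=
  ev (iL idfun) (iR (iL idfun)).

Section Legs.
Variables (k : fieldType) (T : algType k) (alpha beta : T).

Global Instance mor_jL (V W Z : algType k) : mor (@jL k V W Z).
Proof. by rewrite /jL; exact _. Qed.

Lemma jL_pure (V W Z : algType k) v w : @jL k V W Z (v ⊗ w) = v ⊗ (w ⊗ 1).
Proof. by rewrite /jL ev_pure pureM mulr1 mul1r. Qed.

Lemma jL_iL (X : Type) (V W Z : algType k) (p : X -> V) : @jL k V W Z \o iL p = iL p.
Proof. by apply: funext => x /=; rewrite jL_pure. Qed.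

Lemma jL_iR (X : Type) (V W Z : algType k) (p : X -> W) : @jL k V W Z \o iR p
    = iR (iL p).
Proof. by apply: funext => x /=; rewrite jL_pure. Qed.

Lemma legA_l (W : algType k) (E : W -> T) t a w `{!lin E} :
  ev (eA alpha) (ev (eB beta) E) (jL t * (a ⊗ w))
  = unop a * ev (eA alpha) idfun t * ev (eB beta) E w.
Proof.
elim/tens_ind: t => [x y|x y IHx IHy].
  by rewrite jL_pure pureM !ev_pure (eB_iL idfun) /eA unopM !mulrA.
rewrite (linED (p := @jL _ _ _ _)) mulrDl !(linED (p := ev _ _)) IHx IHy.
by rewrite mulrDr mulrDl.
Qed.

Lemma legA t a w :
  ev (eA alpha) idfun (t * (a ⊗ w)) = unop a * ev (eA alpha) idfun t * w.
Proof.
elim/tens_ind: t => [x y|x y IHx IHy].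
  by rewrite pureM !ev_pure /eA unopM /= !mulrA.
by rewrite mulrDl !(linED (p := ev _ _)) IHx IHy mulrDr mulrDl.
Qed.

Lemma legB t a w :
  ev (eB beta) (@eU _ T) ((a ⊗ w) * t) = a * ev (eB beta) (@eU _ T) t * unop w.
Proof.
elim/tens_ind: t => [x y|x y IHx IHy].
  by rewrite pureM !ev_pure /eB /eU unopM !mulrA.
by rewrite mulrDr !(linED (p := ev _ _)) IHx IHy mulrDr mulrDl.
Qed.

Lemma legB_l (W : algType k) (E : W -> T) t a w `{!lin E} :
  ev (eB beta) (ev (eA alpha) E) ((a ⊗ w) * jL t)
  = a * ev (eB beta) (@eU _ T) t * ev (eA alpha) E w.
Proof.
elim/tens_ind: t => [x y|x y IHx IHy].
  by rewrite jL_pure pureM !ev_pure (eA_iL idfun) /eB /eU !mulrA.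
rewrite (linED (p := @jL _ _ _ _)) mulrDr !(linED (p := ev _ _)) IHx IHy.
by rewrite mulrDr mulrDl.
Qed.

End Legs.

Lemma cv_iL (k : fieldType) (C X Y V W : algType k) (c : C -> X ⊗ Y) (p : X -> V)
    (q : Y -> V) :
  cv c (iL (W := W) p) (iL q) = iL (cv c p q).
Proof. by rewrite /cv ev_iL. Qed.

Section PushPhi.
Variables (k : fieldType) (H : algType k) (Q : quasi_bialgebra H) (T T' : algType k).
Variable g : T -> T'.
Context `{!mor g}.

Lemma mor_cv_push (C V W : algType k) (c : C -> V ⊗ W) (p : V -> T) (q : W -> T) :
  g \o cv c p q = cv c (g \o p) (g \o q).
Proof. by apply: funext => x /=; rewrite /cv mor_ev_push. Qed.

Lemma mor_ev3 (V W Z : algType k) (p : V -> T) (q : W -> T) (r : Z -> T) t :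
  g (ev p (ev q r) t) = ev (g \o p) (ev (g \o q) (g \o r)) t.
Proof. by rewrite mor_ev_push; apply: eq_ev => // x /=; rewrite mor_ev_push. Qed.

Lemma mor_Phi3 p q r : g (Phi3 Q p q r) = Phi3 Q (g \o p) (g \o q) (g \o r).
Proof. exact: mor_ev3. Qed.
Lemma mor_Phi3V p q r : g (Phi3V Q p q r) = Phi3V Q (g \o p) (g \o q) (g \o r).
Proof. exact: mor_ev3. Qed.
End PushPhi.

Lemma opK (k : fieldType) (T : algType k) (x : T) : unop (op x) = x.
Proof. by []. Qed.

Lemma ev3_pure (k : fieldType) (X Y Z U V W : algType k) (s : X -> U) (t : Y -> V)
    (r : Z -> W) (x : X ⊗ Y ⊗ Z) :
  ev (iL s) (ev (iR (iL t)) (iR (iR r))) x = \tsum_(a, b, c <- x) s a ⊗ (t b ⊗ r c).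
Proof.
apply: eq_tsum => a y; rewrite tsum_mull; apply: eq_tsum => b c.
by rewrite !pureM !mul1r !mulr1.
Qed.

(** * The Drinfeld twist *)

Section TensorDual.
Variables (k : fieldType) (H : algType k) (Q : quasi_hopf_algebra H) (T : algType k).

Local Notation "p ⋆ q" := (cv (comul Q) p q) (at level 40, left associativity).
Local Notation F := (Phi3 Q).
Local Notation G := (Phi3V Q).

Definition anti (p : H -> T) : H -> T^c := fun h => op (p (antipode Q h)).

Global Instance mor_anti p `{!mor p} : mor (anti p).
Proof.
split=> [a x y||x y]; rewrite /anti.
- by rewrite linearP (mor_lin a).
- by rewrite antipode1 mor1.
- by rewrite antipodeM morM opM.
Qed.

Global Instance comm_anti p q `{!comm p q} : comm (anti p) (anti q).
Proof. by move=> x y; rewrite /anti -!opM commP. Qed.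

Lemma dual_point p `{!mor p} : dual Q p (anti p) (p (alpha Q)) (p (beta Q)).
Proof.
split.
- move=> h; rewrite -linEZ -antipode_alpha (linE_tsum (g := p)).
  by apply: eq_tsum => x y; rewrite !morM.
- move=> h; rewrite -linEZ -antipode_beta (linE_tsum (g := p)).
  by apply: eq_tsum => x y; rewrite !morM.
- rewrite -(mor1 (p := p)) -(antipode_Phi Q) (linE_tsum (g := p)).
  apply: eq_tsum => x y; rewrite (linE_tsum (g := p)) /= /ev tsum_mull.
  by apply: eq_tsum => u v; rewrite !morM /= /eA /eB !mulrA.
- rewrite -(mor1 (p := p)) -(antipode_PhiV Q) (linE_tsum (g := p)).
  apply: eq_tsum => x y; rewrite (linE_tsum (g := p)) /= /ev tsum_mull.
  by apply: eq_tsum => u v; rewrite !morM /= /eA /eB !mulrA.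
Qed.

Section Two.
Variables p q : H -> T.
Context `{!mor p} `{!mor q} `{!comm p q}.

Let pq a b : p a * q b = q b * p a. Proof. exact: commP. Qed.
Let pqA x a b : x * p a * q b = x * q b * p a.
Proof. by rewrite -!mulrA pq. Qed.

(* The values of [A^1 ⊗ ... ⊗ A^4], and of its analogue for [delta], with the legs
   ordered so that contraction gives [S(A^2) alpha A^3 ⊗ S(A^1) alpha A^4]. *)
Definition gamma_legs : T^c ⊗ T :=
  F (iL (anti q)) (iL (anti p)) (iR p) * G (iL (anti q) ⋆ iL (anti p)) (iR p) (iR q).
Definition delta_legs : T ⊗ T^c :=
  F (iL p ⋆ iL q) (iR (anti q)) (iR (anti p)) * G (iL p) (iL q) (iR (anti q)).

Definition gamma2 : T := ev (eA (p (alpha Q) * q (alpha Q))) idfun gamma_legs.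
Definition delta2 : T := ev (eB (p (beta Q) * q (beta Q))) (@eU _ T) delta_legs.

(** The letters of [p] and [q] share their legs, so the product of both alphas must serve each of
    them; the foreign alpha commutes past. The next three lemmas rest on the same remark. *)
Lemma evalP_l : evalP Q p (anti p) (p (alpha Q) * q (alpha Q)).
Proof.
move=> h; rewrite scalerAl -(dual_ev (dual_point (p := p))) /ev tsum_mulr.
by apply: eq_tsum => x y; rewrite !mulrA -pqA.
Qed.

Lemma evalP_r : evalP Q q (anti q) (p (alpha Q) * q (alpha Q)).
Proof.
move=> h; rewrite scalerAr -(dual_ev (dual_point (p := q))) /ev tsum_mull.
by apply: eq_tsum => x y; rewrite !mulrA /anti /= -pq.
Qed.

Lemma coevP_l : coevP Q p (anti p) (p (beta Q) * q (beta Q)).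
Proof.
move=> h; rewrite scalerAl -(dual_coev (dual_point (p := p))) /ev tsum_mulr.
by apply: eq_tsum => x y; rewrite !mulrA -pqA.
Qed.

Lemma coevP_r : coevP Q q (anti q) (p (beta Q) * q (beta Q)).
Proof.
move=> h; rewrite scalerAr -(dual_coev (dual_point (p := q))) /ev tsum_mull.
by apply: eq_tsum => x y; rewrite !mulrA /anti /= -pq.
Qed.

Lemma tensor_evalP : evalP Q (p ⋆ q) (anti q ⋆ anti p) gamma2.
Proof.
move=> h.
have <- // := @kill_gamma _ _ Q _ _ (ev (eA (p (alpha Q) * q (alpha Q))) idfun) _
  (iL (anti q)) (iL (anti p)) (iR p) (iR q) _ _ _ _ _ _ _ _ _ _
  (kill2 evalP_r) (kill2 evalP_l) h.
rewrite -/gamma_legs cv_iL cv_iR [cv _ (iL _) (iR _) _]/cv [ev (iL _) _ _]/ev tsum_mull.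
rewrite (linE_tsum (g := ev _ _)); apply: eq_tsum => x y.
by rewrite pureM mul1r mulr1 legA.
Qed.

Lemma tensor_coevP : coevP Q (p ⋆ q) (anti q ⋆ anti p) delta2.
Proof.
move=> h.
have <- // := @kill_delta _ _ Q _ _ (ev (eB (p (beta Q) * q (beta Q))) (@eU _ T)) _
  (iL p) (iL q) (iR (anti q)) (iR (anti p)) _ _ _ _ _ _ _ _ _ _
  (kill2' coevP_l) (kill2' coevP_r) h.
rewrite -/delta_legs cv_iL cv_iR [cv _ (iL _) (iR _) _]/cv [ev (iL _) _ _]/ev tsum_mulr.
rewrite (linE_tsum (g := ev _ _)); apply: eq_tsum => x y.
by rewrite pureM mul1r mulr1 legB.
Qed.

Lemma tensor_zag :
  ev (eA gamma2 \o (anti q ⋆ anti p))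
     (ev (eB delta2 \o (p ⋆ q)) (@eU _ T \o (anti q ⋆ anti p))) (PhiV Q) = 1.
Proof.
set a := p (alpha Q) * q (alpha Q); set b := p (beta Q) * q (beta Q).
have := @kill_zag6 _ _ Q _ _ (ev (eA a) (ev (eB b) (@eU _ T))) _
  (iL (anti q)) (iL (anti p)) (iR (iL p)) (iR (iL q)) (iR (iR (anti q)))
    (iR (iR (anti p)))
  _ _ _ _ _ _ _ _ _ _ _ _ _ _ _ _ _ _ _ _ _
  (kill3 _ evalP_l) (kill3 _ evalP_r) (kill3r _ coevP_r) (kill3r _ coevP_l).
have -> : F (iL (anti q)) (iL (anti p)) (iR (iL p))
    * G (iL (anti q) ⋆ iL (anti p)) (iR (iL p)) (iR (iL q))
      = jL gamma_legs :> T^c ⊗ (T ⊗ T^c).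
  by rewrite /gamma_legs morM mor_Phi3 mor_Phi3V mor_cv_push !jL_iL !jL_iR.
have -> : F (iR (iL p) ⋆ iR (iL q)) (iR (iR (anti q))) (iR (iR (anti p)))
    * G (iR (iL p)) (iR (iL q)) (iR (iR (anti q)))
      = iR idfun delta_legs :> T^c ⊗ (T ⊗ T^c).
  by rewrite /delta_legs morM mor_Phi3 mor_Phi3V mor_cv_push.
rewrite !cv_iR !cv_iL /Phi3V !ev3_pure => e.
apply: etrans (etrans (e _ _ _ _ _ _ _ _ _ _ _ _ _ _ _ _ _ _ _ _ _ _) _) => //.
  rewrite tsum_mull tsum_mulr (linE_tsum (g := ev _ _)); apply: eq_tsum => x y.
  rewrite tsum_mull tsum_mull tsum_mulr (linE_tsum (g := ev _ _)).
  apply: eq_tsum => u v; rewrite -mulrA pureM mulr1 legA_l legB.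
  by rewrite /eA /eB /eU /= !mulrA.
(* The contraction leaves one reassociator in the letters of [q] and one in those of [p]: these are
   the zigzags of the two single duals, each equal to 1. *)
rewrite -[RHS]mulr1 -{1}(dual_zag (dual_point (p := q)))
  -(dual_zag (dual_point (p := p))).
set P := (X in _ = _ * X); set S := (X in ev _ _ (_ * X)).
rewrite tsum_mulr. rewrite (linE_tsum (g := ev _ _)) [X in _ = X * _]/ev.
  rewrite tsum_mulr.
apply: eq_tsum => x y; rewrite tsum_mulr (linE_tsum (g := ev _ _)) [ev _ _ y]/ev.
rewrite tsum_mull tsum_mulr; apply: eq_tsum => u v.
rewrite /S /P tsum_mull (linE_tsum (g := ev _ _)) [ev _ _ (PhiV Q)]/ev tsum_mull.
apply: eq_tsum => x' y'; rewrite tsum_mull (linE_tsum (g := ev _ _)) [ev _ _ y']/ev.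
rewrite !tsum_mull; apply: eq_tsum => u' v'.
rewrite !pureM !ev_pure /= /eA /eB /eU !unopM /= /anti /a /b.
by rewrite !mulrA !opK !(pqA, pq).
Qed.

Lemma tensor_zig :
  ev (eB delta2 \o (p ⋆ q)) (ev (eA gamma2 \o (anti q ⋆ anti p)) (p ⋆ q)) (Phi Q) = 1.
Proof.
set a := p (alpha Q) * q (alpha Q); set b := p (beta Q) * q (beta Q).
have := @kill_zig6 _ _ Q _ _ (ev (eB b) (ev (eA a) idfun)) _
  (iL p) (iL q) (iR (iL (anti q))) (iR (iL (anti p))) (iR (iR p)) (iR (iR q))
  _ _ _ _ _ _ _ _ _ _ _ _ _ _ _ _ _ _ _ _ _
  (kill3r' _ coevP_r) (kill3r' _ coevP_l) (kill3' _ evalP_l) (kill3' _ evalP_r).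
have -> : F (iL p ⋆ iL q) (iR (iL (anti q))) (iR (iL (anti p)))
    * G (iL p) (iL q) (iR (iL (anti q))) = jL delta_legs :> T ⊗ (T^c ⊗ T).
  by rewrite /delta_legs morM mor_Phi3 mor_Phi3V mor_cv_push !jL_iL !jL_iR.
have -> : F (iR (iL (anti q))) (iR (iL (anti p))) (iR (iR p))
    * G (iR (iL (anti q)) ⋆ iR (iL (anti p))) (iR (iR p)) (iR (iR q))
    = iR idfun gamma_legs :> T ⊗ (T^c ⊗ T).
  by rewrite /gamma_legs morM mor_Phi3 mor_Phi3V mor_cv_push.
rewrite !cv_iR !cv_iL /Phi3 !ev3_pure => e.
apply: etrans (etrans (e _ _ _ _ _ _ _ _ _ _ _ _ _ _ _ _ _ _ _ _ _ _) _) => //.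
  rewrite (tsum_mull _ _ (iR idfun gamma_legs)) (tsum_mulr _ _ (jL delta_legs))
    (linE_tsum (g := ev _ _)); apply: eq_tsum => x y.
  rewrite tsum_mull (tsum_mull _ _ (iR idfun gamma_legs))
    (tsum_mulr _ _ (jL delta_legs)) (linE_tsum (g := ev _ _)).
  apply: eq_tsum => u v; rewrite pureM mul1r legB_l legA.
  by rewrite /eA /eB /eU /= !mulrA.
(* As before, the zigzags of [q] and of [p] remain, here in the form [dual_zig]. *)
rewrite -[RHS]mulr1 -{1}(dual_zig (dual_point (p := q)))
  -(dual_zig (dual_point (p := p))).
set P := (X in _ = _ * X); set S := (X in ev _ _ (_ * X)).
rewrite tsum_mulr (linE_tsum (g := ev _ _)) [X in _ = X * _]/ev tsum_mulr.
apply: eq_tsum => x y; rewrite tsum_mulr (linE_tsum (g := ev _ _)) [ev _ _ y]/ev.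
rewrite tsum_mull tsum_mulr; apply: eq_tsum => u v.
rewrite /S /P tsum_mull (linE_tsum (g := ev _ _)) [ev _ _ (Phi Q)]/ev tsum_mull.
apply: eq_tsum => x' y'; rewrite tsum_mull (linE_tsum (g := ev _ _)) [ev _ _ y']/ev.
rewrite !tsum_mull; apply: eq_tsum => u' v'.
rewrite !pureM !ev_pure /= /eA /eB !unopM /= /anti /a /b.
by rewrite !mulrA !opK !(pqA, pq).
Qed.

Lemma tensor_dual : dual Q (p ⋆ q) (anti q ⋆ anti p) gamma2 delta2.
Proof.
by split; [exact: tensor_evalP | exact: tensor_coevP | exact: tensor_zig |
  exact: tensor_zag].
Qed.

End Two.
End TensorDual.

Lemma evE (k : fieldType) (V W T : algType k) (p : V -> T) (q : W -> T) t :
  ev p q t = @tsum k V W T t (fun v w => p v * q w).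
Proof. by []. Qed.

(** * The Drinfeld twist as a comparison of duals *)

Section Twist.
Variables (k : fieldType) (H : algType k) (Q : quasi_hopf_algebra H).

Local Notation "p ⋆ q" := (cv (comul Q) p q) (at level 40, left associativity).
Local Notation F := (Phi3 Q).
Local Notation G := (Phi3V Q).
Local Notation gA := (tassoc3 (Phi Q ⊗ 1) * tmapl (comul Q) (PhiV Q)).

Global Instance lin_antipode : lin (antipode Q).
Proof. exact: linearP. Qed.

Global Instance lin_compo (U V W : lmodType k) (g : V -> W) (f : U -> V) `{!lin g}
    `{!lin f} :
  lin (g \o f).
Proof. by move=> a x y /=; rewrite (lin_of a) (lin_of a). Qed.

Section OneAlgebra.
Variable T : algType k.
Implicit Types p q r : H -> T.
Local Notation anti := (anti Q).

Lemma ev_gA (U : algType k) (s1 s2 s3 s4 : H -> U) `{!mor s1} `{!mor s2} `{!mor s3}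
    `{!mor s4} `{!comm s1 s2} `{!comm s1 s3} `{!comm s1 s4} `{!comm s2 s3}
    `{!comm s2 s4} `{!comm s3 s4} :
  ev s1 (ev s2 (ev s3 s4)) gA = F s1 s2 s3 * G (s1 ⋆ s2) s3 s4.
Proof. by rewrite morM ev_tassoc3 ev_tmapl. Qed.

Lemma gamE p q `{!mor p} `{!mor q} `{!comm p q} :
  gamma_legs Q p q = ev (iL (anti q)) (ev (iL (anti p)) (ev (iR p) (iR q))) gA.
Proof. by rewrite ev_gA. Qed.

Lemma ev4_pure (s1 s2 : H -> T^c) (t1 t2 : H -> T) (x : H ⊗ H ⊗ H ⊗ H) :
  ev (iL s1) (ev (iL s2) (ev (iR t1) (iR t2))) x
  = \tsum_(a, b, c, d <- x) (s1 a * s2 b) ⊗ (t1 c * t2 d).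
Proof.
apply: eq_tsum => a y; rewrite (evE (iL s2)) tsum_mull; apply: eq_tsum => b z.
rewrite mulrA pureM mulr1 (evE (iR t1)) tsum_mull; apply: eq_tsum => c d.
by rewrite !pureM !mulr1 !mul1r.
Qed.

Lemma legA4 (alpha : T) (s1 s2 : H -> T^c) (t1 t2 : H -> T) t (x : H ⊗ H ⊗ H ⊗ H) :
  ev (eA alpha) idfun (t * ev (iL s1) (ev (iL s2) (ev (iR t1) (iR t2))) x)
  = \tsum_(a, b, c, d <- x) unop (s1 a * s2 b) * ev (eA alpha) idfun t * (t1 c * t2 d).
Proof.
rewrite ev4_pure -/(preE _ t _) (linE_tsum (g := preE _ t)); apply: eq_tsum => a y.
rewrite (linE_tsum (g := preE _ t)); apply: eq_tsum => b z.
rewrite (linE_tsum (g := preE _ t)); apply: eq_tsum => c d.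
by rewrite /preE legA.
Qed.

Lemma gamma2E p q `{!mor p} `{!mor q} `{!comm p q} :
  gamma2 Q p q = \tsum_(a, b, c, d <- gA)
    p (antipode Q b) * q (antipode Q a) * (p (alpha Q) * q (alpha Q)) * (p c * q d).
Proof.
rewrite /gamma2 gamE -[X in ev _ _ X]mul1r legA4; apply: eq_tsum => a y.
apply: eq_tsum => b z; apply: eq_tsum => c d.
by rewrite ev_pure unopM /eA /= mul1r mulr1.
Qed.

Definition tw p q : T := transport Q (anti q ⋆ anti p) (gamma2 Q p q) (p ⋆ q)
  ((p ⋆ q) (beta Q)) (anti (p ⋆ q)).
Definition twV p q : T := transport Q (anti (p ⋆ q)) ((p ⋆ q) (alpha Q)) (p ⋆ q)
  (delta2 Q p q) (anti q ⋆ anti p).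

Lemma tw_inv p q `{!mor p} `{!mor q} `{!comm p q} : inverse_of (tw p q) (twV p q).
Proof. by apply: transport_inv; [exact: dual_point | exact: tensor_dual]. Qed.

Lemma tw_anti p q `{!mor p} `{!mor q} `{!comm p q} h :
  tw p q * (p ⋆ q) (antipode Q h) = unop ((anti q ⋆ anti p) h) * tw p q.
Proof. by apply: transport_itw; [exact: dual_point | exact: tensor_evalP]. Qed.

Lemma tw_alpha p q `{!mor p} `{!mor q} `{!comm p q} :
  tw p q * (p ⋆ q) (alpha Q) = gamma2 Q p q.
Proof. by apply: transport_alpha; [exact: dual_point | exact: tensor_evalP]. Qed.

Lemma ev_drinfeld_gamma p q `{!mor p} `{!mor q} `{!comm p q} :
  ev p q (drinfeld_gamma Q) = gamma2 Q p q.
Proof.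
have pq a b : p a * q b = q b * p a by exact: commP.
have pqA x a b : x * p a * q b = x * q b * p a by rewrite -!mulrA pq.
rewrite gamma2E /drinfeld_gamma (linE_tsum (g := ev _ _)); apply: eq_tsum => a y.
rewrite (linE_tsum (g := ev _ _)); apply: eq_tsum => b z.
rewrite (linE_tsum (g := ev _ _)); apply: eq_tsum => c d.
by rewrite ev_pure !morM !mulrA !(pqA, pq).
Qed.

Lemma ev_tflip (V W : algType k) (p : V -> T) (q : W -> T) t `{!lin p} `{!lin q} :
  ev p q (tflip t) = \tsum_(x, y <- t) p y * q x.
Proof.
rewrite /tflip (linE_tsum (g := ev _ _)); apply: eq_tsum => x y.
by rewrite ev_pure.
Qed.

Lemma unop_anti p q h :
  unop ((anti q ⋆ anti p) h) =
  \tsum_(x, y <- comul Q h) p (antipode Q y) * q (antipode Q x).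
Proof.
rewrite -[LHS]/(eU (ev _ _ _)) evE (linE_tsum (g := @eU _ T)); apply: eq_tsum => x y.
by rewrite /eU unopM.
Qed.

(** The two formulas agree term by term over the components of [PhiV], so the explicit twist
    inherits everything that uniqueness of duals gives for [tw]. *)
Lemma ev_drinfeld_twist p q `{!mor p} `{!mor q} `{!comm p q} :
  ev p q (drinfeld_twist Q) = tw p q.
Proof.
rewrite /drinfeld_twist (linE_tsum (g := ev _ _)); apply: eq_tsum => a y.
rewrite (linE_tsum (g := ev _ _)) (evE (eB _ \o _)) tsum_mull; apply: eq_tsum => b c.
rewrite !(morM (p := ev p q)) ev_drinfeld_gamma ev_tmap.
rewrite -[ev p q (comul Q _)]/((p ⋆ q) _) !(morM (p := p ⋆ q)) ev_tflip.
by rewrite /= /eA /eB /eU unop_anti /anti opK !mulrA.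
Qed.

Global Instance itw_tw_commute (Z : Type) p q (r : Z -> T) `{!mor p} `{!mor q}
    `{!comm p q} `{!comm p r} `{!comm q r} : itw (tw p q) r r.
Proof. by rewrite -ev_drinfeld_twist; exact: itw_comm. Qed.

(** The value of $S(X^3) ⊗ S(X^2) ⊗ S(X^1)$ at [p], [q], [r]. *)
Definition Santi p q r : T := unop (F (anti r) (anti q) (anti p)).

Section Pentagon.
Variables p q r : H -> T.
Context `{!mor p} `{!mor q} `{!mor r} `{!comm p q} `{!comm p r} `{!comm q r}.

Let qp a b : q a * p b = p b * q a. Proof. exact: commP. Qed.
Let rp a b : r a * p b = p b * r a. Proof. exact: commP. Qed.
Let rq a b : r a * q b = q b * r a. Proof. exact: commP. Qed.
Let qpA x a b : x * q a * p b = x * p b * q a. Proof. by rewrite -!mulrA qp. Qed.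
Let rpA x a b : x * r a * p b = x * p b * r a. Proof. by rewrite -!mulrA rp. Qed.
Let rqA x a b : x * r a * q b = x * q b * r a. Proof. by rewrite -!mulrA rq. Qed.

Let a3 := p (alpha Q) * (q (alpha Q) * r (alpha Q)).

Let Egam_qr : ev (eA a3) idfun (gamma_legs Q q r) = p (alpha Q) * gamma2 Q q r.
Proof.
rewrite gamma2E gamE -[X in ev (eA _) _ X]mul1r legA4 (tsum_mull _ _ (p (alpha Q)));
apply: eq_tsum => a y.
rewrite (tsum_mull _ _ (p (alpha Q))); apply: eq_tsum => b z;
rewrite (tsum_mull _ _ (p (alpha Q))); apply: eq_tsum => c d.
by rewrite ev_pure unopM /eA /= /a3 !mul1r mulr1 !mulrA !(qpA, rpA, qp, rp).
Qed.

Let Egam_pq : ev (eA a3) idfun (gamma_legs Q p q) = gamma2 Q p q * r (alpha Q).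
Proof.
rewrite gamma2E gamE -[X in ev (eA _) _ X]mul1r legA4 (tsum_mulr _ _ (r (alpha Q)));
apply: eq_tsum => a y.
rewrite (tsum_mulr _ _ (r (alpha Q))); apply: eq_tsum => b z;
rewrite (tsum_mulr _ _ (r (alpha Q))); apply: eq_tsum => c d.
by rewrite ev_pure unopM /eA /= /a3 !mul1r mulr1 !mulrA !(rpA, rqA).
Qed.

Let tw_p x h : x * tw q r * p h = x * p h * tw q r.
Proof. by rewrite -!mulrA -ev_drinfeld_twist commP. Qed.
Let tw_r x h : x * r h * tw p q = x * tw p q * r h.
Proof. by rewrite -!mulrA -ev_drinfeld_twist commP. Qed.

(** Multiplying by [tw q r] turns the alpha of [q ⋆ r] into [gamma2 Q q r] and its antipode into
    [anti r ⋆ anti q]. What results is a contraction in the six single letters, to which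
    [kill_assoc6] applies. *)
Lemma tw_gamma_l : tw q r * gamma2 Q p (q ⋆ r)
  = ev (eA a3) idfun (gamma_legs Q q r * ev (iL (anti r ⋆ anti q)) (ev (iL (anti p))
      (ev (iR p) (iR (q ⋆ r)))) gA).
Proof.
rewrite legA4 Egam_qr gamma2E (tsum_mull _ _ (tw q r)); apply: eq_tsum => a y.
rewrite (tsum_mull _ _ (tw q r)); apply: eq_tsum => b z;
rewrite (tsum_mull _ _ (tw q r)); apply: eq_tsum => c d.
rewrite -tw_alpha unopM /anti opK !mulrA -[tw q r]mul1r !tw_p !mul1r.
rewrite -(mulrA (p _) (tw q r)) tw_anti !mulrA.
by rewrite !tw_p.
Qed.

Lemma tw_gamma_r : tw p q * gamma2 Q (p ⋆ q) r
  = ev (eA a3) idfun (gamma_legs Q p q * ev (iL (anti r)) (ev (iL (anti q ⋆ anti p))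
      (ev (iR (p ⋆ q)) (iR r))) gA).
Proof.
rewrite legA4 Egam_pq gamma2E (tsum_mull _ _ (tw p q)); apply: eq_tsum => a y.
rewrite (tsum_mull _ _ (tw p q)); apply: eq_tsum => b z;
rewrite (tsum_mull _ _ (tw p q)); apply: eq_tsum => c d.
by rewrite -tw_alpha unopM !mulrA tw_anti {2}/anti opK tw_r.
Qed.

(* By uniqueness of duals, [tw_pentagon] need only be checked after multiplication by
   the [alpha] of the triple product. *)
Lemma tw_pentagon_alpha :
  tw q r * gamma2 Q p (q ⋆ r) * F p q r = Santi p q r * (tw p q * gamma2 Q (p ⋆ q) r).
Proof.
rewrite tw_gamma_l tw_gamma_r !ev_gA.
have kl : evalP Q p (anti p) a3.
  move=> h; rewrite scalerAl -(dual_ev (@dual_point _ _ Q _ p _)) evE tsum_mulr.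
  by apply: eq_tsum => x y; rewrite /a3 !mulrA !(qpA, rpA).
have := @kill_assoc6 _ _ Q _ _ (ev (eA a3) idfun) _ (iL (anti r)) (iL (anti q))
  (iL (anti p)) (iR p) (iR q) (iR r) _ _ _ _ _ _ _ _ _ _ _ _ _ _ _ _ _ _ _ _ _
    (kill2 kl) 1.
rewrite !mulr1 /gamma_legs !cv_iL !cv_iR.
have -> : F (iR p) (iR q) (iR r) = 1 ⊗ F p q r :> T^c ⊗ T by rewrite /Phi3 !ev_iR.
have -> : F (iL (anti r)) (iL (anti q)) (iL (anti p))
  = F (anti r) (anti q) (anti p) ⊗ 1 :> T^c ⊗ T.
  by rewrite /Phi3 !ev_iL.
rewrite (legA _ _ 1) mul1r (legA _ _ _ 1) mulr1 => -> //.
Qed.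

End Pentagon.

(** This is [tw_anti] read in [T^c], where the reversed product also reverses the direction of the
    intertwiner. *)
Global Instance itw_tw p q `{!mor p} `{!mor q} `{!comm p q} :
  itw (op (tw p q)) (anti q ⋆ anti p) (anti (p ⋆ q)).
Proof. by move=> h; apply/esym; exact: (tw_anti h). Qed.

Global Instance itw_tw_comm p q r `{!mor p} `{!mor q} `{!comm p q} `{!comm p r}
    `{!comm q r} :
  itw (op (tw p q)) (anti r) (anti r).
Proof.
by move=> h; rewrite -opM -ev_drinfeld_twist /anti -(commP (p := ev p q)) -opM.
Qed.

Lemma tw_pentagon p q r `{!mor p} `{!mor q} `{!mor r} `{!comm p q} `{!comm p r}
    `{!comm q r} :
  tw q r * tw p (q ⋆ r) * F p q r = Santi p q r * tw p q * tw (p ⋆ q) r.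
Proof.
have d : dual Q (p ⋆ q ⋆ r) (anti (p ⋆ q ⋆ r)) ((p ⋆ q ⋆ r) (alpha Q))
  ((p ⋆ q ⋆ r) (beta Q))
  by exact: dual_point.
set w1 := LHS; set w2 := RHS.
have i1 : itw (op w1) (anti r ⋆ anti q ⋆ anti p) (anti (p ⋆ q ⋆ r)).
  rewrite /w1 !opM; apply: (itw_compose (g := anti (p ⋆ (q ⋆ r)))).
    by move=> h; apply/esym; exact: (itwP (w := F p q r) (antipode Q h)).
  exact: (itw_compose (g := anti (q ⋆ r) ⋆ anti p)).
have i2 : itw (op w2) (anti r ⋆ anti q ⋆ anti p) (anti (p ⋆ q ⋆ r)).
  rewrite /w2 !opM; apply: (itw_compose (g := anti r ⋆ anti (p ⋆ q))).
  exact: (itw_compose (g := anti r ⋆ (anti q ⋆ anti p))).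
have e : w1 * (p ⋆ q ⋆ r) (alpha Q) = w2 * (p ⋆ q ⋆ r) (alpha Q).
  rewrite /w1 /w2 -!mulrA (itwP (w := F p q r) (p' := p ⋆ (q ⋆ r))).
  rewrite (mulrA (tw p _)) !tw_alpha mulrA; exact: tw_pentagon_alpha.
(* [transport_uniq] admits any target alpha; the choice [w2 * (p ⋆ q ⋆ r) (alpha Q)] makes [w1] and
   [w2] the same transport. *)
have u1 : w1 = transport Q (anti r ⋆ anti q ⋆ anti p) (w2 * (p ⋆ q ⋆ r) (alpha Q))
    (p ⋆ q ⋆ r) ((p ⋆ q ⋆ r) (beta Q)) (anti (p ⋆ q ⋆ r)).
  by apply: (transport_uniq d) => // h; exact: esym (i1 h).
by rewrite u1; apply/esym/(transport_uniq d) => // h; exact: esym (i2 h).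
Qed.

Lemma tw_id p `{!mor p} :
  transport Q (anti p) (p (alpha Q)) p (p (beta Q)) (anti p) = 1.
Proof.
apply/esym; apply: (transport_uniq (@dual_point _ _ Q _ p _)) => [h|].
  by rewrite mul1r mulr1.
by rewrite mul1r.
Qed.

Lemma anti_triv : anti (triv Q T) = triv Q _.
Proof. by apply: funext => h; rewrite /anti /triv counit_antipode. Qed.

Lemma iL_triv (V W : algType k) : iL (triv Q V) = triv Q (tens V W).
Proof.
apply: funext => h; rewrite /iL /triv.
by rewrite -(linEZ (p := iL idfun)).
Qed.

(** With a trivial letter the reassociators in [gamma2] vanish and the counit of [alpha] is 1, so
    the twist compares the dual of [p] with itself. *)
Lemma tw_triv2 p `{!mor p} : tw p (triv Q T) = 1.
Proof.
rewrite /tw anti_triv !cv_trivr !cv_trivl /gamma2 /gamma_legs anti_triv iL_triv iR_triv.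
rewrite Phi3_triv1 Phi3V_triv3 mulr1 [ev _ _ 1]ev_pure /eA /= mul1r mulr1.
by rewrite {1}/triv counit_alpha scale1r mulr1 tw_id.
Qed.

Lemma tw_triv1 p `{!mor p} : tw (triv Q T) p = 1.
Proof.
rewrite /tw anti_triv !cv_trivl !cv_trivr /gamma2 /gamma_legs anti_triv iL_triv iR_triv.
rewrite Phi3_triv2 Phi3V_triv2 mulr1 [ev _ _ 1]ev_pure /eA /= mul1r mulr1.
by rewrite {1}/triv counit_alpha scale1r mul1r tw_id.
Qed.

End OneAlgebra.
End Twist.

(** * Comodule algebras at points *)

Section RightComodulePoints.
Variables (k : fieldType) (K : algType k) (Q : quasi_bialgebra K) (A : algType k).

Local Notation "p ⋆ q" := (cv (comul Q) p q) (at level 40, left associativity).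

Definition ev3 (U V W T : algType k) (x : U ⊗ V ⊗ W) (a : U -> T) (p : V -> T)
    (q : W -> T) : T :=
  ev a (ev p q) x.

Lemma ev3_inv (U V W T : algType k) (x y : U ⊗ V ⊗ W) (a : U -> T) (p : V -> T)
    (q : W -> T)
    `{!mor a} `{!mor p} `{!mor q} `{!comm a p} `{!comm a q} `{!comm p q} :
  inverse_of x y -> inverse_of (ev3 x a p q) (ev3 y a p q).
Proof. by apply: inverse_mor. Qed.

(** The comodule identities read at points. Quantifying over all targets allows the universal points
    to be substituted back. *)
Record right_points (rho : A -> A ⊗ K) (Phir : A ⊗ K ⊗ K) : Prop := RightPoints {
  right_itw : forall (T : algType k) (a : A -> T) (p q : K -> T)
      `{!mor a} `{!mor p} `{!mor q} `{!comm a p} `{!comm a q} `{!comm p q},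
    itw (ev3 Phir a p q) (cv rho (cv rho a p) q) (cv rho a (p ⋆ q));
  right_pentagon : forall (T : algType k) (a : A -> T) (p q r : K -> T)
      `{!mor a} `{!mor p} `{!mor q} `{!mor r} `{!comm a p} `{!comm a q} `{!comm a r}
      `{!comm p q} `{!comm p r} `{!comm q r},
    Phi3 Q p q r * ev3 Phir a (p ⋆ q) r * ev3 Phir a p q
    = ev3 Phir a p (q ⋆ r) * ev3 Phir (cv rho a p) q r;
  right_counit : forall (T : algType k) (a : A -> T) `{!mor a}, cv rho a (triv Q T) = a;
  right_counit2 : forall (T : algType k) (a : A -> T) (p : K -> T)
      `{!mor a} `{!mor p} `{!comm a p}, ev3 Phir a (triv Q T) p = 1;
  right_counit3 : forall (T : algType k) (a : A -> T) (p : K -> T)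
      `{!mor a} `{!mor p} `{!comm a p}, ev3 Phir a p (triv Q T) = 1
}.

Lemma right_comodule_points rho Phir :
  is_right_comodule_algebra Q rho Phir -> right_points rho Phir.
Proof.
case=> rl [r1 rM] _ co pe cu c2 c3.
have rm : mor rho by split.
split.
- move=> T a p q *; move=> u;
rewrite /ev3 [cv _ _ _ u]/cv -ev_tmapl -morM co morM ev_tmapr.
  by [].
- move=> T a p q r *; have := congr1 (ev a (ev p (ev q r))) pe.
  by rewrite !morM ev_1pure ev_tmaprl ev_tassoc3 ev_tmaprr ev_tmapl.
- by move=> T a am; apply: funext => u; rewrite /cv ev_trivr cu.
- move=> T a p *; rewrite /ev3.
  have := congr1 (ev a p) c2; rewrite ev_tmap [ev a p (_ ⊗ _)]ev_pure !mor1 mulr1 => <-.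
  by apply: eq_ev => // x; rewrite ev_trivl.
- move=> T a p *; rewrite /ev3.
  have := congr1 (ev a p) c3; rewrite ev_tmap [ev a p (_ ⊗ _)]ev_pure !mor1 mulr1 => <-.
  by apply: eq_ev => // x; rewrite ev_trivr.
Qed.

Lemma ev_id (V W : algType k) : ev (iL idfun) (iR idfun) = idfun :> (V ⊗ W -> _).
Proof. by apply: funext => t; rewrite ev_iLR_id. Qed.

Lemma ev3_id (U V W : algType k) (x : U ⊗ V ⊗ W) :
  ev (iL idfun) (ev (iR (iL idfun)) (iR (iR idfun))) x = x.
Proof. by rewrite ev_iR ev_id ev_id. Qed.

Lemma ev4_id (U V W Z : algType k) (x : U ⊗ V ⊗ W ⊗ Z) :
  ev (iL idfun) (ev (iR (iL idfun)) (ev (iR (iR (iL idfun))) (iR (iR (iR idfun)))))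
    x = x.
Proof. by rewrite !ev_iR !ev_id. Qed.

(** The points are taken to be the leg inclusions of the threefold or fourfold tensor product, where
    evaluation is the identity. *)
Lemma right_points_comodule rho Phir : mor rho ->
  (exists y, inverse_of Phir y) -> right_points rho Phir ->
  is_right_comodule_algebra Q rho Phir.
Proof.
move=> rm inv [itwP pe cu c2 c3]; split.
- exact: mor_lin.
- by split; [exact: mor1 | exact: morM].
- exact: inv.
- move=> a; rewrite -[LHS]ev3_id -[RHS]ev3_id !(morM (p := ev _ (ev _ _))).
  rewrite ev_tmapl ev_tmapr; exact: (itwP _ (iL idfun) (iR (iL idfun)) (iR (iR idfun))).
- rewrite -[LHS]ev4_id -[RHS]ev4_id !(morM (p := ev _ (ev _ (ev _ _)))).
  rewrite ev_1pure ev_tmaprl ev_tassoc3 ev_tmaprr ev_tmapl; exact: pe.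
- move=> a; have e : cv rho idfun (triv Q A) = idfun by exact: cu.
  by rewrite -[RHS]/(idfun a) -[in RHS]e /cv ev_trivr.
- rewrite -[LHS]ev_iLR_id ev_tmap -[RHS](c2 _ (iL idfun) (iR idfun)).
  by apply: eq_ev => // x; rewrite ev_trivl.
- rewrite -[LHS]ev_iLR_id ev_tmap -[RHS](c3 _ (iL idfun) (iR idfun)).
  by apply: eq_ev => // x; rewrite ev_trivr.
Qed.

(** * Twisting a right comodule algebra *)

Section Twisting.
Variables (rho : A -> A ⊗ K) (Phir : A ⊗ K ⊗ K) (V W : A ⊗ K).
Hypothesis rho_comodule : is_right_comodule_algebra Q rho Phir.
Hypothesis VW : inverse_of V W.
Hypothesis V_counit : contrr (counit Q) V = 1.

Let rho' a := V * rho a * W.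
Let Phir' := tmap idfun (comul Q) V * Phir * tmapl rho W * tassoc (W ⊗ 1).

#[local] Instance rho_mor : mor rho.
Proof. by case: rho_comodule => rl [r1 rM] *; split. Qed.

#[local] Instance rho'_mor : mor rho'.
Proof.
split=> [||x y]; rewrite /rho'.
- exact: lin_mull _ (lin_mulr _ (mor_lin (p := rho))).
- by rewrite (mor1 (p := rho)) mulr1 VW.1.
- by rewrite (morM (p := rho)) !mulrA -(mulrA _ W V) VW.2 mulr1.
Qed.

Let VWp (T : algType k) (a : A -> T) (p : K -> T) `{!mor a} `{!mor p} `{!comm a p} :
  inverse_of (ev a p V) (ev a p W).
Proof. exact: inverse_mor VW. Qed.

Let cv_rho' (T : algType k) (a : A -> T) (p : K -> T) `{!mor a} `{!mor p}
    `{!comm a p} u :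
  cv rho' a p u = ev a p V * cv rho a p u * ev a p W.
Proof. by rewrite /cv /rho' !morM. Qed.

#[local] Instance itwV (T : algType k) (a : A -> T) (p : K -> T) `{!mor a} `{!mor p}
    `{!comm a p} :
  itw (ev a p V) (cv rho a p) (cv rho' a p).
Proof. by move=> u; rewrite cv_rho' -!mulrA VWp.2 mulr1. Qed.

#[local] Instance itwW (T : algType k) (a : A -> T) (p : K -> T) `{!mor a} `{!mor p}
    `{!comm a p} :
  itw (ev a p W) (cv rho' a p) (cv rho a p).
Proof. by move=> u; rewrite cv_rho' !mulrA VWp.2 mul1r. Qed.

Let ev_Phir' (T : algType k) (a : A -> T) (p q : K -> T)
    `{!mor a} `{!mor p} `{!mor q} `{!comm a p} `{!comm a q} `{!comm p q} :
  ev3 Phir' a p q = ev a (p ⋆ q) V * ev3 Phir a p q * ev (cv rho a p) q W * ev a p W.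
Proof. by rewrite /ev3 /Phir' !morM ev_tmapr ev_tmapl ev_tassoc1. Qed.

Lemma twist_comodule : is_right_comodule_algebra Q rho' Phir'.
Proof.
have [itwP pe cu c2 c3] := right_comodule_points rho_comodule.
have [y iy] : exists y, inverse_of Phir y by case: rho_comodule.
apply: right_points_comodule => //.
  exists (tassoc (V ⊗ 1) * (tmapl rho V * (y * tmap idfun (comul Q) W))).
  rewrite -[Phir']ev3_id -[X in inverse_of _ X]ev3_id -/(ev3 _ _ _ _) ev_Phir'.
  rewrite !morM ev_tassoc1 ev_tmapl ev_tmapr -mulrA -mulrA.
  rewrite ![X in inverse_of _ X]mulrA.
  apply: inverseM; first exact: VWp.
  apply: inverseM; first exact: ev3_inv.
  by apply: inverseM; apply: inverseC; exact: VWp.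
split.
- move=> T a p q *; rewrite ev_Phir'.
  apply: (itw_compose (g := cv rho' (cv rho a p) q)).
  apply: (itw_compose (g := cv rho (cv rho a p) q)).
  exact: (itw_compose (g := cv rho a (p ⋆ q))).
- move=> T a p q r *; rewrite !ev_Phir'.
  have n1 : itw (Phi3 Q p q r) (ev a (p ⋆ q ⋆ r)) (ev a (p ⋆ (q ⋆ r))) by exact _.
  have n2 : itw (ev3 Phir a p q) (ev (cv rho (cv rho a p) q) r)
    (ev (cv rho a (p ⋆ q)) r) by exact _.
  have n3 : itw (ev a p W) (ev (cv rho' a p) (q ⋆ r)) (ev (cv rho a p) (q ⋆ r))
    by exact _.
  have n4 : itw (ev a p W) (ev (cv rho' a p) (ev q r)) (ev (cv rho a p) (ev q r))
    by exact _.
  have n5 : itw (ev a p W) (ev (cv rho (cv rho' a p) q) r)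
    (ev (cv rho (cv rho a p) q) r) by exact _.
  have n6 : itw (ev a p W) (ev (cv rho' a p) q) (ev (cv rho a p) q) by exact _.
  (* Left side: [Phi3] passes the outer [V], the inner pair of [W] and [V] cancels, and the
     untwisted pentagon becomes applicable. *)
  rewrite !mulrA n1.
  rewrite -(mulrA _ (ev a (p ⋆ q) W)) VWp.2 mulr1.
  rewrite -(mulrA _ (ev _ r W) (ev3 _ _ _ _)) -n2 !mulrA.
  rewrite -(mulrA _ (Phi3 _ _ _ _)) -(mulrA _ (_ * _) (ev3 _ _ _ _)) pe.
  (* Right side: [ev a p W] travels to the right end, changing [rho'] back to [rho] in every factor
     it passes, so that another pair of [V] and [W] cancels on the way. *)
  rewrite -(mulrA _ (ev a p W) (ev _ (q ⋆ r) V)) n3 !mulrA.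
  rewrite -(mulrA _ (ev (cv rho a p) (q ⋆ r) W)) VWp.2 mulr1.
  rewrite -(mulrA _ (ev a p W) (ev3 _ _ _ _)) n4 mulrA.
  rewrite -(mulrA _ (ev a p W) (ev _ r W)) n5 mulrA.
  by rewrite -(mulrA _ (ev a p W) (ev _ q W)) n6 !mulrA.
- move=> T a am; apply: funext => u.
  have V1 : ev a (triv Q T) V = 1 by rewrite ev_trivr V_counit mor1.
  have [] := VWp (a := a) (p := triv Q T); rewrite V1 mul1r => W1 _.
  by rewrite cv_rho' cu V1 W1 mul1r mulr1.
- move=> T a p *; have V1 : ev a (triv Q T) V = 1 by rewrite ev_trivr V_counit mor1.
  have [] := VWp (a := a) (p := triv Q T); rewrite V1 mul1r => W1 _.
  by rewrite ev_Phir' c2 cu cv_trivl W1 !mulr1 VWp.1.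
- move=> T a p *; have V1 : ev (cv rho a p) (triv Q T) V = 1
  by rewrite ev_trivr V_counit mor1.
  have [] := VWp (a := cv rho a p) (p := triv Q T); rewrite V1 mul1r => W1 _.
  by rewrite ev_Phir' c3 cv_trivr W1 !mulr1 VWp.1.
Qed.
End Twisting.

End RightComodulePoints.

(** * Reassociators of a bicomodule algebra at points *)

Section BicomodulePoints.
Variables (k : fieldType) (H : algType k) (Q : quasi_bialgebra H).
Variables (A : algType k) (M : bicomodule_algebra Q A) (T : algType k).

Local Notation "p ⋆ q" := (cv (comul Q) p q) (at level 40, left associativity).
Local Notation "p ⊳ a" := (cv (bc_lambda M) p a) (at level 40, left associativity).
Local Notation "a ⊲ p" := (cv (bc_rho M) a p) (at level 40, left associativity).

Global Instance mor_lambda : mor (bc_lambda M).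
Proof. by case: (bc_left M) => l [l1 lM] *; split. Qed.
Global Instance mor_rho : mor (bc_rho M).
Proof. by case: (bc_right M) => l [l1 lM] *; split. Qed.

Implicit Types (p q r : H -> T) (a : A -> T).

Definition PhL p q a : T := ev3 (bc_Phil M) p q a.
Definition PhLV p q a : T := ev3 (bc_PhilV M) p q a.
Definition PhR a p q : T := ev3 (bc_Phir M) a p q.
Definition PhX p a q : T := ev3 (bc_Philr M) p a q.
Definition PhXV p a q : T := ev3 (bc_PhilrV M) p a q.

Let right := right_comodule_points (bc_right M).

Section Three.
Variables (a : A -> T) (p q : H -> T).
Context `{!mor a} `{!mor p} `{!mor q} `{!comm p a} `{!comm p q} `{!comm q a}.

Lemma PhL_inv : inverse_of (PhL p q a) (PhLV p q a).
Proof. exact: ev3_inv (bc_Phil_inverse M). Qed.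
Lemma PhX_inv : inverse_of (PhX p a q) (PhXV p a q).
Proof. exact: ev3_inv (bc_Philr_inverse M). Qed.

Lemma PhXK : PhX p a q * PhXV p a q = 1.
Proof. by case: PhX_inv. Qed.

Global Instance itw_PhL : itw (PhL p q a) ((p ⋆ q) ⊳ a) (p ⊳ (q ⊳ a)) | 1.
Proof.
move=> u; rewrite /PhL /ev3 [cv _ _ _ u]/cv -ev_tmapl -morM -(lca_coassoc (bc_left M)).
by rewrite morM ev_tmapr.
Qed.
Global Instance itw_PhLV : itw (PhLV p q a) (p ⊳ (q ⊳ a)) ((p ⋆ q) ⊳ a) | 1.
Proof. by apply: (itw_inv (w := PhL p q a)); exact: PhL_inv. Qed.
Global Instance itw_PhX : itw (PhX p a q) (p ⊳ a ⊲ q) (p ⊳ (a ⊲ q)) | 1.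
Proof.
move=> u; rewrite /PhX /ev3 [cv _ _ _ u]/cv -ev_tmapl -morM (bc_coassoc M).
by rewrite morM ev_tmapr.
Qed.
Global Instance itw_PhXV : itw (PhXV p a q) (p ⊳ (a ⊲ q)) (p ⊳ a ⊲ q) | 1.
Proof. by apply: (itw_inv (w := PhX p a q)); exact: PhX_inv. Qed.
Global Instance itw_PhR : itw (PhR a p q) (a ⊲ p ⊲ q) (a ⊲ (p ⋆ q)) | 1.
Proof. exact: (right_itw right). Qed.

End Three.

Lemma lambda_triv a `{!mor a} : triv Q T ⊳ a = a.
Proof. by apply: funext => u; rewrite /cv ev_trivl (lca_counit (bc_left M)). Qed.
Lemma rho_triv a `{!mor a} : a ⊲ triv Q T = a.
Proof. exact: (right_counit right). Qed.

Section Four.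
Variables (a : A -> T) (p q r : H -> T).
Context `{!mor a} `{!mor p} `{!mor q} `{!mor r} `{!comm p a} `{!comm q a} `{!comm r a}
  `{!comm p q} `{!comm p r} `{!comm q r}.

Lemma pentagonL :
  PhL q r a * PhL p (q ⋆ r) a * Phi3 Q p q r = PhL p q (r ⊳ a) * PhL (p ⋆ q) r a.
Proof.
have := congr1 (ev p (ev q (ev r a))) (lca_pentagon (bc_left M)).
by rewrite !morM ev_1pure ev_tmaprl ev_tassoc3 ev_tmaprr ev_tmapl.
Qed.

Lemma pentagonR :
  Phi3 Q p q r * PhR a (p ⋆ q) r * PhR a p q = PhR a p (q ⋆ r) * PhR (a ⊲ p) q r.
Proof. exact: (right_pentagon right). Qed.

Lemma pentagonXl :
  PhX q a r * PhX p (q ⊳ a) r * PhL p q a = PhL p q (a ⊲ r) * PhX (p ⋆ q) a r.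
Proof.
have := congr1 (ev p (ev q (ev a r))) (bc_pentagonl M).
by rewrite !morM ev_1pure ev_tmaprl ev_tassoc3 ev_tmaprr ev_tmapl.
Qed.

Lemma pentagonXr :
  PhR a q r * PhX p (a ⊲ q) r * PhX p a q = PhX p a (q ⋆ r) * PhR (p ⊳ a) q r.
Proof.
have := congr1 (ev p (ev a (ev q r))) (bc_pentagonr M).
by rewrite !morM ev_1pure ev_tmaprl ev_tassoc3 ev_tmaprr ev_tmapl.
Qed.
End Four.

Section Two.
Variables (a : A -> T) (p : H -> T).
Context `{!mor a} `{!mor p} `{!comm p a}.

Lemma PhL_triv1 : PhL (triv Q T) p a = 1.
Proof.
rewrite /PhL /ev3 ev_trivl (lca_Phi_counit1 (bc_left M)).
by rewrite ev_pure !mor1 mulr1.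
Qed.
Lemma PhL_triv2 : PhL p (triv Q T) a = 1.
Proof.
rewrite /PhL /ev3.
have := congr1 (ev p a) (lca_Phi_counit2 (bc_left M)).
rewrite ev_tmap [ev p a (_ ⊗ _)]ev_pure !mor1 mulr1 => <-.
by apply: eq_ev => // x; rewrite ev_trivl.
Qed.
Lemma PhR_triv2 : PhR a (triv Q T) p = 1.
Proof. exact: (right_counit2 right). Qed.
Lemma PhR_triv3 : PhR a p (triv Q T) = 1.
Proof. exact: (right_counit3 right). Qed.
End Two.

Lemma PhLV_triv1 a p `{!mor a} `{!mor p} `{!comm p a} : PhLV (triv Q T) p a = 1.
Proof.
have [] : inverse_of (PhL (triv Q T) p a) (PhLV (triv Q T) p a) by exact: PhL_inv.
by rewrite PhL_triv1 mul1r.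
Qed.
Lemma PhLV_triv2 a p `{!mor a} `{!mor p} `{!comm p a} : PhLV p (triv Q T) a = 1.
Proof.
have [] : inverse_of (PhL p (triv Q T) a) (PhLV p (triv Q T) a) by exact: PhL_inv.
by rewrite PhL_triv2 mul1r.
Qed.

(* The axioms do not require [PhX] to be counital in its outer legs; it follows *)
(* from the mixed pentagons, [PhX] being invertible. *)
Lemma PhX_triv1 a p `{!mor a} `{!mor p} `{!comm p a} : PhX (triv Q T) a p = 1.
Proof.
have := @pentagonXl a (triv Q T) (triv Q T) p _ _ _ _ _ _ _ _ _ _.
rewrite lambda_triv cv_trivl !PhL_triv1 mulr1 mul1r => e.
have i : inverse_of (PhX (triv Q T) a p) (PhXV (triv Q T) a p) by exact: PhX_inv.
by apply: (inverse_idem i); rewrite e.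
Qed.
Lemma PhX_triv3 a p `{!mor a} `{!mor p} `{!comm p a} : PhX p a (triv Q T) = 1.
Proof.
have := @pentagonXr a p (triv Q T) (triv Q T) _ _ _ _ _ _ _ _ _ _.
rewrite rho_triv cv_trivr !PhR_triv3 mulr1 mul1r => e.
have i : inverse_of (PhX p a (triv Q T)) (PhXV p a (triv Q T)) by exact: PhX_inv.
by apply: (inverse_idem i); rewrite e.
Qed.
Lemma PhXV_triv1 a p `{!mor a} `{!mor p} `{!comm p a} : PhXV (triv Q T) a p = 1.
Proof.
have [] : inverse_of (PhX (triv Q T) a p) (PhXV (triv Q T) a p) by exact: PhX_inv.
by rewrite PhX_triv1 mul1r.
Qed.
Lemma PhXV_triv3 a p `{!mor a} `{!mor p} `{!comm p a} : PhXV p a (triv Q T) = 1.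
Proof.
have [] : inverse_of (PhX p a (triv Q T)) (PhXV p a (triv Q T)) by exact: PhX_inv.
by rewrite PhX_triv3 mul1r.
Qed.

Section PentagonWords.
Variables (a : A -> T) (p q r : H -> T).
Context `{!mor a} `{!mor p} `{!mor q} `{!mor r} `{!comm p a} `{!comm q a} `{!comm r a}
  `{!comm p q} `{!comm p r} `{!comm q r}.

Lemma pentagonLV :
  Phi3V Q p q r * PhLV p (q ⋆ r) a * PhLV q r a = PhLV (p ⋆ q) r a * PhLV p q (r ⊳ a).
Proof.
have [[_ _ e _ _] _] := pentagon_words (@PhL_inv a q r _ _ _ _ _ _)
  (@PhL_inv a p (q ⋆ r) _ _ _ _ _ _) (@Phi3_inv _ _ Q _ p q r _ _ _ _ _ _)
  (@PhL_inv (r ⊳ a) p q _ _ _ _ _ _) (@PhL_inv a (p ⋆ q) r _ _ _ _ _ _)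
  (@pentagonL a p q r _ _ _ _ _ _ _ _ _ _).
exact: e.
Qed.

Lemma pentagonXl_words :
  PhLV p q a * PhXV p (q ⊳ a) r * PhXV q a r = PhXV (p ⋆ q) a r * PhLV p q (a ⊲ r)
  /\ PhX (p ⋆ q) a r * PhLV p q a = PhLV p q (a ⊲ r) * PhX q a r * PhX p (q ⊳ a) r.
Proof.
have [[_ _ e _ _] e'] := pentagon_words (@PhX_inv a q r _ _ _ _ _ _)
  (@PhX_inv (q ⊳ a) p r _ _ _ _ _ _) (@PhL_inv a p q _ _ _ _ _ _)
  (@PhL_inv (a ⊲ r) p q _ _ _ _ _ _) (@PhX_inv a (p ⋆ q) r _ _ _ _ _ _)
  (@pentagonXl a p q r _ _ _ _ _ _ _ _ _ _).
by split.
Qed.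

Lemma pentagonXrV :
  PhXV p a (q ⋆ r) * PhR a q r = PhR (p ⊳ a) q r * PhXV p a q * PhXV p (a ⊲ q) r.
Proof.
rewrite -mulrA; apply: inv_sq.
- exact: PhX_inv.
- by apply: inverseM; exact: PhX_inv.
- by rewrite mulrA pentagonXr.
Qed.
End PentagonWords.

Section FiveLegs.
Variables (a : A -> T) (y z r s : H -> T).
Context `{!mor a} `{!mor y} `{!mor z} `{!mor r} `{!mor s} `{!comm y a} `{!comm z a}
  `{!comm r a} `{!comm s a} `{!comm y z} `{!comm y r} `{!comm y s} `{!comm z r}
  `{!comm z s} `{!comm r s}.

(** Both sides rebracket the word y((z(ar))s) into (yz)(a(rs)). It is the relation between the
    reassociators of [rho1] and [rho2] with the Drinfeld twist removed. *)
Lemma twist_relation :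
  PhLV y z (a ⊲ (r ⋆ s)) * PhR a r s * PhX z (a ⊲ r) s
  = PhX (y ⋆ z) a (r ⋆ s) * (PhR ((y ⋆ z) ⊳ a) r s * PhLV y z a * PhXV y (z ⊳ a) r)
    * PhXV y (z ⊳ a ⊲ r) s * PhXV z a r.
Proof.
have e1 := @pentagonXr a (y ⋆ z) r s _ _ _ _ _ _ _ _ _ _.
have [_ e2] := @pentagonXl_words a y z r _ _ _ _ _ _ _ _ _ _.
have [_ e3] := @pentagonXl_words (a ⊲ r) y z s _ _ _ _ _ _ _ _ _ _.
have n1 : itw (PhX z a r) (ev y (ev (z ⊳ a ⊲ r) s)) (ev y (ev (z ⊳ (a ⊲ r)) s))
  by exact _.
have n2 : itw (PhR a r s) (ev y (ev z (a ⊲ r ⊲ s))) (ev y (ev z (a ⊲ (r ⋆ s))))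
  by exact _.
(* The mixed pentagons break up the [PhX] factors with letter [y ⋆ z] on the right side, until the
   inverses standing there all cancel. *)
rewrite !mulrA -e1 // -(mulrA _ (PhX _ a r)) e2 !mulrA.
rewrite -(mulrA _ (PhX y _ r)) PhXK mulr1.
rewrite -(mulrA _ (PhX z a r)) n1 !mulrA -(mulrA _ (PhX z a r)) PhXK mulr1.
rewrite -(mulrA _ (PhX _ _ s)) e3 !mulrA.
rewrite -(mulrA _ (PhX y _ s)) PhXK mulr1.
by rewrite n2.
Qed.
End FiveLegs.

Section SevenLegs.
Variables (a : A -> T) (x y z r1 r2 r3 : H -> T).
Context `{!mor a} `{!mor x} `{!mor y} `{!mor z} `{!mor r1} `{!mor r2} `{!mor r3}
  `{!comm x a} `{!comm y a} `{!comm z a} `{!comm r1 a} `{!comm r2 a} `{!comm r3 a}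
  `{!comm x y} `{!comm x z} `{!comm x r1} `{!comm x r2} `{!comm x r3}
  `{!comm y z} `{!comm y r1} `{!comm y r2} `{!comm y r3}
  `{!comm z r1} `{!comm z r2} `{!comm z r3} `{!comm r1 r2} `{!comm r1 r3}
    `{!comm r2 r3}.

Local Notation G := (Phi3V Q).
Local Notation F := (Phi3 Q).

(** The core of [seven_legs]: two ways from x(y((za)r1)) to (((xy)z)a)r1, not involving [r2] and
    [r3]. *)
Let five :
  G x y z * PhLV x (y ⋆ z) a * PhXV x ((y ⋆ z) ⊳ a) r1 * PhLV y z a * PhXV y (z ⊳ a) r1
  = PhLV (x ⋆ y) z a * PhXV (x ⋆ y) (z ⊳ a) r1 * PhLV x y (z ⊳ a ⊲ r1).
Proof.
have n : itw (PhLV y z a) (ev x (ev (y ⊳ (z ⊳ a)) r1)) (ev x (ev ((y ⋆ z) ⊳ a) r1))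
  by exact _.
rewrite -(mulrA _ (PhXV x _ r1)) -n mulrA (@pentagonLV a x y z _ _ _ _ _ _ _ _ _ _).
rewrite -!mulrA (mulrA (PhLV x y _)).
by have [-> _] := @pentagonXl_words (z ⊳ a) x y r1 _ _ _ _ _ _ _ _ _ _.
Qed.

Lemma seven_legs :
  G x y z * F r1 r2 r3
    * (PhR ((x ⋆ (y ⋆ z)) ⊳ a) (r1 ⋆ r2) r3 * PhLV x (y ⋆ z) a
       * PhXV x ((y ⋆ z) ⊳ a) (r1 ⋆ r2))
    * (PhR ((y ⋆ z) ⊳ a) r1 r2 * PhLV y z a * PhXV y (z ⊳ a) r1)
  = PhR ((x ⋆ y ⋆ z) ⊳ a) r1 (r2 ⋆ r3) * PhLV (x ⋆ y) z a * PhXV (x ⋆ y) (z ⊳ a) r1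
    * (PhR ((x ⋆ y) ⊳ (z ⊳ a ⊲ r1)) r2 r3 * PhLV x y (z ⊳ a ⊲ r1)
       * PhXV x (y ⊳ (z ⊳ a ⊲ r1)) r2).
Proof.
have s1 := @pentagonXrV ((y ⋆ z) ⊳ a) x r1 r2 _ _ _ _ _ _ _ _ _ _.
have s2 : itw (PhLV x (y ⋆ z) a) (ev (x ⊳ ((y ⋆ z) ⊳ a)) (ev r1 r2))
  (ev ((x ⋆ (y ⋆ z)) ⊳ a) (ev r1 r2)) by exact _.
have s3 := @pentagonR ((x ⋆ (y ⋆ z)) ⊳ a) r1 r2 r3 _ _ _ _ _ _ _ _ _ _.
have s4 : itw (G x y z) (ev ((x ⋆ (y ⋆ z)) ⊳ a) (ev r1 (r2 ⋆ r3)))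
  (ev ((x ⋆ y ⋆ z) ⊳ a) (ev r1 (r2 ⋆ r3))) by exact _.
have s4' : itw (G x y z) (ev ((x ⋆ (y ⋆ z)) ⊳ a ⊲ r1) (ev r2 r3))
  (ev ((x ⋆ y ⋆ z) ⊳ a ⊲ r1) (ev r2 r3)) by exact _.
have s5 : itw (PhLV y z a) (ev x (ev (y ⊳ (z ⊳ a) ⊲ r1) r2))
  (ev x (ev ((y ⋆ z) ⊳ a ⊲ r1) r2)) by exact _.
have s5' : itw (PhXV y (z ⊳ a) r1) (ev x (ev (y ⊳ (z ⊳ a ⊲ r1)) r2))
  (ev x (ev (y ⊳ (z ⊳ a) ⊲ r1) r2)) by exact _.
have s6 : itw (PhXV (x ⋆ y) (z ⊳ a) r1) (ev ((x ⋆ y) ⊳ (z ⊳ a ⊲ r1)) (ev r2 r3))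
  (ev ((x ⋆ y) ⊳ (z ⊳ a) ⊲ r1) (ev r2 r3)) by exact _.
have s6' : itw (PhLV (x ⋆ y) z a) (ev ((x ⋆ y) ⊳ (z ⊳ a) ⊲ r1) (ev r2 r3))
  (ev ((x ⋆ y ⋆ z) ⊳ a ⊲ r1) (ev r2 r3)) by exact _.
rewrite !mulrA -(mulrA _ (PhXV x _ (r1 ⋆ r2))) s1 !mulrA.
rewrite -(mulrA _ (PhLV x (y ⋆ z) a) (PhR _ _ _)) s2 !mulrA.
rewrite -(mulrA _ (F r1 r2 r3)) -(mulrA _ (_ * _) (PhR _ r1 r2)) s3 !mulrA.
rewrite s4 -(mulrA _ (G x y z)) s4' !mulrA.
rewrite -(mulrA _ _ (PhLV y z a)) -s5 !mulrA -(mulrA _ _ (PhXV y _ _)) -s5' !mulrA.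
rewrite -[in RHS](mulrA _ (PhXV (x ⋆ y) _ _)) s6 [in RHS]mulrA.
rewrite -[in RHS](mulrA _ (PhLV (x ⋆ y) _ _)) s6' [in RHS]mulrA.
(* Both sides now begin with the same two right reassociators and end with the same [PhXV]; [five]
   identifies what lies between. *)
have := congr1 (fun w => PhR ((x ⋆ y ⋆ z) ⊳ a) r1 (r2 ⋆ r3)
  * PhR ((x ⋆ y ⋆ z) ⊳ a ⊲ r1) r2 r3 * w * PhXV x (y ⊳ (z ⊳ a ⊲ r1)) r2) five.
by rewrite !mulrA.
Qed.
End SevenLegs.

End BicomodulePoints.

(** * Sums over triple tensors *)

Section Tsum3.
Variables (k : fieldType) (U V W : algType k) (x : U ⊗ V ⊗ W).

Lemma linE_tsum3 (X T : lmodType k) (g : X -> T) (F : U -> V -> W -> X) : lin g ->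
  g (\tsum_(u, v, w <- x) F u v w) = \tsum_(u, v, w <- x) g (F u v w).
Proof. by move=> gl; rewrite (linE_tsum (g := g)); apply: eq_tsum => u y;
rewrite (linE_tsum (g := g)). Qed.

Lemma eq_tsum3 (T : nmodType) (F F' : U -> V -> W -> T) :
  (forall u v w, F u v w = F' u v w) ->
  \tsum_(u, v, w <- x) F u v w = \tsum_(u, v, w <- x) F' u v w.
Proof. by move=> e; apply: eq_tsum => u y; apply: eq_tsum. Qed.

Variable T : algType k.

Lemma tsum3_mull (F : U -> V -> W -> T) b :
  b * (\tsum_(u, v, w <- x) F u v w) = \tsum_(u, v, w <- x) b * F u v w.
Proof. by rewrite tsum_mull; apply: eq_tsum => u y; rewrite tsum_mull. Qed.

Lemma tsum3_mulr (F : U -> V -> W -> T) b :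
  (\tsum_(u, v, w <- x) F u v w) * b = \tsum_(u, v, w <- x) F u v w * b.
Proof. by rewrite tsum_mulr; apply: eq_tsum => u y; rewrite tsum_mulr. Qed.

Lemma ev3E (a : U -> T) (p : V -> T) (q : W -> T) :
  ev a (ev p q) x = \tsum_(u, v, w <- x) a u * (p v * q w).
Proof. by apply: eq_tsum => u y; rewrite tsum_mull. Qed.

End Tsum3.

Global Instance mor_compo (k : fieldType) (U V W : algType k) (g : V -> W) (f : U -> V)
  `{!mor g} `{!mor f} : mor (g \o f).
Proof.
split=> [a x y||x y] /=; first by rewrite (@mor_lin _ _ _ f _ a) (@mor_lin _ _ _ g _ a).
- by rewrite !mor1.
- by rewrite !morM.
Qed.

Global Instance comm_compo (k : fieldType) (U V U' V' : Type) (T : algType k)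
  (g : V -> T) (f : U -> V) (g' : V' -> T) (f' : U' -> V')
  `{!comm g g'} : comm (g \o f) (g' \o f').
Proof. by move=> x y; exact: (commP (p := g) (q := g')). Qed.

(** * Points of [H^op ⊗ H] *)

Section TensorPoints.
Variables (k : fieldType) (H H' : algType k).
Variables (Q : quasi_bialgebra H) (Q' : quasi_bialgebra H') (T : algType k).

Lemma tens_comul_pure a b :
  tens_comul Q Q' (a ⊗ b) = \tsum_(a1, a2 <- comul Q a) \tsum_(b1, b2 <- comul Q' b)
    (a1 ⊗ b1) ⊗ (a2 ⊗ b2).
Proof.
have b2 := shuffle_bilin H H' (@pure_bilin k H H').
apply: (tsum_pure (F := fun a b => shuffle (@pure k H H') (comul Q a) (comul Q' b))).
split=> [c|c] /=; first exact: (lin_comp (b2.1 _) (linearP (comul Q))).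
exact: (lin_comp (b2.2 _) (linearP (comul Q'))).
Qed.

Lemma split_pure (p : H ⊗ H' -> T) a b `{!mor p} : p (a ⊗ b) = p (a ⊗ 1) * p (1 ⊗ b).
Proof. by rewrite -morM pureM mulr1 mul1r. Qed.

Section Two.
Variables p q : H ⊗ H' -> T.
Context `{!mor p} `{!mor q} `{!comm p q}.

Lemma cv_tens a b :
  cv (comul (tens_quasi_bialgebra Q Q')) p q (a ⊗ b)
  = cv (comul Q) (p \o iL idfun) (q \o iL idfun) a
    * cv (comul Q') (p \o iR idfun) (q \o iR idfun) b.
Proof.
rewrite /cv -[comul _ _]/(tens_comul Q Q' (a ⊗ b)) tens_comul_pure.
rewrite (linE_tsum (g := ev p q)) evE tsum_mulr; apply: eq_tsum => a1 a2.
rewrite (linE_tsum (g := ev p q)) evE tsum_mull; apply: eq_tsum => b1 b2.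
rewrite ev_pure (split_pure a1) (split_pure a2) /iL /iR /= !mulrA.
by rewrite -(mulrA _ (p (1 ⊗ b1))) commP mulrA.
Qed.
End Two.

Lemma Phi3_tens (p q r : H ⊗ H' -> T) `{!mor p} `{!mor q} `{!mor r}
    `{!comm p q} `{!comm p r} `{!comm q r} :
  Phi3 (tens_quasi_bialgebra Q Q') p q r
  = Phi3 Q (p \o iL idfun) (q \o iL idfun) (r \o iL idfun)
    * Phi3 Q' (p \o iR idfun) (q \o iR idfun) (r \o iR idfun).
Proof.
have sw1 x y : p (1 ⊗ x) * q (y ⊗ 1) = q (y ⊗ 1) * p (1 ⊗ x) by exact: commP.
have sw2 x y : p (1 ⊗ x) * r (y ⊗ 1) = r (y ⊗ 1) * p (1 ⊗ x) by exact: commP.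
have sw3 x y : q (1 ⊗ x) * r (y ⊗ 1) = r (y ⊗ 1) * q (1 ⊗ x) by exact: commP.
have sA1 z x y : z * p (1 ⊗ x) * q (y ⊗ 1) = z * q (y ⊗ 1) * p (1 ⊗ x)
  by rewrite -!mulrA sw1.
have sA2 z x y : z * p (1 ⊗ x) * r (y ⊗ 1) = z * r (y ⊗ 1) * p (1 ⊗ x)
  by rewrite -!mulrA sw2.
have sA3 z x y : z * q (1 ⊗ x) * r (y ⊗ 1) = z * r (y ⊗ 1) * q (1 ⊗ x)
  by rewrite -!mulrA sw3.
rewrite /Phi3 -[Phi _]/(tens_3 (Phi Q) (Phi Q')) /tens_3
  (@linE_tsum3 _ _ _ _ _ _ _ (ev p (ev q r))).
rewrite !ev3E tsum3_mulr; apply: eq_tsum3 => x1 x2 x3.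
rewrite (@linE_tsum3 _ _ _ _ _ _ _ (ev p (ev q r))) tsum3_mull;
apply: eq_tsum3 => y1 y2 y3.
rewrite !ev_pure (split_pure x1) (split_pure x2) (split_pure x3) /iL /iR /= !mulrA.
by rewrite !(sA1, sA2, sA3).
Qed.

End TensorPoints.

Section OpTens.
Variables (k : fieldType) (H : algType k) (Q : quasi_hopf_algebra H).
Local Notation K := (op_tens Q).
Local Notation S' := (antipodeV Q).
Local Notation "p ⋆ q" := (cv (comul Q) p q) (at level 40, left associativity).

(** As an algebra map from [H] to its opposite, it turns the restriction of a point to the left
    factor into a point [lft] of [H] itself. *)
Definition opS' (h : H) : H^c := op (S' h).

Global Instance mor_opS' : mor opS'.
Proof.
have inj := can_inj (antipodeK Q).
split=> [a x y||x y]; rewrite /opS'.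
- apply: inj; rewrite antipodeVK -[LHS]/(a *: x + y) [RHS]linearP.
  by rewrite !antipodeVK.
- by apply: inj; rewrite antipodeVK antipode1.
- rewrite -opM; congr op; apply: inj.
  by rewrite antipodeM !antipodeVK.
Qed.

Section OneAlgebra.
Variable T : algType k.
Implicit Types (c : H^c ⊗ H -> T).

Definition lft c : H -> T := fun h => c (iL opS' h).
Definition rgt c : H -> T := fun h => c (iR idfun h).

Lemma point_pure c x y `{!mor c} : c (opS' x ⊗ y) = lft c x * rgt c y.
Proof. by rewrite split_pure. Qed.

Lemma lft_antipode c h : lft c (antipode Q h) = c (op h ⊗ 1).
Proof. by rewrite /lft /iL /opS' antipodeK. Qed.

Global Instance mor_lft c `{!mor c} : mor (lft c).
Proof. exact: (mor_compo (g := c) (f := iL opS')). Qed.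
Global Instance mor_rgt c `{!mor c} : mor (rgt c).
Proof. exact: (mor_compo (g := c) (f := iR idfun)). Qed.

Global Instance comm_lft_rgt c `{!mor c} : comm (lft c) (rgt c).
Proof. by move=> x y; rewrite /lft /rgt -!morM commP. Qed.
Global Instance comm_rgt_lft c `{!mor c} : comm (rgt c) (lft c).
Proof. exact: comm_sym. Qed.
Global Instance comm_lft c (V : Type) (p : V -> T) `{!comm p c} : comm p (lft c).
Proof. by move=> x y; exact: (commP (p := p) (q := c)). Qed.
Global Instance comm_lft' c (V : Type) (p : V -> T) `{!comm c p} : comm (lft c) p.
Proof. by move=> x y; exact: (commP (p := c) (q := p)). Qed.
Global Instance comm_rgt c (V : Type) (p : V -> T) `{!comm p c} : comm p (rgt c).
Proof. by move=> x y; exact: (commP (p := p) (q := c)). Qed.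
Global Instance comm_rgt' c (V : Type) (p : V -> T) `{!comm c p} : comm (rgt c) p.
Proof. by move=> x y; exact: (commP (p := c) (q := p)). Qed.

Lemma counit_pure x y : counit K (op x ⊗ y) = counit Q x * counit Q y.
Proof.
apply: (tsum_pure (F := fun a b => counit (op_quasi_bialgebra Q) a * counit Q b : k^o)).
split=> [b|a] /=; first exact: (lin_mull _ (linearP (counit (op_quasi_bialgebra Q)))).
exact: (lin_mulr _ (linearP (counit Q))).
Qed.

Lemma lft_triv : lft (triv K T) = triv Q T.
Proof.
apply: funext => h; rewrite /lft /triv /iL counit_pure rmorph1 mulr1.
by rewrite -counit_antipode antipodeVK.
Qed.

Lemma rgt_triv : rgt (triv K T) = triv Q T.
Proof.
apply: funext => h; rewrite /rgt /triv /iR.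
by rewrite -[1 ⊗ _]/(op 1 ⊗ h) counit_pure rmorph1 mul1r.
Qed.

Section Two.
Variables c d : H^c ⊗ H -> T.
Context `{!mor c} `{!mor d} `{!comm c d}.

Lemma rgt_cv : rgt (cv (comul K) c d) = rgt c ⋆ rgt d.
Proof.
apply: funext => h; rewrite /rgt {1}/iR cv_tens.
rewrite [cv _ (c \o iL _) _ 1]mor1 mul1r.
by [].
Qed.

(** The inverse antipode reverses the comultiplication only up to the Drinfeld twist. Writing [h] as
    the antipode of [antipodeV Q h] reduces this to [tw_anti]. *)
Global Instance itw_lft :
    itw (tw Q (lft d) (lft c)) (lft d ⋆ lft c) (lft (cv (comul K) c d)).
Proof.
move=> h; rewrite -[h in LHS](antipodeVK Q) tw_anti; congr (_ * _).
rewrite unop_anti /lft [in RHS]/iL cv_tens [X in _ = _ * X]mor1 mulr1.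
rewrite [RHS]/cv -[comul (op_quasi_bialgebra Q) _]/(op_comul Q (opS' h)) /op_comul
  (linE_tsum (g := ev _ _)).
apply: eq_tsum => x y; rewrite ev_pure -!/(lft _ _) !lft_antipode /= commP.
by [].
Qed.
End Two.

(** The opposite algebra has reassociator [PhiV], and composing [lft] with the antipode recovers the
    original left factor; this is where [anti] comes from. *)
Lemma Phi3_op_tens c d e `{!mor c} `{!mor d} `{!mor e} `{!comm c d} `{!comm c e}
    `{!comm d e} :
  Phi3 K c d e = unop (Phi3V Q (anti Q (lft c)) (anti Q (lft d)) (anti Q (lft e)))
    * Phi3 Q (rgt c) (rgt d) (rgt e).
Proof.
rewrite Phi3_tens; congr (_ * _).
rewrite /Phi3 -[Phi _]/(op_3 (PhiV Q)) /op_3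
  (@linE_tsum3 _ _ _ _ _ _ _ (ev _ (ev _ _))).
rewrite /Phi3V ev3E -[unop _]/(eU _) (@linE_tsum3 _ _ _ _ _ _ _ (@eU _ T));
apply: eq_tsum3 => x y z.
rewrite !ev_pure /eU !unopM /anti !opK !lft_antipode /= /iL.
have cd : c (op x ⊗ 1) * d (op y ⊗ 1) = d (op y ⊗ 1) * c (op x ⊗ 1) by exact: commP.
have ce : c (op x ⊗ 1) * e (op z ⊗ 1) = e (op z ⊗ 1) * c (op x ⊗ 1) by exact: commP.
have de : d (op y ⊗ 1) * e (op z ⊗ 1) = e (op z ⊗ 1) * d (op y ⊗ 1) by exact: commP.
by rewrite de mulrA ce -mulrA cd mulrA.
Qed.

(** [tw_pentagon] with its two reassociators moved across by inversion, to match the inverse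
    reassociator of the opposite algebra. *)
Lemma tw_pentagon_op c d e `{!mor c} `{!mor d} `{!mor e} `{!comm c d} `{!comm c e}
    `{!comm d e} :
  unop (Phi3V Q (anti Q (lft c)) (anti Q (lft d)) (anti Q (lft e)))
    * tw Q (lft d) (lft c) * tw Q (lft e) (lft d ⋆ lft c)
  = tw Q (lft e) (lft d) * tw Q (lft e ⋆ lft d) (lft c) * Phi3V Q (lft e) (lft d)
    (lft c).
Proof.
have pent := @tw_pentagon _ _ Q T (lft e) (lft d) (lft c) _ _ _ _ _ _.
have i1 : inverse_of (Phi3 Q (anti Q (lft c)) (anti Q (lft d)) (anti Q (lft e)))
  (Phi3V Q (anti Q (lft c)) (anti Q (lft d)) (anti Q (lft e))) by exact: Phi3_inv.
have i2 : inverse_of (Santi Q (lft e) (lft d) (lft c))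
   (unop (Phi3V Q (anti Q (lft c)) (anti Q (lft d)) (anti Q (lft e)))).
  by case: i1 => h1 h2; split; rewrite /Santi -unopM ?h1 ?h2.
rewrite -mulrA; apply: (inv_sq i2); first exact: Phi3_inv.
by rewrite mulrA -pent.
Qed.

End OneAlgebra.
End OpTens.

(** * The coactions [rho1] and [rho2] *)

Section TwoCoactionsPoints.
Variables (k : fieldType) (H : algType k) (Q : quasi_hopf_algebra H).
Variables (A : algType k) (M : bicomodule_algebra Q A).
Local Notation K := (op_tens Q).
Local Notation "p ⋆ q" := (cv (comul Q) p q) (at level 40, left associativity).
Local Notation "p ⊳ a" := (cv (bc_lambda M) p a) (at level 40, left associativity).
Local Notation "a ⊲ p" := (cv (bc_rho M) a p) (at level 40, left associativity).

Section Points.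
Variables (T : algType k) (a : A -> T) (c d : H^c ⊗ H -> T).
Context `{!mor a} `{!mor c} `{!mor d} `{!comm c a} `{!comm d a} `{!comm c d}.

Lemma cv_rho1 : cv (rho1 M) a c = lft Q c ⊳ a ⊲ rgt c.
Proof.
apply: funext => u; rewrite /cv /rho1 (linE_tsum (g := ev a c));
apply: eq_tsum => u0 u1.
rewrite (linE_tsum (g := ev a c)) evE tsum_mulr; apply: eq_tsum => u0m u00.
by rewrite ev_pure point_pure mulrA (commP (p := lft Q c) (q := a)).
Qed.

Lemma cv_rho2 : cv (rho2 M) a c = lft Q c ⊳ (a ⊲ rgt c).
Proof.
apply: funext => u; rewrite /cv /rho2 (linE_tsum (g := ev a c));
apply: eq_tsum => um u0.
rewrite (linE_tsum (g := ev a c)) evE tsum_mull; apply: eq_tsum => u00 u01.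
by rewrite ev_pure point_pure mulrA -(commP (p := lft Q c) (q := a)) mulrA.
Qed.

Let l1 := lft Q c.
Let l2 := lft Q d.
Let r1 := rgt c.
Let r2 := rgt d.

(** The rules collected in [sort] bring words in commuting letters into the order [l2], [l1], [a],
    [r1], [r2]. *)
Let s1 x y : l1 x * l2 y = l2 y * l1 x.
Proof. by rewrite /l1 /l2 /r1 /r2 ?(commP (p := lft Q d) (q := a)) commP. Qed.
Let s2 x y : a x * l2 y = l2 y * a x.
Proof. by rewrite /l1 /l2 /r1 /r2 ?(commP (p := lft Q d) (q := a)) commP. Qed.
Let s3 x y : a x * l1 y = l1 y * a x.
Proof. by rewrite /l1 /l2 /r1 /r2 ?(commP (p := lft Q d) (q := a)) commP. Qed.
Let s4 x y : r1 x * l2 y = l2 y * r1 x.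
Proof. by rewrite /l1 /l2 /r1 /r2 ?(commP (p := lft Q d) (q := a)) commP. Qed.
Let s5 x y : r1 x * l1 y = l1 y * r1 x.
Proof. by rewrite /l1 /l2 /r1 /r2 ?(commP (p := lft Q d) (q := a)) commP. Qed.
Let s6 x y : r1 x * a y = a y * r1 x.
Proof. by rewrite /l1 /l2 /r1 /r2 ?(commP (p := lft Q d) (q := a)) commP. Qed.
Let s7 x y : r2 x * l2 y = l2 y * r2 x.
Proof. by rewrite /l1 /l2 /r1 /r2 ?(commP (p := lft Q d) (q := a)) commP. Qed.
Let s8 x y : r2 x * l1 y = l1 y * r2 x.
Proof. by rewrite /l1 /l2 /r1 /r2 ?(commP (p := lft Q d) (q := a)) commP. Qed.
Let s9 x y : r2 x * a y = a y * r2 x.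
Proof. by rewrite /l1 /l2 /r1 /r2 ?(commP (p := lft Q d) (q := a)) commP. Qed.
Let s0 x y : r2 x * r1 y = r1 y * r2 x.
Proof. by rewrite /l1 /l2 /r1 /r2 ?(commP (p := lft Q d) (q := a)) commP. Qed.
Let sA (U V : Type) (p : U -> T) (q : V -> T) (e : forall x y, p x * q y = q y * p x) z
    x y :
  z * p x * q y = z * q y * p x.
Proof. by rewrite -!mulrA e. Qed.
Let sort := (s1, s2, s3, s4, s5, s6, s7, s8, s9, s0,
  sA s1, sA s2, sA s3, sA s4, sA s5, sA s6, sA s7, sA s8, sA s9, sA s0).

(** Since different letters commute, the explicit sum regroups into the values of the four tensors
    it is made of; equal letters keep their order. *)
Lemma ev3_Phi_rho1 : ev3 (Phi_rho1 M) a c d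
  = tw Q l2 l1 * (PhR M ((l2 ⋆ l1) ⊳ a) r1 r2 * PhLV M l2 l1 a * PhXV M l2 (l1 ⊳ a) r1).
Proof.
rewrite /Phi_rho1 /ev3 (@linE_tsum3 _ _ _ _ _ _ _ (ev a (ev c d))).
rewrite /PhR /PhLV /PhXV /ev3 [X in _ = _ * (X * _ * _)]ev3E.
rewrite -mulrA tsum3_mulr tsum3_mull; apply: eq_tsum3 => X1 X2 X3.
rewrite (@linE_tsum3 _ _ _ _ _ _ _ (ev a (ev c d))).
rewrite [X in _ = _ * (_ * (X * _))]ev3E tsum3_mulr 2!tsum3_mull;
apply: eq_tsum3 => x1 x2 x3.
rewrite (@linE_tsum3 _ _ _ _ _ _ _ (ev a (ev c d))).
rewrite [X in _ = _ * (_ * (_ * X))]ev3E 3!tsum3_mull; apply: eq_tsum3 => t1 t2 t3.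
rewrite -ev_drinfeld_twist (evE l2 l1) tsum_mulr (linE_tsum (g := ev a (ev c d))).
apply: eq_tsum => f1 f2.
rewrite (linE_tsum (g := ev a (ev c d))) [(_ ⊳ a) X1]/cv (evE (l2 ⋆ l1) a) !mulrA.
rewrite (tsum_mull _ _ (l2 f1 * l1 f2)) !tsum_mulr; apply: eq_tsum => X1m X10.
rewrite (linE_tsum (g := ev a (ev c d))) [(_ ⋆ _) X1m]/cv (evE l2 l1) tsum_mulr.
rewrite (tsum_mull _ _ (l2 f1 * l1 f2)) !tsum_mulr; apply: eq_tsum => X1m1 X1m2.
rewrite (linE_tsum (g := ev a (ev c d))) [(_ ⊳ a) t2]/cv (evE l1 a).
rewrite tsum_mull !tsum_mulr; apply: eq_tsum => t2m t20.
by rewrite !ev_pure !point_pure -/l1 -/l2 -/r1 -/r2 !morM !mulrA !sort.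
Qed.

Lemma ev3_Phi_rho2 : ev3 (Phi_rho2 M) a c d
  = tw Q l2 l1 * (PhLV M l2 l1 (a ⊲ (r1 ⋆ r2)) * PhR M a r1 r2 * PhX M l1 (a ⊲ r1) r2).
Proof.
rewrite /Phi_rho2 /ev3 (@linE_tsum3 _ _ _ _ _ _ _ (ev a (ev c d))).
rewrite /PhR /PhLV /PhX /ev3 [X in _ = _ * (X * _ * _)]ev3E.
rewrite -mulrA tsum3_mulr tsum3_mull; apply: eq_tsum3 => x1 x2 x3.
rewrite (@linE_tsum3 _ _ _ _ _ _ _ (ev a (ev c d))).
rewrite [X in _ = _ * (_ * (X * _))]ev3E tsum3_mulr 2!tsum3_mull;
apply: eq_tsum3 => X1 X2 X3.
rewrite (@linE_tsum3 _ _ _ _ _ _ _ (ev a (ev c d))).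
rewrite [X in _ = _ * (_ * (_ * X))]ev3E 3!tsum3_mull; apply: eq_tsum3 => t1 t2 t3.
rewrite -ev_drinfeld_twist (evE l2 l1) tsum_mulr (linE_tsum (g := ev a (ev c d))).
apply: eq_tsum => f1 f2.
rewrite (linE_tsum (g := ev a (ev c d))) [(a ⊲ _) x3]/cv (evE a (r1 ⋆ r2)) !mulrA.
rewrite tsum_mull !tsum_mulr; apply: eq_tsum => x30 x31.
rewrite (linE_tsum (g := ev a (ev c d))) [(_ ⋆ _) x31]/cv (evE r1 r2) !mulrA.
rewrite tsum_mull !tsum_mulr; apply: eq_tsum => x311 x312.
rewrite (linE_tsum (g := ev a (ev c d))) [(a ⊲ _) t2]/cv (evE a r1) !mulrA.
rewrite tsum_mull !tsum_mulr; apply: eq_tsum => t20 t21.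
by rewrite !ev_pure !point_pure -/l1 -/l2 -/r1 -/r2 !morM !mulrA !sort.
Qed.

End Points.
End TwoCoactionsPoints.

(** * Comodule axioms for both coactions and the twist between them *)

Section Comodules.
Variables (k : fieldType) (H : algType k) (Q : quasi_hopf_algebra H).
Variables (A : algType k) (M : bicomodule_algebra Q A).
Local Notation K := (op_tens Q).
Local Notation "p ⋆ q" := (cv (comul Q) p q) (at level 40, left associativity).
Local Notation "p ⊳ a" := (cv (bc_lambda M) p a) (at level 40, left associativity).
Local Notation "a ⊲ p" := (cv (bc_rho M) a p) (at level 40, left associativity).

#[local] Instance mor_rho1 : mor (rho1 M).
Proof.
(* [rho1] is its own value at the universal points, where [cv_rho1] exhibits it as an iterated
   action of points. *)
suff -> : rho1 M = cv (rho1 M) (iL idfun) (iR idfun) by rewrite cv_rho1; exact _.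
by apply: funext => u; rewrite /cv ev_iLR_id.
Qed.

Lemma Phi_rho1_invertible : exists y, inverse_of (Phi_rho1 M) y.
Proof.
have [y iy] : exists y, inverse_of (bc_Phir M) y by case: (bc_right M).
rewrite -[Phi_rho1 M]ev3_id -/(ev3 _ _ _ _) ev3_Phi_rho1.
eexists; apply: inverseM; first exact: tw_inv.
apply: inverseM; last by apply: inverseC; exact: PhX_inv.
apply: inverseM; last by apply: inverseC; exact: PhL_inv.
exact: ev3_inv iy.
Qed.

Section RightPoints.
Variables (T : algType k) (a : A -> T) (c d e : H^c ⊗ H -> T).
Context `{!mor a} `{!mor c} `{!mor d} `{!mor e} `{!comm a c} `{!comm a d} `{!comm a e}
  `{!comm c d} `{!comm c e} `{!comm d e}.

Lemma Phi_rho1_itw :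
  itw (ev3 (Phi_rho1 M) a c d) (cv (rho1 M) (cv (rho1 M) a c) d)
      (cv (rho1 M) a (cv (comul K) c d)).
Proof.
rewrite ev3_Phi_rho1 !cv_rho1 rgt_cv.
apply: (itw_compose (g := (lft Q d ⋆ lft Q c) ⊳ a ⊲ (rgt c ⋆ rgt d))).
apply: (itw_compose (g := lft Q d ⊳ (lft Q c ⊳ a) ⊲ rgt c ⊲ rgt d)).
exact: (itw_compose (g := (lft Q d ⋆ lft Q c) ⊳ a ⊲ rgt c ⊲ rgt d)).
Qed.

Local Notation l1 := (lft Q c).
Local Notation l2 := (lft Q d).
Local Notation l3 := (lft Q e).
Local Notation r1 := (rgt c).
Local Notation r2 := (rgt d).
Local Notation r3 := (rgt e).

Let conjM (w x x' y y' : T) : w * x = x' * w -> w * y = y' * w -> w * (x * y)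
    = x' * y' * w.
Proof. by move=> wx wy; rewrite mulrA wx -mulrA wy mulrA. Qed.

Lemma Phi_rho1_pentagon :
  Phi3 K c d e * ev3 (Phi_rho1 M) a (cv (comul K) c d) e * ev3 (Phi_rho1 M) a c d
  = ev3 (Phi_rho1 M) a c (cv (comul K) d e) * ev3 (Phi_rho1 M) (cv (rho1 M) a c) d e.
Proof.
rewrite !ev3_Phi_rho1 !cv_rho1 !rgt_cv Phi3_op_tens.
set l12 := lft Q (cv _ c d); set l23 := lft Q (cv _ d e).
(* Conjugation by the twist trades [l12], the left point of the product, for [l2 ⋆ l1] in each
   factor; [c23] does this for [l23]. *)
have c12 : tw Q l2 l1 * (tw Q l3 (l2 ⋆ l1) * (PhR M ((l3 ⋆ (l2 ⋆ l1)) ⊳ a) (r1 ⋆ r2) r3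
      * PhLV M l3 (l2 ⋆ l1) a * PhXV M l3 ((l2 ⋆ l1) ⊳ a) (r1 ⋆ r2)))
    = tw Q l3 l12 * (PhR M ((l3 ⋆ l12) ⊳ a) (r1 ⋆ r2) r3
      * PhLV M l3 l12 a * PhXV M l3 (l12 ⊳ a) (r1 ⋆ r2)) * tw Q l2 l1.
  have n1 : itw (tw Q l2 l1) (ev l3 (l2 ⋆ l1)) (ev l3 l12) by exact _.
  have n2 : itw (tw Q l2 l1) (ev ((l3 ⋆ (l2 ⋆ l1)) ⊳ a) (ev (r1 ⋆ r2) r3))
    (ev ((l3 ⋆ l12) ⊳ a) (ev (r1 ⋆ r2) r3)) by exact _.
  have n3 : itw (tw Q l2 l1) (ev l3 (ev (l2 ⋆ l1) a)) (ev l3 (ev l12 a)) by exact _.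
  have n4 : itw (tw Q l2 l1) (ev l3 (ev ((l2 ⋆ l1) ⊳ a) (r1 ⋆ r2)))
    (ev l3 (ev (l12 ⊳ a) (r1 ⋆ r2))) by exact _.
  apply: conjM; first by rewrite -(@ev_drinfeld_twist _ _ Q T l3 (l2 ⋆ l1))
    -(@ev_drinfeld_twist _ _ Q T l3 l12).
  apply: conjM; last exact: n4.
  by apply: conjM; [exact: n2 | exact: n3].
have c23 : tw Q l3 l2 * (tw Q (l3 ⋆ l2) l1 * (PhR M ((l3 ⋆ l2 ⋆ l1) ⊳ a) r1 (r2 ⋆ r3)
      * PhLV M (l3 ⋆ l2) l1 a * PhXV M (l3 ⋆ l2) (l1 ⊳ a) r1))
    = tw Q l23 l1 * (PhR M ((l23 ⋆ l1) ⊳ a) r1 (r2 ⋆ r3)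
      * PhLV M l23 l1 a * PhXV M l23 (l1 ⊳ a) r1) * tw Q l3 l2.
  have n1 : itw (tw Q l3 l2) (ev (l3 ⋆ l2) l1) (ev l23 l1) by exact _.
  have n2 : itw (tw Q l3 l2) (ev ((l3 ⋆ l2 ⋆ l1) ⊳ a) (ev r1 (r2 ⋆ r3)))
    (ev ((l23 ⋆ l1) ⊳ a) (ev r1 (r2 ⋆ r3))) by exact _.
  have n3 : itw (tw Q l3 l2) (ev (l3 ⋆ l2) (ev l1 a)) (ev l23 (ev l1 a)) by exact _.
  have n4 : itw (tw Q l3 l2) (ev (l3 ⋆ l2) (ev (l1 ⊳ a) r1)) (ev l23 (ev (l1 ⊳ a) r1))
    by exact _.
  apply: conjM; first by rewrite -(@ev_drinfeld_twist _ _ Q T (l3 ⋆ l2) l1)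
    -(@ev_drinfeld_twist _ _ Q T l23 l1).
  apply: conjM; last exact: n4.
  by apply: conjM; [exact: n2 | exact: n3].
have f1 : Phi3 Q r1 r2 r3 * tw Q l2 l1 = tw Q l2 l1 * Phi3 Q r1 r2 r3.
  by rewrite -ev_drinfeld_twist; exact: (commP (p := ev r1 (ev r2 r3))).
have f2 : Phi3 Q r1 r2 r3 * tw Q l3 (l2 ⋆ l1) = tw Q l3 (l2 ⋆ l1) * Phi3 Q r1 r2 r3.
  by rewrite -ev_drinfeld_twist; exact: (commP (p := ev r1 (ev r2 r3))).
have p1 := @tw_pentagon_op _ _ Q T c d e _ _ _ _ _ _.
have p2 := @seven_legs _ _ Q A M T a l3 l2 l1 r1 r2
  r3 _ _ _ _ _ _ _ _ _ _ _ _ _ _ _ _ _ _ _ _ _ _ _ _ _ _ _ _.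
(* Now all twists can be gathered in front: [tw_pentagon_op] matches them, leaving the reassociators
   to [seven_legs]. *)
rewrite [RHS]mulrA -c23 -[LHS]mulrA [X in _ * X]mulrA -c12.
rewrite !mulrA -(mulrA _ _ (tw Q l2 l1)) f1 !mulrA.
rewrite -(mulrA _ _ (tw Q l3 (l2 ⋆ l1))) f2 !mulrA p1 //.
have := congr1 (fun w => tw Q l3 l2 * tw Q (l3 ⋆ l2) l1 * w)
  (p2 _ _ _ _ _ _ _ _ _ _ _ _ _ _
  _ _ _ _ _ _ _ _ _ _ _ _ _ _).
by rewrite !mulrA => ->.
Qed.

(** This is [twist_relation] with the Drinfeld twist restored: moving [PhX] across it replaces
    [l2 ⋆ l1] by the left point of the product. *)
Lemma Phi_rho2_points : ev3 (Phi_rho2 M) a c d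
  = PhX M (lft Q (cv (comul K) c d)) a (r1 ⋆ r2) * ev3 (Phi_rho1 M) a c d
    * PhXV M l2 (l1 ⊳ a ⊲ r1) r2 * PhXV M l1 a r1.
Proof.
rewrite ev3_Phi_rho2 ev3_Phi_rho1; set l12 := lft Q (cv _ c d).
have n : itw (tw Q l2 l1) (ev (l2 ⋆ l1) (ev a (r1 ⋆ r2))) (ev l12 (ev a (r1 ⋆ r2)))
  by exact _.
rewrite [X in _ = X * _ * _]mulrA -[PhX M l12 _ _]/(ev l12 (ev a (r1 ⋆ r2)) _) -n.
by rewrite -!(mulrA (tw Q l2 l1)) (@twist_relation _ _ Q A M T a l2 l1 r1 r2).
Qed.

End RightPoints.

Lemma rho1_comodule : is_right_comodule_algebra K (rho1 M) (Phi_rho1 M).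
Proof.
apply: right_points_comodule Phi_rho1_invertible _.
split.
- by move=> *; exact: Phi_rho1_itw.
- by move=> *; exact: Phi_rho1_pentagon.
- by move=> T a am; rewrite cv_rho1 lft_triv rgt_triv lambda_triv rho_triv.
- move=> T a p *; rewrite ev3_Phi_rho1 lft_triv rgt_triv tw_triv2.
  by rewrite PhR_triv2 PhLV_triv2 PhXV_triv3 !mulr1.
- move=> T a p *; rewrite ev3_Phi_rho1 lft_triv rgt_triv tw_triv1.
  by rewrite PhR_triv3 PhLV_triv1 PhXV_triv1 !mulr1.
Qed.

(** For [bc_Philr] this is $Θ^2 ⊗ (S^{-1}(Θ^1) ⊗ Θ^3)$, the twisting element. *)
Definition coaction_twist (x : H ⊗ A ⊗ H) : A ⊗ (H^c ⊗ H) :=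
  ev3 x (lft Q (iR idfun)) (iL idfun) (rgt (iR idfun)).

Lemma ev_coaction_twist x (T : algType k) (a : A -> T) (c : H^c ⊗ H -> T)
    `{!mor a} `{!mor c} `{!comm a c} :
  ev a c (coaction_twist x) = ev3 x (lft Q c) a (rgt c).
Proof.
rewrite /coaction_twist /ev3 mor_ev3; apply: eq_ev => [h|y] /=.
  by rewrite /lft /iR ev_pure mor1 mul1r.
apply: eq_ev => [u|h] /=; first by rewrite /iL ev_pure mor1 mulr1.
by rewrite /rgt {1}/iR ev_pure mor1 mul1r.
Qed.


Local Notation V := (coaction_twist (bc_Philr M)).
Local Notation W := (coaction_twist (bc_PhilrV M)).

Lemma coaction_twist_inverse : inverse_of V W.
Proof. exact: ev3_inv (bc_Philr_inverse M). Qed.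

Lemma coaction_twist_counit : contrr (counit K) V = 1.
Proof.
rewrite -[LHS]/(idfun _) -ev_trivr ev_coaction_twist lft_triv rgt_triv.
exact: PhX_triv1.
Qed.

Lemma rho2_twist u : rho2 M u = V * rho1 M u * W.
Proof.
rewrite -[LHS]ev_iLR_id -[RHS]ev_iLR_id -[LHS]/(cv (rho2 M) _ _ u) cv_rho2.
rewrite !(morM (p := ev _ _)) !ev_coaction_twist
  -[ev _ _ (rho1 M u)]/(cv (rho1 M) _ _ u) cv_rho1.
set l := lft Q _; set r := rgt _; set a := iL _.
rewrite -/(PhX M l a r) -/(PhXV M l a r).
have -> : itw (PhX M l a r) (l ⊳ a ⊲ r) (l ⊳ (a ⊲ r)) by exact _.
by rewrite -mulrA PhXK mulr1.
Qed.

Lemma Phi_rho2_twist : Phi_rho2 M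
  = tmap idfun (comul K) V * Phi_rho1 M * tmapl (rho1 M) W * tassoc (W ⊗ 1).
Proof.
rewrite -[LHS]ev3_id -[RHS]ev3_id -/(ev3 (Phi_rho2 M) _ _ _) Phi_rho2_points.
rewrite !(morM (p := ev _ (ev _ _))) ev_tmapr ev_tmapl ev_tassoc1.
by rewrite -/(ev3 (Phi_rho1 M) _ _ _) !ev_coaction_twist !cv_rho1 rgt_cv.
Qed.

Lemma rho2_comodule : is_right_comodule_algebra K (rho2 M) (Phi_rho2 M).
Proof.
have -> : rho2 M = fun u => V * rho1 M u * W by apply: funext => u; exact: rho2_twist.
rewrite Phi_rho2_twist.
exact: twist_comodule rho1_comodule coaction_twist_inverse coaction_twist_counit.
Qed.

End Comodules.

Theorem proposition3p3 (k : fieldType) (H : algType k)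
    (Q : quasi_hopf_algebra H) (A : algType k) (M : bicomodule_algebra Q A) :
  [/\ is_right_comodule_algebra (op_tens Q) (rho1 M) (Phi_rho1 M),
      is_right_comodule_algebra (op_tens Q) (rho2 M) (Phi_rho2 M) &
      twist_equivalent (op_tens Q)
        (rho1 M) (Phi_rho1 M) (rho2 M) (Phi_rho2 M)].
Proof.
split; [exact: rho1_comodule | exact: rho2_comodule |].
exists (coaction_twist Q (bc_Philr M)), (coaction_twist Q (bc_PhilrV M)); split.
- exact: coaction_twist_inverse.
- exact: coaction_twist_counit.
- exact: rho2_twist.
- exact: Phi_rho2_twist.
Qed.
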